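(* The group $(E_6)^{\sigma_3}\cap(E_6)^{\nu_3}$ is isomorphic to $(Sp(1)\times U(1)\times U(1)\times U(1)\times SU(2)\times SU(2))/(\mathbb{Z}_2\times\mathbb{Z}_2\times\mathbb{Z}_4)$, where the first $\mathbb{Z}_2$ is $\{(1,1,1,1,E,E),(1,1,-1,1,E,-E)\}$, the second $\mathbb{Z}_2$ is $\{(1,1,1,1,E,E),(1,1,-1,-1,-E,E)\}$, and $\mathbb{Z}_4=\{(1,1,1,1,E,E),(1,-1,-1,1,E,E),(-1,i,i,1,-E,E),(-1,-i,-i,1,-E,E)\}$.
   Context: Let $\mathbf{H}$ be the quaternions with units $e_1,e_2,e_3=e_1e_2$, and $\mathbf{C}=\{x+ye_1: x,y\in\mathbb{R}\}\subset\mathbf{H}$. Let $\mathfrak{C}=\mathbf{H}\oplus\mathbf{H}e_4$ be the division Cayley algebra with multiplication $(m+ne_4)(p+qe_4)=(mp-\bar q n)+(n\bar p+qm)e_4$ and conjugation $\overline{m+ne_4}=\bar m-ne_4$. Let $\mathfrak{J}=\{X\in M(3,\mathfrak{C}):X^*=X\}$, with elements $X=\begin{pmatrix}\xi_1&x_3&\overline{x_2}\\ \overline{x_3}&\xi_2&x_1\\ x_2&\overline{x_1}&\xi_3\end{pmatrix}$, $\xi_i\in\mathbb{R}$, $x_i\in\mathfrak{C}$, and with $X\circ Y=\tfrac12(XY+YX)$, $(X,Y)=\mathrm{tr}(X\circ Y)$, $X\times Y=\tfrac12(2X\circ Y-\mathrm{tr}(X)Y-\mathrm{tr}(Y)X+(\mathrm{tr}(X)\mathrm{tr}(Y)-(X,Y))E)$,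 $\det X=\tfrac13(X,X\times X)$. Let $C=\{x+iy:x,y\in\mathbb{R}\}$, where $i$ commutes with all of $\mathfrak{C}$; let $\mathfrak{J}^C=\mathfrak{J}\oplus i\mathfrak{J}$ be the complexification with these operations extended $C$-linearly. Let $\tau$ denote complex conjugation with respect to $i$ and $\langle X,Y\rangle=(\tau X,Y)$. Put $E_6=\{\alpha\in\mathrm{Iso}_C(\mathfrak{J}^C):\det\alpha X=\det X,\ \langle\alpha X,\alpha Y\rangle=\langle X,Y\rangle\}$, where $\mathrm{Iso}_C$ denotes $C$-linear isomorphisms. Identify $\mathfrak{J}=\mathfrak{J}(3,\mathbf{H})\oplus\mathbf{H}^3$: $X$ with $x_i=m_i+a_ie_4$ ($m_i,a_i\in\mathbf{H}$) corresponds to $M+\mathbf{a}$, where $M$ is the Hermitian matrix obtained from $X$ by replacing $x_i$ with $m_i$, and $\mathbf{a}=(a_1,a_2,a_3)$ is a row vector; correspondingly $\mathfrak{J}^C=\mathfrak{J}(3,\mathbf{H})^C\oplus(\mathbf{H}^3)^C$. Let $k:M(3,\mathbf{H})^C\to M(6,C)$ be the $C$-linear algebra isomorphism replacing each entry $a+be_2$ ($a,b\in\mathbf{C}$) by the $2\times2$ block $\begin{pmatrix}a&b\\-\bar b&\bar a\end{pmatrix}$ (with $e_1$ replaced by $i$), and let $k_J:\mathfrak{J}(3,\mathbf{H})^C\to\mathfrak{S}(6,C)=\{S\in M(6,C):{}^tS=-S\}$, $k_J(M)=k(M)J_6$, $J_6=\mathrm{diag}(J,J,J)$, $J=\begin{pmatrix}0&1\\-1&0\end{pmatrix}$.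 For $p\in Sp(1)$ (unit quaternions) and $A\in SU(6)=\{A\in M(6,C):(\tau\,{}^tA)A=E,\det A=1\}$ define $\varphi(p,A)\in E_6$ by $$\varphi(p,A)(M+\mathbf{a})=k_J^{-1}(A(k_JM)\,{}^tA)+p\,\mathbf{a}\,k^{-1}(\tau\,{}^tA).$$ Let $\boldsymbol{\omega}=-\tfrac12+\tfrac{\sqrt3}{2}e_1$. $\sigma_3\in E_6$ is the $C$-linear extension of the map of $\mathfrak{J}$ fixing each $\xi_i$ and sending $x_1\mapsto\bar{\boldsymbol{\omega}}x_1\bar{\boldsymbol{\omega}}$, $x_2\mapsto\boldsymbol{\omega}x_2$, $x_3\mapsto x_3\boldsymbol{\omega}$. $\nu_3=\varphi(1,\mathrm{diag}(\nu^5,\nu^{-1},\nu^{-1},\nu^{-1},\nu^{-1},\nu^{-1}))\in E_6$ with $\nu=\exp(2\pi i/9)\in C$. For $g\in E_6$, $(E_6)^g=\{\alpha\in E_6:g^{-1}\alpha g=\alpha\}$. $U(1)$ is the group of unit complex numbers, $E$ the unit matrix. *)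

(* Defs.v *)
From HB Require Import structures.
From mathcomp Require Import all_boot all_order all_algebra.
From mathcomp Require Import all_classical all_reals all_analysis.
From mathcomp.real_closed Require Import complex.
From mathcomp Require Import ring.

Set Implicit Arguments.
Unset Strict Implicit.
Unset Printing Implicit Defensive.

Import Order.TTheory GRing.Theory Num.Theory.
Local Open Scope ring_scope.
Local Open Scope classical_set_scope.
Local Open Scope quotient_scope.
Local Open Scope complex_scope.

(* The quaternions, the Cayley algebra and the Jordan algebra are defined over
   an arbitrary field [K] by their (rational) structure constants.  Taking
   [K = R] gives the real algebras, and taking [K = R[i]] gives their
   complexifications: all operations, including the conjugations of H and of
   the Cayley algebra, are then extended C-linearly. *)

Section Quaternions.
Variable K : fieldType.

Definition quat : Type := 'rV[K]_4.
HB.instance Definition _ := Vector.on quat.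

(* [mkq a b c d] is a + b e1 + c e2 + d e3. *)
Definition mkq (a b c d : K) : quat := \row_(j < 4) nth 0 [:: a; b; c; d] j.
Definition qscal (a : K) : quat := mkq a 0 0 0.
Definition qco (q : quat) (n : nat) : K := q 0 (inord n).

Lemma mkqE a b c d :
  (qco (mkq a b c d) 0 = a) * (qco (mkq a b c d) 1 = b) *
  (qco (mkq a b c d) 2 = c) * (qco (mkq a b c d) 3 = d).
Proof. by rewrite /qco !mxE !inordK. Qed.

Lemma quatP (p q : quat) :
  qco p 0 = qco q 0 -> qco p 1 = qco q 1 -> qco p 2 = qco q 2 ->
  qco p 3 = qco q 3 -> p = q.
Proof.
move=> h0 h1 h2 h3; apply/rowP => i; rewrite -(inord_val i).
by case: i => [[|[|[|[|]]]]].
Qed.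

Lemma qcoD n x y : qco (x + y) n = qco x n + qco y n.
Proof. by rewrite /qco !mxE. Qed.
Lemma qcoN n x : qco (- x) n = - qco x n.
Proof. by rewrite /qco !mxE. Qed.
Lemma qcoZ n a x : qco (a *: x) n = a * qco x n.
Proof. by rewrite /qco !mxE. Qed.
Lemma qco0 n : qco 0 n = 0.
Proof. by rewrite /qco !mxE. Qed.

Definition qmul (p q : quat) : quat :=
  mkq (qco p 0 * qco q 0 - qco p 1 * qco q 1 - qco p 2 * qco q 2
         - qco p 3 * qco q 3)
      (qco p 0 * qco q 1 + qco p 1 * qco q 0 + qco p 2 * qco q 3
         - qco p 3 * qco q 2)
      (qco p 0 * qco q 2 - qco p 1 * qco q 3 + qco p 2 * qco q 0
         + qco p 3 * qco q 1)
      (qco p 0 * qco q 3 + qco p 1 * qco q 2 - qco p 2 * qco q 1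
         + qco p 3 * qco q 0).

Local Ltac quat_ring :=
  repeat move=> ?; apply: quatP; rewrite /qmul ?(qcoD, mkqE); ring.

Fact qmulA : associative qmul. Proof. quat_ring. Qed.
Fact qmul1q : left_id (mkq 1 0 0 0) qmul. Proof. quat_ring. Qed.
Fact qmulq1 : right_id (mkq 1 0 0 0) qmul. Proof. quat_ring. Qed.
Fact qmulDl : left_distributive qmul +%R. Proof. quat_ring. Qed.
Fact qmulDr : right_distributive qmul +%R. Proof. quat_ring. Qed.
Fact qone_neq0 : mkq 1 0 0 0 != 0.
Proof.
apply/eqP => /(congr1 (qco^~ 0)); rewrite mkqE qco0 => /eqP.
by rewrite oner_eq0.
Qed.

HB.instance Definition _ := GRing.Zmodule_isNzRing.Build quat
  qmulA qmul1q qmulq1 qmulDl qmulDr qone_neq0.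

Definition qconj (q : quat) : quat :=
  mkq (qco q 0) (- qco q 1) (- qco q 2) (- qco q 3).

Lemma qmulE (p q : quat) : p * q = qmul p q. Proof. by []. Qed.
Lemma qoneE : (1 : quat) = mkq 1 0 0 0. Proof. by []. Qed.

Lemma qconjK : involutive qconj.
Proof. by move=> q; apply: quatP; rewrite /qconj !mkqE ?opprK. Qed.

Lemma qconjM p q : qconj (p * q) = qconj q * qconj p.
Proof. rewrite !qmulE /qconj; apply: quatP; rewrite /qmul ?mkqE; ring. Qed.

Lemma qconjD p q : qconj (p + q) = qconj p + qconj q.
Proof. apply: quatP; rewrite /qconj !(qcoD, mkqE); ring. Qed.

Lemma qconjZ a p : qconj (a *: p) = a *: qconj p.
Proof. apply: quatP; rewrite /qconj !(qcoZ, mkqE); ring. Qed.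

Lemma qmul_conj_comm p : p * qconj p = qconj p * p.
Proof. rewrite !qmulE /qconj; apply: quatP; rewrite /qmul ?mkqE; ring. Qed.

Lemma qscaleAl a (p q : quat) : a *: (p * q) = (a *: p) * q.
Proof. rewrite !qmulE; apply: quatP; rewrite /qmul !(qcoZ, mkqE); ring. Qed.

Lemma qscaleAr a (p q : quat) : a *: (p * q) = p * (a *: q).
Proof. rewrite !qmulE; apply: quatP; rewrite /qmul !(qcoZ, mkqE); ring. Qed.

End Quaternions.

Section Cayley.
Variable K : fieldType.

(* [(m, n)] is m + n e4. *)
Definition cayley : Type := (quat K * quat K)%type.
HB.instance Definition _ := Vector.on cayley.

(* The product is not associative, hence is not declared as a ring product. *)
Definition omul (x y : cayley) : cayley :=
  (x.1 * y.1 - qconj y.2 * x.2, x.2 * qconj y.1 + y.2 * x.1).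
Definition oconj (x : cayley) : cayley := (qconj x.1, - x.2).
Definition oscal (a : K) : cayley := (qscal a, 0).
Definition ore (x : cayley) : K := qco x.1 0.

Lemma omulDl x y z : omul (x + y) z = omul x z + omul y z.
Proof.
by rewrite /omul /=; congr pair;
  rewrite /= ?mulrDl ?mulrDr ?opprD addrACA.
Qed.

Lemma omulDr x y z : omul x (y + z) = omul x y + omul x z.
Proof.
by rewrite /omul /=; congr pair;
  rewrite /= ?qconjD ?mulrDl ?mulrDr ?mulrDl ?opprD addrACA.
Qed.

Lemma omulZl a x y : omul (a *: x) y = a *: omul x y.
Proof.
by rewrite /omul /=; congr pair;
  rewrite /= ?scalerDr ?scalerN -?qscaleAl -?qscaleAr.
Qed.

Lemma omulZr a x y : omul x (a *: y) = a *: omul x y.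
Proof.
by rewrite /omul /=; congr pair;
  rewrite /= ?qconjZ ?scalerDr ?scalerN -?qscaleAl -?qscaleAr.
Qed.

Lemma oconjD x y : oconj (x + y) = oconj x + oconj y.
Proof. by rewrite /oconj; congr pair; rewrite /= ?qconjD ?opprD. Qed.

Lemma oconjZ a x : oconj (a *: x) = a *: oconj x.
Proof. by rewrite /oconj; congr pair; rewrite /= ?qconjZ ?scalerN. Qed.

Lemma oconj_sum (I : finType) (F : I -> cayley) :
  oconj (\sum_i F i) = \sum_i oconj (F i).
Proof.
apply: (big_morph _ oconjD).
by rewrite -(scale0r (0 : cayley)) oconjZ !scale0r.
Qed.

Lemma oconjM x y : oconj (omul x y) = omul (oconj y) (oconj x).
Proof.
rewrite /oconj /omul; congr pair; rewrite /=.
  by rewrite -scaleN1r qconjD qconjZ !qconjM qconjK scaleN1r -[- x.2]scaleN1r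
    -[- y.2]scaleN1r qconjZ -qscaleAl -qscaleAr scalerA mulrNN mulr1 scale1r.
by rewrite qconjK opprD addrC !mulNr.
Qed.

Lemma oconjK : involutive oconj.
Proof. by case=> m n; rewrite /oconj /= qconjK opprK. Qed.

End Cayley.

Definition mx3 (T : Type) (x0 : T) (s : seq (seq T)) : 'M[T]_3 :=
  \matrix_(i < 3, j < 3) nth x0 (nth [::] s i) j.

Section Jordan.
Variable K : fieldType.
Local Notation O := (cayley K).

(* The coordinates (xi_1, xi_2, xi_3) and (x_1, x_2, x_3) of a Hermitian
   matrix; see [jmx] for the matrix itself, and [jmx_herm], [jmxK], [jofK] for
   the identification with the Hermitian matrices.  Coordinates are numbered
   from 0: [xi X n] is xi_(n + 1) and [xo X n] is x_(n + 1). *)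
Definition jordan : Type := ('rV[K]_3 * {ffun 'I_3 -> O})%type.
HB.instance Definition _ := Vector.on jordan.

Definition xi (X : jordan) (n : nat) : K := X.1 0 (inord n).
Definition xo (X : jordan) (n : nat) : O := X.2 (inord n).
Definition mkj (r1 r2 r3 : K) (x1 x2 x3 : O) : jordan :=
  (\row_(j < 3) nth 0 [:: r1; r2; r3] j,
   [ffun j : 'I_3 => nth 0 [:: x1; x2; x3] j]).

Definition jmx (X : jordan) : 'M[O]_3 := mx3 0
  [:: [:: oscal (xi X 0) ; xo X 2         ; oconj (xo X 1) ];
      [:: oconj (xo X 2) ; oscal (xi X 1) ; xo X 0         ];
      [:: xo X 1         ; oconj (xo X 0) ; oscal (xi X 2) ]].

(* The inverse of [jmx] on Hermitian matrices. *)
Definition jof (A : 'M[O]_3) : jordan :=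
  mkj (ore (A 0 0)) (ore (A 1 1)) (ore (A (inord 2) (inord 2)))
      (A 1 (inord 2)) (A (inord 2) 0) (A 0 1).

Lemma mkjE r1 r2 r3 x1 x2 x3 (X := mkj r1 r2 r3 x1 x2 x3) :
  (xi X 0 = r1) * (xi X 1 = r2) * (xi X 2 = r3) *
  (xo X 0 = x1) * (xo X 1 = x2) * (xo X 2 = x3).
Proof. by rewrite /X /xi /xo !mxE !ffunE !inordK. Qed.

Lemma jordanP (X Y : jordan) :
  xi X 0 = xi Y 0 -> xi X 1 = xi Y 1 -> xi X 2 = xi Y 2 ->
  xo X 0 = xo Y 0 -> xo X 1 = xo Y 1 -> xo X 2 = xo Y 2 -> X = Y.
Proof.
case: X Y => [a f] [b g]; rewrite /xi /xo /= => h0 h1 h2 k0 k1 k2.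
congr pair; [apply/rowP => i | apply/ffunP => i]; rewrite -(inord_val i);
  by case: i => [[|[|[|]]]].
Qed.

Lemma xiD X Y n : xi (X + Y) n = xi X n + xi Y n.
Proof. by rewrite /xi !mxE. Qed.
Lemma xiZ a X n : xi (a *: X) n = a * xi X n.
Proof. by rewrite /xi !mxE. Qed.
Lemma xoD X Y n : xo (X + Y) n = xo X n + xo Y n.
Proof. by rewrite /xo !ffunE. Qed.
Lemma xoZ a X n : xo (a *: X) n = a *: xo X n.
Proof. by rewrite /xo !ffunE. Qed.

Definition omulmx (A B : 'M[O]_3) : 'M[O]_3 :=
  \matrix_(i, j) \sum_k omul (A i k) (B k j).
Definition oadjmx (A : 'M[O]_3) : 'M[O]_3 := \matrix_(i, j) oconj (A j i).

Lemma oscal_re (c : cayley K) :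
  (2 : K) != 0 -> oconj c = c -> oscal (ore c) = c.
Proof.
have hx (x : K) : (2 : K) != 0 -> - x = x -> 0 = x.
  move=> h2 /eqP; rewrite eq_sym -subr_eq0 opprK -mulr2n -mulr_natl mulf_eq0.
  by rewrite (negbTE h2) => /eqP ->.
case: c => m n h2 [hm hn]; congr pair; last first.
  apply/rowP => j; move/rowP/(_ j): hn; rewrite !mxE; exact: hx.
apply: quatP; rewrite !mkqE //; apply: hx => //.
- by rewrite -{2}hm mkqE.
- by rewrite -{2}hm mkqE.
- by rewrite -{2}hm mkqE.
Qed.

Lemma jmx_herm X : oadjmx (jmx X) = jmx X.
Proof.
have oscalK a : oconj (oscal a) = oscal a :> O.
  by congr pair; rewrite /= ?oppr0 //; apply: quatP; rewrite !mkqE ?oppr0.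
apply/matrixP => i j; rewrite !mxE.
by case: i j => [[|[|[|]]] // ?] [[|[|[|]]] // ?] /=; rewrite ?oscalK ?oconjK.
Qed.

Lemma jmxK : cancel jmx jof.
Proof.
move=> X; apply: jordanP; rewrite !mkjE /ore !mxE ?inordK //= !mkqE //.
Qed.

Lemma jofK A : (2 : K) != 0 -> oadjmx A = A -> jmx (jof A) = A.
Proof.
move=> h2 hA; have hE i j : oconj (A i j) = A j i by rewrite -{2}hA mxE.
have e0 (h : (0 < 3)%N) : Ordinal h = 0 :> 'I_3 by apply: val_inj.
have e1 (h : (1 < 3)%N) : Ordinal h = 1 :> 'I_3 by apply: val_inj.
have e2 (h : (2 < 3)%N) : Ordinal h = inord 2 :> 'I_3.
  by apply: val_inj; rewrite /= inordK.
apply/matrixP => i j; rewrite !mxE.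
by case: i j => [[|[|[|]]] // ?] [[|[|[|]]] // ?] /=;
  rewrite ?(e0, e1, e2) !mkjE ?hE ?oscal_re ?hE.
Qed.

Definition jmulmx (X Y : jordan) : 'M[O]_3 := \matrix_(i, j)
  (2^-1 *: (omulmx (jmx X) (jmx Y) i j + omulmx (jmx Y) (jmx X) i j)).
Definition jmul (X Y : jordan) : jordan := jof (jmulmx X Y).

Lemma jmx_mul X Y : (2 : K) != 0 -> jmx (jmul X Y) = jmulmx X Y.
Proof.
have adjM (A B : 'M[O]_3) i j :
    oconj (omulmx A B i j) = omulmx (oadjmx B) (oadjmx A) j i.
  rewrite !mxE oconj_sum; apply: eq_bigr => k _.
  by rewrite oconjM !mxE.
move=> h2; apply: jofK => //; apply/matrixP => i j.
rewrite [LHS]mxE [in LHS]mxE [RHS]mxE oconjZ oconjD !adjM !jmx_herm.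
by rewrite addrC.
Qed.

Definition jtr (X : jordan) : K := \sum_(n < 3) xi X n.
Definition jinner (X Y : jordan) : K := jtr (jmul X Y).
Definition junit : jordan := mkj 1 1 1 0 0 0.
Definition jcross (X Y : jordan) : jordan :=
  2^-1 *: (2 *: jmul X Y - jtr X *: Y - jtr Y *: X
           + (jtr X * jtr Y - jinner X Y) *: junit).
Definition jdet (X : jordan) : K := 3^-1 * jinner X (jcross X X).

Definition jtwist (w : O) (X : jordan) : jordan :=
  mkj (xi X 0) (xi X 1) (xi X 2)
    (omul (omul (oconj w) (xo X 0)) (oconj w))
    (omul w (xo X 1))
    (omul (xo X 2) w).

Lemma jtwist_linear w : linear (jtwist w).
Proof.
move=> a X Y; apply: jordanP; rewrite !(xiD, xiZ, xoD, xoZ) !mkjE.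
all: by rewrite ?(xiD, xiZ, xoD, xoZ, omulDr, omulZr, omulDl, omulZl).
Qed.

(* The identification of X with M + a, where x_n = m_n + a_n e4. *)
Definition jM (X : jordan) : 'M[quat K]_3 :=
  mx3 0 [:: [:: qscal (xi X 0)     ; (xo X 2).1          ; qconj (xo X 1).1 ];
            [:: qconj (xo X 2).1   ; qscal (xi X 1)      ; (xo X 0).1       ];
            [:: (xo X 1).1         ; qconj (xo X 0).1    ; qscal (xi X 2)   ]].
Definition ja (X : jordan) : 'rV[quat K]_3 := \row_(j < 3) (xo X j).2.
Definition jglue (M : 'M[quat K]_3) (a : 'rV[quat K]_3) : jordan :=
  mkj (qco (M 0 0) 0) (qco (M 1 1) 0) (qco (M (inord 2) (inord 2)) 0)
      (M 1 (inord 2), a 0 0) (M (inord 2) 0, a 0 1) (M 0 1, a 0 (inord 2)).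

Lemma jglueK : cancel (fun X => (jM X, ja X)) (fun Ma => jglue Ma.1 Ma.2).
Proof.
move=> X /=; apply: jordanP; rewrite !mkjE !mxE ?inordK //= ?mkqE //.
- by case: (xo X 0).
- by case: (xo X 1).
- by case: (xo X 2).
Qed.

Lemma jM_linear a X Y u v : jM (a *: X + Y) u v = a *: jM X u v + jM Y u v.
Proof.
rewrite !mxE; case: u v => [[|[|[|]]] // ?] [[|[|[|]]] // ?] /=;
  rewrite ?(xiD, xiZ, xoD, xoZ) /= ?(qconjD, qconjZ) //;
  by apply: quatP; rewrite !(qcoD, qcoZ, mkqE); ring.
Qed.

Lemma ja_linear (p : quat K) (N : 'M[quat K]_3) a X Y j :
  (p *: ja (a *: X + Y) *m N) 0 j =
  a *: (p *: ja X *m N) 0 j + (p *: ja Y *m N) 0 j.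
Proof.
rewrite !mxE scaler_sumr -big_split /=; apply: eq_bigr => u _.
by rewrite !mxE !(xoD, xoZ) /= mulrDr mulrDl -qscaleAr -qscaleAl.
Qed.

Lemma jglue_linear a (M M' M2 : 'M[quat K]_3) (r r' r2 : 'rV[quat K]_3) :
  (forall i j, M2 i j = a *: M i j + M' i j) ->
  (forall j, r2 0 j = a *: r 0 j + r' 0 j) ->
  jglue M2 r2 = a *: jglue M r + jglue M' r'.
Proof.
move=> hM hr; apply: jordanP; rewrite !(xiD, xiZ, xoD, xoZ) !mkjE.
all: by rewrite ?hM ?hr ?(qcoD, qcoZ).
Qed.

End Jordan.

Section E6.
Variable R : realType.
Local Notation C := R[i].

Definition cconj (m n : nat) (A : 'M[C]_(m, n)) : 'M[C]_(m, n) :=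
  map_mx (@conjc R) A.

(* [jordan C] being the scalar extension of the real Jordan algebra, tau is the
   conjugation of the complex coordinates. *)
Definition tauj (X : jordan C) : jordan C :=
  (cconj X.1, [ffun j => (cconj (X.2 j).1, cconj (X.2 j).2)]).
Definition jherm (X Y : jordan C) : C := jinner (tauj X) Y.

Definition E6 : set 'End(jordan C) :=
  [set alpha | [/\ lker alpha = 0%VS,
    forall X, jdet (alpha X) = jdet X &
    forall X Y, jherm (alpha X) (alpha Y) = jherm X Y]].

(* Elements of E_6 are encoded as elements of 'End(jordan C), so equality is
   pointwise equality and [lker alpha = 0%VS] means that alpha is bijective.
   [E6fix g] is (E_6)^g for g in E_6; [g^-1%VF] is then the inverse of g. *)
Definition E6fix (g : 'End(jordan C)) : set 'End(jordan C) :=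
  [set alpha | E6 alpha /\ (g^-1 \o alpha \o g)%VF = alpha].

Definition qC (q : quat R) : quat C := map_mx (fun r => r%:C) q.

Definition omega : quat R := mkq (- 2^-1) (Num.sqrt 3 / 2) 0 0.
Definition omegaO : cayley C := (qC omega, 0).

Definition sigma3_fun (X : jordan C) : jordan C := jtwist omegaO X.
HB.instance Definition _ := GRing.isLinear.Build C (jordan C) (jordan C) _
  sigma3_fun (jtwist_linear omegaO).

Definition sigma3 : 'End(jordan C) := linfun sigma3_fun.


(* The block replacing q = a + b e2 with a = q0 + q1 e1 and b = q2 + q3 e1;
   since k is C-linear, the coordinates q0, ..., q3 may be complex, whereas the
   conjugations of a and b only change the sign of e1. *)
Definition kblock (q : quat C) : 'M[C]_2 :=
  \matrix_(s < 2, t < 2) nth 0 (nth [::]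
    [:: [:: qco q 0 + 'i * qco q 1    ; qco q 2 + 'i * qco q 3 ];
        [:: - (qco q 2 - 'i * qco q 3); qco q 0 - 'i * qco q 1 ]] s) t.
Definition kblock_inv (B : 'M[C]_2) : quat C :=
  mkq ((B 0 0 + B 1 1) / 2) ((B 0 0 - B 1 1) / (2 * 'i))
      ((B 0 1 - B 1 0) / 2) ((B 0 1 + B 1 0) / (2 * 'i)).

Definition kmx (M : 'M[quat C]_3) : 'M[C]_6 :=
  \matrix_(i, j) kblock (M (inord (i %/ 2)%N) (inord (j %/ 2)%N))
                        (inord (i %% 2)%N) (inord (j %% 2)%N).
Definition kinv (N : 'M[C]_6) : 'M[quat C]_3 :=
  \matrix_(i, j) kblock_inv
    (\matrix_(s < 2, t < 2) N (inord (2 * i + s)%N) (inord (2 * j + t)%N)).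

Lemma ci_neq0 : 'i != 0 :> C.
Proof. by apply/eqP => -[] /eqP; rewrite oner_eq0. Qed.

Lemma kblockK : cancel kblock kblock_inv.
Proof.
move=> q; have i0 := ci_neq0.
by apply: quatP; rewrite !mkqE !mxE /=; field.
Qed.

Lemma kblock_invK : cancel kblock_inv kblock.
Proof.
move=> B; have i0 := ci_neq0.
have e0 (h : (0 < 2)%N) : Ordinal h = 0 :> 'I_2 by apply: val_inj.
have e1 (h : (1 < 2)%N) : Ordinal h = 1 :> 'I_2 by apply: val_inj.
apply/matrixP => s t; rewrite !mxE.
by case: s t => [[|[|]] // ?] [[|[|]] // ?] /=; rewrite ?(e0, e1) !mkqE; field.
Qed.

Lemma kmxK : cancel kmx kinv.
Proof.
move=> M; apply/matrixP => i j; rewrite mxE -[RHS]kblockK; congr kblock_inv.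
apply/matrixP => s t; rewrite !mxE.
have lt6 (u : 'I_3) (v : 'I_2) : (2 * u + v < 6)%N.
  by case: u v => [[|[|[|]]] // ?] [[|[|]] // ?].
by rewrite !inordK ?lt6 ?ltn_mod // !(mulnC 2) !divnMDl // !modnMDl
  !divn_small // !modn_small // !addn0 !inord_val.
Qed.

Lemma kinvK : cancel kinv kmx.
Proof.
move=> N; apply/matrixP => i j.
have lt3 (u : 'I_6) : (u %/ 2 < 3)%N by rewrite ltn_divLR.
have lt2 (u : 'I_6) : (u %% 2 < 2)%N by rewrite ltn_mod.
rewrite mxE [kinv N _ _]mxE kblock_invK mxE. rewrite !inordK ?lt3 ?lt2 //.
by rewrite !(mulnC 2) -!divn_eq !inord_val.
Qed.

Lemma kblockM p q : kblock (p * q) = kblock p *m kblock q.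
Proof.
have ii : 'i * 'i = -1 :> C by rewrite -expr2 sqr_i.
apply/matrixP => s t; rewrite !mxE !big_ord_recl big_ord0 !mxE qmulE.
by case: s t => [[|[|]] // ?] [[|[|]] // ?] /=; rewrite !mkqE; ring: ii.
Qed.

Lemma kblock_sum (I : finType) (F : I -> quat C) s t :
  kblock (\sum_i F i) s t = \sum_i kblock (F i) s t.
Proof.
have qs n : qco (\sum_i F i) n = \sum_i qco (F i) n by rewrite /qco summxE.
rewrite mxE; under [RHS]eq_bigr do rewrite mxE.
by case: s t => [[|[|]] // ?] [[|[|]] // ?] /=;
  rewrite !qs ?mulr_sumr -?sumrB -?big_split -?sumrN.
Qed.

Lemma kmxM M N : kmx (M *m N) = kmx M *m kmx N.
Proof.
apply/matrixP => i j; rewrite [LHS]mxE [RHS]mxE.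
under eq_bigr do rewrite 2![kmx _ _ _]mxE.
move: (inord (i %/ 2)%N) (inord (j %/ 2)%N).
move: (inord (i %% 2)%N) (inord (j %% 2)%N) => s t u v.
rewrite [(M *m N) u v]mxE kblock_sum.
transitivity (\sum_k \sum_l kblock (M u k) s l * kblock (N k v) l t).
  by apply: eq_bigr => k _; rewrite kblockM [LHS]mxE.
rewrite !big_ord_recl !big_ord0 !addr0 !addrA.
by do ![congr (_ + _)]; congr (kblock (M u _) s _ * kblock (N _ v) _ t);
  apply/val_inj; rewrite /= inordK.
Qed.

Definition J6 : 'M[C]_6 := \matrix_(i, j)
  (((i %/ 2 == j %/ 2) && (i < j))%N%:R
    - ((i %/ 2 == j %/ 2) && (j < i))%N%:R).
Definition kJ (M : 'M[quat C]_3) : 'M[C]_6 := kmx M *m J6.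
Definition kJinv (S : 'M[C]_6) : 'M[quat C]_3 := kinv (S *m invmx J6).

Lemma J6_unit : J6 \in unitmx.
Proof.
suff /mulmx1_unit[] : J6 *m (- J6) = 1%:M by [].
apply/matrixP => i j; rewrite !mxE !big_ord_recl big_ord0 !mxE.
by case: i j => [[|[|[|[|[|[|]]]]]] // ?] [[|[|[|[|[|[|]]]]]] // ?];
  rewrite /=; ring.
Qed.

Lemma kJK : cancel kJ kJinv.
Proof. by move=> M; rewrite /kJinv mulmxK ?J6_unit // kmxK. Qed.

Definition phi_fun (p : quat R) (A : 'M[C]_6) (X : jordan C) : jordan C :=
  jglue (kJinv (A *m kJ (jM X) *m A^T)) (qC p *: ja X *m kinv (cconj A^T)).

Lemma kblockP a q q' s t :
  kblock (a *: q + q') s t = a * kblock q s t + kblock q' s t.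
Proof.
rewrite !mxE; case: s => [[|[|]] // ?]; case: t => [[|[|]] // ?] /=;
  rewrite !(qcoD, qcoZ); ring.
Qed.

Lemma kblock_invP a B B' :
  kblock_inv (a *: B + B') = a *: kblock_inv B + kblock_inv B'.
Proof.
have i0 := ci_neq0.
by apply: quatP; rewrite !(qcoD, qcoZ, mkqE) !mxE; field.
Qed.

Fact phi_fun_linear p A : linear (phi_fun p A).
Proof.
have kinvP a N N' i j :
    kinv (a *: N + N') i j = a *: kinv N i j + kinv N' i j.
  rewrite !mxE -kblock_invP; congr kblock_inv.
  by apply/matrixP => s t; rewrite !mxE.
have kMP a X Y : kmx (jM (a *: X + Y)) = a *: kmx (jM X) + kmx (jM Y).
  have kE Q i j : kmx Q i j = kblock (Q (inord (i %/ 2)%N) (inord (j %/ 2)%N))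
    (inord (i %% 2)%N) (inord (j %% 2)%N) by rewrite mxE.
  apply/matrixP => i j; rewrite [RHS]mxE [X in _ = X + _]mxE !kE jM_linear.
  exact: kblockP.
move=> a X Y; rewrite /phi_fun; apply: jglue_linear => [i j | j]; last first.
  exact: ja_linear.
rewrite /kJinv -kinvP; congr (kinv _ i j).
by rewrite /kJ kMP !(mulmxDl, mulmxDr) -!(scalemxAl, scalemxAr).
Qed.
HB.instance Definition _ p A := GRing.isLinear.Build C (jordan C) (jordan C) _
  (phi_fun p A) (phi_fun_linear p A).

End E6.

Section UnitQuaternions.
Variable R : realType.

Record Sp1 := MkSp1 { Sp1val :> quat R; Sp1P : qconj Sp1val * Sp1val == 1 }.
HB.instance Definition _ := [isSub for Sp1val].
HB.instance Definition _ := [Choice of Sp1 by <:].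

Fact Sp1_one_subproof : qconj (1 : quat R) * 1 == 1.
Proof. by rewrite mulr1 qoneE /qconj !mkqE !oppr0. Qed.
Fact Sp1_mul_subproof (p q : Sp1) :
  qconj (Sp1val p * Sp1val q) * (Sp1val p * Sp1val q) == 1.
Proof.
by rewrite qconjM -mulrA (mulrA (qconj p)) (eqP (Sp1P p)) mul1r (Sp1P q).
Qed.
Fact Sp1_inv_subproof (p : Sp1) : qconj (qconj p) * qconj p == 1.
Proof. by rewrite -qmul_conj_comm qconjK (Sp1P p). Qed.
Fact Sp1_opp_subproof (p : Sp1) : qconj (- Sp1val p) * - Sp1val p == 1.
Proof.
by rewrite -scaleN1r qconjZ -qscaleAl -qscaleAr (eqP (Sp1P p)) !scaleN1r opprK.
Qed.

Definition Sp1_one := MkSp1 Sp1_one_subproof.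
Definition Sp1_mul p q := MkSp1 (Sp1_mul_subproof p q).
Definition Sp1_inv p := MkSp1 (Sp1_inv_subproof p).
Definition Sp1_opp p := MkSp1 (Sp1_opp_subproof p).

Fact Sp1_mulA : associative Sp1_mul.
Proof. by move=> p q r; apply: val_inj; rewrite /= mulrA. Qed.
Fact Sp1_mul1g : left_id Sp1_one Sp1_mul.
Proof. by move=> p; apply: val_inj; rewrite /= mul1r. Qed.
Fact Sp1_mulg1 : right_id Sp1_one Sp1_mul.
Proof. by move=> p; apply: val_inj; rewrite /= mulr1. Qed.
Fact Sp1_mulVg : left_inverse Sp1_one Sp1_inv Sp1_mul.
Proof. by move=> p; apply: val_inj; rewrite /= (eqP (Sp1P p)). Qed.
Fact Sp1_mulgV : right_inverse Sp1_one Sp1_inv Sp1_mul.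
Proof.
by move=> p; apply: val_inj; rewrite /= qmul_conj_comm (eqP (Sp1P p)).
Qed.
HB.instance Definition _ := isGroup.Build Sp1
  Sp1_mulA Sp1_mul1g Sp1_mulg1 Sp1_mulVg Sp1_mulgV.

End UnitQuaternions.

Section UnitComplex.
Variable R : realType.

Record U1 := MkU1 { U1val :> R[i]; U1P : `|U1val| == 1 }.
HB.instance Definition _ := [isSub for U1val].
HB.instance Definition _ := [Choice of U1 by <:].

Fact U1_one_subproof : `|1 : R[i]| == 1. Proof. by rewrite normr1. Qed.
Fact U1_mul_subproof (z w : U1) : `|U1val z * U1val w| == 1.
Proof. by rewrite normrM (eqP (U1P z)) (eqP (U1P w)) mul1r. Qed.
Fact U1_inv_subproof (z : U1) : `|(U1val z)^-1| == 1.
Proof. by rewrite normfV (eqP (U1P z)) invr1. Qed.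
Fact U1_opp_subproof (z : U1) : `|- U1val z| == 1.
Proof. by rewrite normrN (U1P z). Qed.
Fact U1_i_subproof : `|'i : R[i]| == 1.
Proof. by rewrite normc_def /= expr0n expr1n add0r sqrtr1. Qed.

Definition U1_one := MkU1 U1_one_subproof.
Definition U1_mul z w := MkU1 (U1_mul_subproof z w).
Definition U1_inv z := MkU1 (U1_inv_subproof z).
Definition U1_opp z := MkU1 (U1_opp_subproof z).
Definition U1_i := MkU1 U1_i_subproof.

Fact U1_neq0 (z : U1) : U1val z != 0.
Proof. by rewrite -normr_eq0 (eqP (U1P z)) oner_eq0. Qed.
Fact U1_mulA : associative U1_mul.
Proof. by move=> z w v; apply: val_inj; rewrite /= mulrA. Qed.
Fact U1_mul1g : left_id U1_one U1_mul.
Proof. by move=> z; apply: val_inj; rewrite /= mul1r. Qed.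
Fact U1_mulg1 : right_id U1_one U1_mul.
Proof. by move=> z; apply: val_inj; rewrite /= mulr1. Qed.
Fact U1_mulVg : left_inverse U1_one U1_inv U1_mul.
Proof. by move=> z; apply: val_inj; rewrite /= mulVf ?U1_neq0. Qed.
Fact U1_mulgV : right_inverse U1_one U1_inv U1_mul.
Proof. by move=> z; apply: val_inj; rewrite /= mulfV ?U1_neq0. Qed.
HB.instance Definition _ := isGroup.Build U1
  U1_mulA U1_mul1g U1_mulg1 U1_mulVg U1_mulgV.

End UnitComplex.

Section SpecialUnitary.
Variables (R : realType) (n : nat).
Local Notation C := R[i].

Definition is_SU (A : 'M[C]_n) : bool :=
  (cconj A^T *m A == 1%:M) && (\det A == 1).

Record SU := MkSU { SUval :> 'M[C]_n; SUP : is_SU SUval }.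
HB.instance Definition _ := [isSub for SUval].
HB.instance Definition _ := [Choice of SU by <:].

Lemma cconjM (p q r : nat) (A : 'M[C]_(p, q)) (B : 'M[C]_(q, r)) :
  cconj (A *m B) = cconj A *m cconj B.
Proof. exact: map_mxM. Qed.

Fact SU_one_subproof : is_SU 1%:M.
Proof. by rewrite /is_SU trmx1 /cconj map_mx1 mulmx1 det1 !eqxx. Qed.
Fact SU_mul_subproof (A B : SU) : is_SU (SUval A *m SUval B).
Proof.
case/andP: (SUP A) (SUP B) => /eqP uA /eqP dA /andP[/eqP uB /eqP dB].
rewrite /is_SU trmx_mul cconjM -mulmxA (mulmxA _ _ (SUval B)) uA mul1mx uB.
by rewrite det_mulmx dA dB mulr1 !eqxx.
Qed.
Fact SU_inv_subproof (A : SU) : is_SU (cconj (SUval A)^T).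
Proof.
case/andP: (SUP A) => /eqP uA /eqP dA; rewrite /is_SU.
have -> : cconj (cconj (SUval A)^T)^T = A.
  by apply/matrixP => i j; rewrite !mxE conjcK.
rewrite (mulmx1C uA) eqxx /= /cconj.
by rewrite (det_map_mx (@conjc R)) det_tr dA rmorph1.
Qed.

Definition SU_one := MkSU SU_one_subproof.
Definition SU_mul A B := MkSU (SU_mul_subproof A B).
Definition SU_inv A := MkSU (SU_inv_subproof A).

Fact SU_mulA : associative SU_mul.
Proof. by move=> A B D; apply: val_inj; rewrite /= mulmxA. Qed.
Fact SU_mul1g : left_id SU_one SU_mul.
Proof. by move=> A; apply: val_inj; rewrite /= mul1mx. Qed.
Fact SU_mulg1 : right_id SU_one SU_mul.
Proof. by move=> A; apply: val_inj; rewrite /= mulmx1. Qed.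
Fact SU_mulVg : left_inverse SU_one SU_inv SU_mul.
Proof.
by move=> A; apply: val_inj; case/andP: (SUP A) => /eqP.
Qed.
Fact SU_mulgV : right_inverse SU_one SU_inv SU_mul.
Proof.
by move=> A; apply: val_inj; case/andP: (SUP A) => /eqP /mulmx1C.
Qed.
HB.instance Definition _ := isGroup.Build SU
  SU_mulA SU_mul1g SU_mulg1 SU_mulVg SU_mulgV.

End SpecialUnitary.

Section Nu3.
Variable R : realType.
Local Notation C := R[i].

Definition phi (p : Sp1 R) (A : SU R 6) : 'End(jordan C) :=
  linfun (phi_fun p A).

Definition nu : C := cos (2 * pi / 9) +i* sin (2 * pi / 9).

Definition nu_mx : 'M[C]_6 :=
  diag_mx (\row_(j < 6) if j == 0 then nu ^+ 5 else nu^-1).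

Lemma nu_conj : conjc nu * nu = 1.
Proof.
apply/eqP; rewrite eq_complex /= -mulNr opprK -!expr2 cos2Dsin2 eqxx /=.
by apply/eqP; ring.
Qed.

Fact nu_mx_SU : is_SU nu_mx.
Proof.
have nu0 : nu != 0.
  apply/eqP => h; have := nu_conj; rewrite h mulr0 => /eqP.
  by rewrite eq_sym oner_eq0.
have nuV : conjc nu = nu^-1 by rewrite -[RHS]mul1r -nu_conj mulfK.
apply/andP; split; last first.
  by rewrite det_diag !big_ord_recl big_ord0 !mxE /=; apply/eqP; field.
apply/eqP; rewrite tr_diag_mx /cconj map_diag_mx mulmx_diag -diag_const_mx.
congr diag_mx; apply/rowP => j; rewrite !mxE.
have n5 : conjc (nu ^+ 5) = nu^-1 ^+ 5 by rewrite -nuV; exact: rmorphXn.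
have nV : conjc nu^-1 = nu by rewrite -nuV conjcK.
case: ifP => _.
  have := congr1 ( *%R^~ (nu ^+ 5)) n5 => /= ->.
  by rewrite -exprMn mulVf ?expr1n.
by have := congr1 ( *%R^~ nu^-1) nV => /= ->; rewrite mulfV.
Qed.

Definition nu3 : 'End(jordan C) := phi 1%g (MkSU nu_mx_SU).

End Nu3.

Section QuotientGroup.
Variable G : groupType.
Local Open Scope group_scope.

Record normal_subgroup := NormalSubgroup {
  nsg_set : set G;
  nsg1 : nsg_set 1;
  nsgM : forall x y, nsg_set x -> nsg_set y -> nsg_set (x * y);
  nsgV : forall x, nsg_set x -> nsg_set x^-1;
  nsgJ : forall x y, nsg_set x -> nsg_set (y^-1 * (x * y))
}.

Variable N : normal_subgroup.

Definition coset_rel (x y : G) : bool := `[< nsg_set N (x^-1 * y) >].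

Fact coset_rel_refl : reflexive coset_rel.
Proof. by move=> x; apply/asboolP; rewrite mulVg; exact: nsg1. Qed.
Fact coset_rel_imply x y : coset_rel x y -> coset_rel y x.
Proof. by move=> /asboolP /nsgV; rewrite invgM invgK => h; apply/asboolP. Qed.
Fact coset_rel_sym : symmetric coset_rel.
Proof. by move=> x y; apply/idP/idP => /coset_rel_imply. Qed.
Fact coset_rel_trans : transitive coset_rel.
Proof.
move=> y x z /asboolP xy /asboolP yz; apply/asboolP.
by have := nsgM xy yz; rewrite -mulgA mulVKg.
Qed.
Canonical coset_equiv :=
  EquivRel coset_rel coset_rel_refl coset_rel_sym coset_rel_trans.

Definition quotg := {eq_quot coset_rel}.
HB.instance Definition _ := Choice.on quotg.
HB.instance Definition _ := EqQuotient.on quotg.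

Definition quotg_one : quotg := \pi_quotg 1.
Definition quotg_mul (a b : quotg) : quotg := \pi_quotg (repr a * repr b).
Definition quotg_inv (a : quotg) : quotg := \pi_quotg (repr a)^-1.

Lemma quotg_eqP x y : \pi_quotg x = \pi_quotg y <-> nsg_set N (x^-1 * y).
Proof. by split=> [/eqmodP/asboolP // | h]; apply/eqmodP/asboolP. Qed.

Lemma quotg_piM x y : quotg_mul (\pi x) (\pi y) = \pi_quotg (x * y).
Proof.
rewrite /quotg_mul; apply/quotg_eqP.
have /quotg_eqP hx : \pi_quotg (repr (\pi_quotg x)) = \pi_quotg x.
  by rewrite reprK.
have /quotg_eqP hy : \pi_quotg (repr (\pi_quotg y)) = \pi_quotg y.
  by rewrite reprK.
move: (repr _) (repr _) hx hy => b a hx hy.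
by have := nsgM (nsgJ b hx) hy; rewrite invgM !mulgA mulgK.
Qed.

Lemma quotg_piV x : quotg_inv (\pi x) = \pi_quotg x^-1.
Proof.
rewrite /quotg_inv; apply/quotg_eqP.
have /quotg_eqP hx : \pi_quotg (repr (\pi_quotg x)) = \pi_quotg x.
  by rewrite reprK.
move: (repr _) hx => a hx; have := nsgJ a^-1 (nsgV hx).
by rewrite invgM !invgK !mulgA mulgK.
Qed.

Fact quotg_mulA : associative quotg_mul.
Proof.
by move=> a b c; rewrite -[a]reprK -[b]reprK -[c]reprK !quotg_piM mulgA.
Qed.
Fact quotg_mul1g : left_id quotg_one quotg_mul.
Proof. by move=> a; rewrite -[a]reprK quotg_piM mul1g. Qed.
Fact quotg_mulg1 : right_id quotg_one quotg_mul.
Proof. by move=> a; rewrite -[a]reprK quotg_piM mulg1. Qed.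
Fact quotg_mulVg : left_inverse quotg_one quotg_inv quotg_mul.
Proof. by move=> a; rewrite -[a]reprK quotg_piV quotg_piM mulVg. Qed.
Fact quotg_mulgV : right_inverse quotg_one quotg_inv quotg_mul.
Proof. by move=> a; rewrite -[a]reprK quotg_piV quotg_piM mulgV. Qed.
HB.instance Definition _ := isGroup.Build quotg
  quotg_mulA quotg_mul1g quotg_mulg1 quotg_mulVg quotg_mulgV.

End QuotientGroup.

Section NormalProduct.
Variable G : groupType.
Local Open Scope group_scope.
Variables M N : normal_subgroup G.

Definition nprod_set : set G := 
  [set x | exists2 y, nsg_set M y & exists2 z, nsg_set N z & x = y * z].

Fact nprod1 : nprod_set 1.
Proof.
by exists 1; [exact: nsg1 | exists 1; [exact: nsg1 | rewrite mulg1]].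
Qed.
Fact nprodM x y : nprod_set x -> nprod_set y -> nprod_set (x * y).
Proof.
case=> a Ma [b Nb ->] [c Mc [d Nd ->]]; exists (a * c); first exact: nsgM.
exists ((c^-1 * (b * c)) * d); first by apply: nsgM => //; exact: nsgJ.
by rewrite !mulgA mulgK.
Qed.
Fact nprodV x : nprod_set x -> nprod_set x^-1.
Proof.
case=> a Ma [b Nb ->]; exists a^-1; first exact: nsgV.
exists (a^-1^-1 * (b^-1 * a^-1)); first by apply: nsgJ; exact: nsgV.
by rewrite invgK invgM mulKg.
Qed.
Fact nprodJ x y : nprod_set x -> nprod_set (y^-1 * (x * y)).
Proof.
case=> a Ma [b Nb ->]; exists (y^-1 * (a * y)); first exact: nsgJ.
exists (y^-1 * (b * y)); first exact: nsgJ.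
by rewrite !mulgA mulgK.
Qed.

(* The subgroup M N of G. *)
Definition nprod : normal_subgroup G :=
  NormalSubgroup nprod1 nprodM nprodV nprodJ.

End NormalProduct.

Definition normal_axiom (G : groupType) (S : set G) : Prop :=
  [/\ S 1%g, forall x y, S x -> S y -> S (x * y)%g,
      forall x, S x -> S (x^-1)%g & forall x y, S x -> S (y^-1 * (x * y))%g].

Definition mk_nsg (G : groupType) (S : set G) (h : normal_axiom S) :
    normal_subgroup G :=
  @NormalSubgroup G S
    (let: And4 a _ _ _ := h in a) (let: And4 _ b _ _ := h in b)
    (let: And4 _ _ c _ := h in c) (let: And4 _ _ _ d := h in d).

Lemma central_nsg (G : groupType) (z : G) (S : set G) (k : nat) :
  (forall x, commute z x) -> (z ^+ k.+1 = 1)%g ->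
  (forall x, S x <-> exists n, x = (z ^+ n)%g) ->
  normal_axiom S.
Proof.
move=> zC zk SE; split.
- by apply/SE; exists 0%N; rewrite expg0.
- move=> x y /SE[m ->] /SE[n ->]; apply/SE; exists (m + n)%N.
  by rewrite expgnDr.
- move=> x /SE[m ->]; apply/SE; exists (m * k)%N; apply: (mulgI (z ^+ m)%g).
  by rewrite mulgV -expgnDr -mulnS mulnC expgnA zk expg1n.
- move=> x y /SE[m ->]; apply/SE; exists m.
  by rewrite -(commuteX m (commute_sym (zC y))) mulKg.
Qed.

Lemma expg_mod (G : groupType) (z : G) k n :
  (z ^+ k = 1)%g -> (z ^+ n = z ^+ (n %% k))%g.
Proof.
by move=> zk; rewrite {1}(divn_eq n k) expgnDr mulnC expgnA zk expg1n mul1g.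
Qed.

Lemma pair_commute (G H : groupType) (x x' : G) (y y' : H) :
  commute x x' -> commute y y' -> commute (x, y) (x', y').
Proof. by rewrite /commute => hx hy; congr pair. Qed.

Lemma cycle2P (G : groupType) (z : G) : (z * z = 1)%g ->
  forall x, [set 1%g; z] x <-> exists n, x = (z ^+ n)%g.
Proof.
move=> zz x; split=> [[->|->]|[n ->]]; first by exists 0%N.
  by exists 1%N; rewrite expg1.
rewrite (@expg_mod _ z 2) ?expg2 //.
case: (n %% 2)%N (ltn_mod n 2) => [|[|]] //= _; first by left.
by right; rewrite expg1.
Qed.

Section Kernel.
Variable R : realType.

Fact SU2_opp_subproof (A : SU R 2) : is_SU (- SUval A).
Proof.
case/andP: (SUP A) => /eqP uA /eqP dA; rewrite /is_SU.
rewrite -scaleN1r detZ dA mulr1 expr2 mulrNN mulr1 eqxx andbT.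
by rewrite !scaleN1r mulmxN raddfN /cconj raddfN mulNmx opprK; apply/eqP.
Qed.
Definition SU2_opp (A : SU R 2) : SU R 2 := MkSU (SU2_opp_subproof A).

Definition G6 : Type := (Sp1 R * U1 R * U1 R * U1 R * SU R 2 * SU R 2)%type.
HB.instance Definition _ := Group.on G6.

Local Notation i := (U1_i R).
Local Notation "-1" := (U1_opp 1%g).
Local Notation "-i" := (U1_opp i).
Local Notation E := (1%g : SU R 2).
Local Notation "-E" := (SU2_opp 1%g).

Definition Z2a_set : set G6 :=
  [set (1, 1, 1, 1, E, E); (1, 1, -1, 1, E, -E)]%g.
Definition Z2b_set : set G6 :=
  [set (1, 1, 1, 1, E, E); (1, 1, -1, -1, -E, E)]%g.
Definition Z4_set : set G6 :=
  [set (1, 1, 1, 1, E, E); (1, -1, -1, 1, E, E);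
       (Sp1_opp 1, i, i, 1, -E, E); (Sp1_opp 1, -i, -i, 1, -E, E)]%g.

Let G6P (x y : G6) :
  x.1.1.1.1.1 = y.1.1.1.1.1 -> x.1.1.1.1.2 = y.1.1.1.1.2 ->
  x.1.1.1.2 = y.1.1.1.2 -> x.1.1.2 = y.1.1.2 -> x.1.2 = y.1.2 -> x.2 = y.2 ->
  x = y.
Proof.
case: x y => [[[[[? ?] ?] ?] ?] ?] [[[[[? ?] ?] ?] ?] ?] /= *.
by congr (_, _, _, _, _, _).
Qed.

Let oppE (z : U1 R) : (U1_opp 1 * z)%g = U1_opp z.
Proof. by apply: val_inj; rewrite /= mulN1r. Qed.

Let Sp1C (x : Sp1 R) : (Sp1_opp 1 * x = x * Sp1_opp 1)%g.
Proof. by apply: val_inj; rewrite /= mulN1r mulrN1. Qed.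
Let U1C (x y : U1 R) : (x * y = y * x)%g.
Proof. by apply: val_inj; rewrite /= mulrC. Qed.
Let SU2C (x : SU R 2) : (-E * x = x * -E)%g.
Proof. by apply: val_inj; rewrite /= mulNmx mulmxN mul1mx mulmx1. Qed.
Let Sp1N : (Sp1_opp 1 * Sp1_opp 1 = 1 :> Sp1 R)%g.
Proof. by apply: val_inj; rewrite /= mulrNN mulr1. Qed.
Let U1N : (-1 * -1 = 1 :> U1 R)%g.
Proof. by apply: val_inj; rewrite /= mulrNN mulr1. Qed.
Let U1ii : (i * i = -1 :> U1 R)%g.
Proof. by apply: val_inj; rewrite /= -expr2 sqr_i. Qed.
Let SU2N : (-E * -E = 1 :> SU R 2)%g.
Proof. by apply: val_inj; rewrite /= mulNmx mulmxN mul1mx opprK. Qed.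

Let central (x : G6) :
  (x.1.1.1.1.1 = 1 \/ x.1.1.1.1.1 = Sp1_opp 1)%g ->
  (x.1.2 = 1 \/ x.1.2 = -E)%g -> (x.2 = 1 \/ x.2 = -E)%g ->
  forall y, commute x y.
Proof.
case: x => [[[[[p a] b] c] A] B] /= h1 h2 h3 [[[[[p' a'] b'] c'] A'] B'].
apply: pair_commute; [apply: pair_commute; [apply: pair_commute;
  [apply: pair_commute; [apply: pair_commute|]|]|]|]; rewrite /commute.
- by case: h1 => ->; [rewrite mul1g mulg1 | exact: Sp1C].
- exact: U1C.
- exact: U1C.
- exact: U1C.
- by case: h2 => ->; [rewrite mul1g mulg1 | exact: SU2C].
- by case: h3 => ->; [rewrite mul1g mulg1 | exact: SU2C].
Qed.

Fact Z2a_normal : normal_axiom Z2a_set.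
Proof.
pose z : G6 := (1, 1, -1, 1, E, -E)%g.
have zz : (z * z = 1)%g by apply: G6P; rewrite /= ?mulg1 ?U1N ?SU2N.
apply: (@central_nsg _ z _ 1) => //; last exact: (cycle2P zz).
by apply: central => /=; [left | left | right].
Qed.

Fact Z2b_normal : normal_axiom Z2b_set.
Proof.
pose z : G6 := (1, 1, -1, -1, -E, E)%g.
have zz : (z * z = 1)%g by apply: G6P; rewrite /= ?mulg1 ?U1N ?SU2N.
apply: (@central_nsg _ z _ 1) => //; last exact: (cycle2P zz).
by apply: central => /=; [left | right | left].
Qed.

Fact Z4_normal : normal_axiom Z4_set.
Proof.
pose z : G6 := (Sp1_opp 1, i, i, 1, -E, E)%g.
have z2 : (z ^+ 2 = (1, -1, -1, 1, E, E) :> G6)%g.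
  by rewrite expg2; apply: G6P; rewrite /= ?mulg1 ?Sp1N ?U1ii ?SU2N.
have z3 : (z ^+ 3 = (Sp1_opp 1, -i, -i, 1, -E, E) :> G6)%g.
  by rewrite expgSr z2; apply: G6P; rewrite /= ?mulg1 ?mul1g ?oppE.
have z4 : (z ^+ 4 = 1)%g.
  by rewrite (expgnDr z 2 2) z2; apply: G6P; rewrite /= ?mulg1 ?U1N.
apply: (@central_nsg _ z _ 3) => //.
  by apply: central => /=; [right | right | left].
move=> x; split=> [[[[->|->]|->]|->]|[n ->]].
- by exists 0%N.
- by exists 2%N.
- by exists 1%N; rewrite expg1.
- by exists 3%N.
rewrite (expg_mod _ z4).
case: (n %% 4)%N (ltn_mod n 4) => [|[|[|[|]]]] //= _.
- by left; left; left.
- by left; right; rewrite expg1.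
- by left; left; right.
- by right.
Qed.

Definition Z2a : normal_subgroup G6 := mk_nsg Z2a_normal.
Definition Z2b : normal_subgroup G6 := mk_nsg Z2b_normal.
Definition Z4 : normal_subgroup G6 := mk_nsg Z4_normal.

End Kernel.

(* Main.v *)
Require Import Defs.
From HB Require Import structures.
From mathcomp Require Import all_boot all_order all_algebra.
From mathcomp Require Import all_classical all_reals all_analysis.
From mathcomp.real_closed Require Import complex.
From mathcomp Require Import ring.

(* Splitting the skew matrix S = k_J(M) and the 2 x 6 matrix k(a) along the
   index sets {1}, {2}, {3, 6}, {4, 5} gives twelve blocks, on each of which
   sigma3 and nu3 are scalar; in these coordinates the determinant is
   Pf(S) - u S v^T, with u, v the rows of k(a), and the Hermitian form is the
   standard one.  The joint eigenspaces are the blocks, except that three scalar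
   blocks each share an eigenspace with a vector block; the cubic form separates
   these, so an element alpha of the centralizer acts blockwise by unitary maps.
   Composing alpha with the inverse of a suitable phi(p, diag(a, b, U, V))
   normalizes three of its twelve components to the identity, and invariance of
   the trilinear parts of the determinant forces the others to be trivial as
   well.  Hence the centralizer is the image of
   Sp(1) x S(U(1) x U(1) x U(2) x U(2)), which the given product covers through
   a choice of square roots, with the stated kernel. *)

Set Implicit Arguments.
Unset Strict Implicit.
Unset Printing Implicit Defensive.

Import Order.TTheory GRing.Theory Num.Theory.
Local Open Scope ring_scope.
Local Open Scope complex_scope.

(** * The determinant and the inner product in coordinates *)

Section JordanForms.
Variable K : fieldType.
Implicit Types (x y z : cayley K) (X Y : jordan K).

(** The four index sets are the joint eigenspaces of two diagonal matrices of SU(6). The block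
    formulas show that sigma3 acts as [Phi] does for a = b = 1, U the scalar [wc'] and V the scalar
    [wc], that is, through diag(1, 1, w', w, w, w') with w = [wc] and w' = [wc']; this separates {1,
    2}, {3, 6} and {4, 5}. The matrix of nu3 has a first entry that differs from all the others,
    which splits {1, 2}. So the expected centralizer consists of block diagonal matrices together
    with the factor Sp(1). What must be excluded is a centralizing element outside this family. No
    description of a larger fixed subgroup of E_6 is assumed for this: eigenspaces, the cubic form
    and unitarity suffice. The three components to be normalized are those on e, g and n1, where
    [Phi p a b U V] acts by a U, a V and p / a: they determine p, U and V once a is chosen, and the
    determinant condition then fixes b. *)

Lemma qcoM (p q : quat K) :
  (qco (p * q) 0 = qco p 0 * qco q 0 - qco p 1 * qco q 1 - qco p 2 * qco q 2
                   - qco p 3 * qco q 3)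
  * (qco (p * q) 1 = qco p 0 * qco q 1 + qco p 1 * qco q 0 + qco p 2 * qco q 3
                     - qco p 3 * qco q 2)
  * (qco (p * q) 2 = qco p 0 * qco q 2 - qco p 1 * qco q 3 + qco p 2 * qco q 0
                     + qco p 3 * qco q 1)
  * (qco (p * q) 3 = qco p 0 * qco q 3 + qco p 1 * qco q 2 - qco p 2 * qco q 1
                     + qco p 3 * qco q 0).
Proof. by rewrite qmulE /qmul !mkqE. Qed.

Lemma qco_conj (p : quat K) :
  (qco (qconj p) 0 = qco p 0) * (qco (qconj p) 1 = - qco p 1)
  * (qco (qconj p) 2 = - qco p 2) * (qco (qconj p) 3 = - qco p 3).
Proof. by rewrite /qconj !mkqE. Qed.

(** The inner product of the Cayley algebra, extended bilinearly, not sesquilinearly, when [K] is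
    complex. *)
Definition odot x y : K :=
  qco x.1 0 * qco y.1 0 + qco x.1 1 * qco y.1 1 + qco x.1 2 * qco y.1 2
  + qco x.1 3 * qco y.1 3 + (qco x.2 0 * qco y.2 0 + qco x.2 1 * qco y.2 1
  + qco x.2 2 * qco y.2 2 + qco x.2 3 * qco y.2 3).

Lemma ore_omul x y : ore (omul x y) = odot (oconj x) y.
Proof.
by rewrite /ore /odot /omul /oconj /= !(qcoD, qcoN, qcoM, qco_conj); ring.
Qed.

Lemma oscal_mull a x : omul (oscal a) x = a *: x.
Proof.
rewrite /omul /oscal /qscal; congr pair; apply: quatP;
  rewrite /= !qmulE /qmul /qconj;
rewrite !(qcoD, qcoN, qcoZ, mkqE, qco0); ring.
Qed.

Lemma oscal_mulr a x : omul x (oscal a) = a *: x.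
Proof.
rewrite /omul /oscal /qscal; congr pair; apply: quatP;
  rewrite /= !qmulE /qmul /qconj;
rewrite !(qcoD, qcoN, qcoZ, mkqE, qco0); ring.
Qed.

Lemma xi_jmul X Y n : (n < 3)%N ->
  xi (jmul X Y) n = ore (jmulmx X Y (inord n) (inord n)).
Proof.
have e0 : inord 0 = 0 :> 'I_3 by apply: val_inj; rewrite /= inordK.
have e1 : inord 1 = 1 :> 'I_3 by apply: val_inj; rewrite /= inordK.
by case: n => [|[|[|]]] // _; rewrite /jmul /jof !mkjE ?e0 ?e1.
Qed.

Lemma ore0 : ore (0 : cayley K) = 0. Proof. exact: qco0. Qed.
Lemma oreD x y : ore (x + y) = ore x + ore y. Proof. exact: qcoD. Qed.
Lemma oreZ a x : ore (a *: x) = a * ore x. Proof. exact: qcoZ. Qed.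
Lemma odotC x y : odot x y = odot y x. Proof. rewrite /odot; ring. Qed.
Lemma odot_conj x y : odot (oconj x) (oconj y) = odot x y.
Proof. by rewrite /odot /oconj /qconj /= !(qcoN, mkqE) !mulrNN. Qed.

Hypothesis K2 : (2 : K) != 0.

Lemma ore_oscal a : ore (oscal a : cayley K) = a.
Proof. by rewrite /ore /oscal /qscal /= mkqE. Qed.

Lemma jinnerE X Y : jinner X Y =
  xi X 0 * xi Y 0 + xi X 1 * xi Y 1 + xi X 2 * xi Y 2 +
  2 * (odot (xo X 0) (xo Y 0) + odot (xo X 1) (xo Y 1) + odot (xo X 2)
    (xo Y 2)).
Proof.
rewrite /jinner /jtr !big_ord_recl big_ord0 /= !xi_jmul // !mxE.
rewrite !big_ord_recl !big_ord0 !mxE !inordK // /=.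
rewrite !(oreZ, oreD, oscal_mull) !ore_omul !odot_conj !oconjK.
rewrite !ore_oscal !ore0 ![odot (xo Y _) _]odotC.
by field.
Qed.

Let half x : 2^-1 *: (x + x) = x.
Proof. by rewrite -mulr2n -scaler_nat scalerA mulVf ?scale1r. Qed.

Lemma jmul_sqr_xo X :
  (xo (jmul X X) 0 = oconj (omul (xo X 1) (xo X 2)) +
    (xi X 1 + xi X 2) *: xo X 0)
  * (xo (jmul X X) 1 = oconj (omul (xo X 2) (xo X 0)) +
    (xi X 0 + xi X 2) *: xo X 1)
  * (xo (jmul X X) 2 = oconj (omul (xo X 0) (xo X 1)) +
    (xi X 0 + xi X 1) *: xo X 2).
Proof.
rewrite /jmul /jof !mkjE !mxE !half !big_ord_recl !big_ord0 !mxE !inordK //=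
  !oconjM.
rewrite !(oscal_mull, oscal_mulr) !addr0 !scalerDl; do ![split] => //.
  by rewrite addrCA [_ *: _ + _ *: _]addrC.
by rewrite addrA addrC.
Qed.

Lemma jmul_sqr_xi X :
  (xi (jmul X X) 0 = xi X 0 ^+ 2 + odot (xo X 1) (xo X 1) + odot (xo X 2)
    (xo X 2))
  * (xi (jmul X X) 1 = xi X 1 ^+ 2 + odot (xo X 0) (xo X 0) + odot (xo X 2)
    (xo X 2))
  * (xi (jmul X X) 2 = xi X 2 ^+ 2 + odot (xo X 0) (xo X 0) + odot (xo X 1)
    (xo X 1)).
Proof.
rewrite !xi_jmul // !mxE !half !big_ord_recl !big_ord0 !mxE !inordK //=.
rewrite !(oreD, oscal_mull, oreZ, ore_oscal) !ore_omul ?odot_conj ?oconjK !ore0.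
by do ![split]; ring.
Qed.

Lemma xi_junit n : (n < 3)%N -> xi (junit K) n = 1.
Proof. by case: n => [|[|[|]]] // _; rewrite /junit mkjE. Qed.

Lemma xo_junit n : (n < 3)%N -> xo (junit K) n = 0.
Proof. by case: n => [|[|[|]]] // _; rewrite /junit mkjE. Qed.

Lemma jcross_sqr_xi X :
  (xi (jcross X X) 0 = xi X 1 * xi X 2 - odot (xo X 0) (xo X 0))
  * (xi (jcross X X) 1 = xi X 0 * xi X 2 - odot (xo X 1) (xo X 1))
  * (xi (jcross X X) 2 = xi X 0 * xi X 1 - odot (xo X 2) (xo X 2)).
Proof.
rewrite /jcross -!scaleNr !(xiZ, xiD) !jmul_sqr_xi !xi_junit // jinnerE.
rewrite /jtr !big_ord_recl big_ord0 /=.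
by do ![split]; field.
Qed.

Lemma jcross_sqr_xo X :
  (xo (jcross X X) 0 = oconj (omul (xo X 1) (xo X 2)) - xi X 0 *: xo X 0)
  * (xo (jcross X X) 1 = oconj (omul (xo X 2) (xo X 0)) - xi X 1 *: xo X 1)
  * (xo (jcross X X) 2 = oconj (omul (xo X 0) (xo X 1)) - xi X 2 *: xo X 2).
Proof.
(* Here t is the trace and a a sum of two diagonal entries, so that t - a is the third one. *)
have comb (c : cayley K) x a t :
    2^-1 *: (2 *: (c + a *: x) + - t *: x + - t *: x) = c - (t - a) *: x.
  rewrite [2 *: (c + _)]scalerDr -!addrA !scalerDr !scalerA mulVf //.
  rewrite scale1r -!scalerDl.
  by rewrite -scaleNr; congr (_ + _ *: _); field.
rewrite /jcross -!scaleNr !(xoZ, xoD) !xo_junit // !scaler0 !addr0 !jmul_sqr_xo.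
have tr : jtr X = xi X 0 + xi X 1 + xi X 2.
  by rewrite /jtr !big_ord_recl big_ord0 /= addr0 addrA.
rewrite !comb tr.
by do ![split]; rewrite -scaleNr; congr (_ + _ *: _); ring.
Qed.

Lemma odotBr x y z : odot x (y - z) = odot x y - odot x z.
Proof. rewrite /odot !(qcoD, qcoN); ring. Qed.
Lemma odotZr a x y : odot x (a *: y) = a * odot x y.
Proof. rewrite /odot !qcoZ; ring. Qed.

Lemma ore_triple x y z :
  odot x (oconj (omul y z)) = ore (omul (omul x y) z).
Proof.
by rewrite /ore /odot /omul /oconj /= !(qcoD, qcoN, qcoM, qco_conj); ring.
Qed.

(** Although the product is not associative, the real part of a triple product does not see the
    bracketing and is cyclic; this merges the three terms that the off-diagonal entries of X x X
    contribute to the determinant. *)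
Lemma ore_cycle x y z : ore (omul (omul y z) x) = ore (omul (omul x y) z).
Proof.
by rewrite /ore /odot /omul /oconj /= !(qcoD, qcoN, qcoM, qco_conj); ring.
Qed.

Hypothesis K3 : (3 : K) != 0.

Lemma jdetE X : jdet X = xi X 0 * xi X 1 * xi X 2
  - xi X 0 * odot (xo X 0) (xo X 0) - xi X 1 * odot (xo X 1) (xo X 1)
  - xi X 2 * odot (xo X 2) (xo X 2)
  + 2 * ore (omul (omul (xo X 0) (xo X 1)) (xo X 2)).
Proof.
rewrite /jdet jinnerE !jcross_sqr_xi !jcross_sqr_xo !odotBr !odotZr !ore_triple.
move: (xo X 0) (xo X 1) (xo X 2) (xi X 0) (xi X 1) (xi X 2) => x y z a b c.
rewrite (ore_cycle y z x) !(ore_cycle x y z).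
move: (ore _) (odot x x) (odot y y) (odot z z) => t u v w.
by field.
Qed.

End JordanForms.

(** * Two-by-two matrices *)

Section Matrix2.
Variable K : comNzRingType.

Fact mx22_key : unit. Proof. by []. Qed.
Definition mx22 (a b c d : K) : 'M[K]_2 :=
  \matrix[mx22_key]_(i, j) nth 0 (nth [::] [:: [:: a; b]; [:: c; d]] i) j.
Definition cv2 (a b : K) : 'cV[K]_2 :=
  \matrix[mx22_key]_(i, j) nth 0 [:: a; b] i.

Lemma mx22E a b c d :
  (mx22 a b c d 0 0 = a) * (mx22 a b c d 0 1 = b) *
  (mx22 a b c d 1 0 = c) * (mx22 a b c d 1 1 = d).
Proof. by rewrite !mxE. Qed.

Lemma cv2E a b : (cv2 a b 0 0 = a) * (cv2 a b 1 0 = b).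
Proof. by rewrite !mxE. Qed.

Lemma cv2L k a b a' b' :
  k *: cv2 a b + cv2 a' b' = cv2 (k * a + a') (k * b + b').
Proof. by apply/matrixP => i j; rewrite !mxE; case: i => [[|[|]]]. Qed.

Lemma mx22L k a b c d a' b' c' d' : k *: mx22 a b c d + mx22 a' b' c' d' =
  mx22 (k * a + a') (k * b + b') (k * c + c') (k * d + d').
Proof.
by apply/matrixP => i j; rewrite !mxE; case: i j => [[|[|]] // ?] [[|[|]] // ?].
Qed.

Lemma cv2Z k a b : k *: cv2 a b = cv2 (k * a) (k * b).
Proof. by apply/matrixP => i j; rewrite !mxE; case: i => [[|[|]]]. Qed.

Lemma mx22Z k a b c d : k *: mx22 a b c d = mx22 (k * a) (k * b) (k * c)
  (k * d).
Proof.
by apply/matrixP => i j; rewrite !mxE; case: i j => [[|[|]] // ?] [[|[|]] // ?].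
Qed.

Lemma mx2P (A B : 'M[K]_2) : A 0 0 = B 0 0 -> A 0 1 = B 0 1 ->
  A 1 0 = B 1 0 -> A 1 1 = B 1 1 -> A = B.
Proof.
have e0 (h : (0 < 2)%N) : Ordinal h = 0 :> 'I_2 by apply: val_inj.
have e1 (h : (1 < 2)%N) : Ordinal h = 1 :> 'I_2 by apply: val_inj.
move=> h1 h2 h3 h4; apply/matrixP => i j.
by case: i j => [[|[|]] // ?] [[|[|]] // ?]; rewrite ?e0 ?e1.
Qed.

Lemma cv2P (x y : 'cV[K]_2) : x 0 0 = y 0 0 -> x 1 0 = y 1 0 -> x = y.
Proof.
have e0 (h : (0 < 2)%N) : Ordinal h = 0 :> 'I_2 by apply: val_inj.
have e1 (h : (1 < 2)%N) : Ordinal h = 1 :> 'I_2 by apply: val_inj.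
move=> h1 h2; apply/matrixP => i j; rewrite (ord1 j).
by case: i => [[|[|]] // ?]; rewrite ?e0 ?e1.
Qed.

Lemma ord2_lift : lift ord0 ord0 = 1 :> 'I_2. Proof. exact: val_inj. Qed.

Lemma mulmx2E m n (A : 'M[K]_(m, 2)) (B : 'M[K]_(2, n)) i j :
  (A *m B) i j = A i 0 * B 0 j + A i 1 * B 1 j.
Proof. by rewrite mxE !big_ord_recl big_ord0 addr0 ord2_lift. Qed.

Lemma mxtrace2 (A : 'M[K]_2) : \tr A = A 0 0 + A 1 1.
Proof. by rewrite /mxtrace !big_ord_recl big_ord0 addr0 ord2_lift. Qed.

Lemma det2 (A : 'M[K]_2) : \det A = A 0 0 * A 1 1 - A 0 1 * A 1 0.
Proof.
rewrite (expand_det_row _ 0) !big_ord_recl big_ord0 addr0 ord2_lift.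
rewrite /cofactor !det_mx11 !mxE /= expr0 expr1 mul1r mulN1r mulrN.
by congr (_ * A _ _ - _ * A _ _); apply: val_inj.
Qed.

(** The determinant of the matrix with columns x and y, that is, the symplectic form of the plane;
    [Jmx] is its Gram matrix. *)
Definition wdg (x y : 'cV[K]_2) : K := x 0 0 * y 1 0 - x 1 0 * y 0 0.
Definition Jmx : 'M[K]_2 := mx22 0 1 (- 1) 0.

Lemma wdgM (A : 'M[K]_2) x y : wdg (A *m x) (A *m y) = \det A * wdg x y.
Proof. by rewrite /wdg !mulmx2E det2; ring. Qed.

Lemma wdg0x y : wdg 0 y = 0. Proof. by rewrite /wdg !mxE; ring. Qed.
Lemma wdgx0 x : wdg x 0 = 0. Proof. by rewrite /wdg !mxE; ring. Qed.
Lemma wdgZl a x y : wdg (a *: x) y = a * wdg x y.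
Proof. by rewrite /wdg !mxE; ring. Qed.
Lemma wdgZr a x y : wdg x (a *: y) = a * wdg x y.
Proof. by rewrite /wdg !mxE; ring. Qed.

Lemma wdg_mx (A : 'M[K]_2) x y : wdg x (A *m y) =
  x 0 0 * (A 1 0 * y 0 0 + A 1 1 * y 1 0) - x 1 0 *
    (A 0 0 * y 0 0 + A 0 1 * y 1 0).
Proof. by rewrite /wdg !mulmx2E. Qed.

Lemma wdg_mxJ (A : 'M[K]_2) x y : wdg x (A *m (Jmx *m y)) =
  x 0 0 * (A 1 0 * y 1 0 - A 1 1 * y 0 0) - x 1 0 *
    (A 0 0 * y 1 0 - A 0 1 * y 0 0).
Proof. by rewrite /wdg !mulmx2E !mx22E; ring. Qed.

Lemma tr_mxJ (A B D : 'M[K]_2) : \tr (A^T *m Jmx *m B *m D^T) =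
  (A 0 0 * B 1 0 - A 1 0 * B 0 0) * D 0 0 + (A 0 0 * B 1 1 - A 1 0 * B 0 1) *
    D 0 1
  + (A 0 1 * B 1 0 - A 1 1 * B 0 0) * D 1 0 + (A 0 1 * B 1 1 - A 1 1 * B 0 1) *
    D 1 1.
Proof.
have trE (M : 'M[K]_2) i j : M^T i j = M j i by rewrite mxE.
by rewrite mxtrace2 !mulmx2E !mx22E !trE; ring.
Qed.

Lemma Jmx_mul (A : 'M[K]_2) : A^T *m Jmx *m A = \det A *: Jmx.
Proof. by apply: mx2P; rewrite det2 !(mulmx2E, mx22E, mxE, mulmx2E) /=;
  ring. Qed.

Lemma det0_2 : \det (0 : 'M[K]_2) = 0.
Proof. by rewrite det2 !mxE mulr0 subrr. Qed.

End Matrix2.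

Ltac simp0 := rewrite ?(mul0mx, mulmx0, wdg0x, wdgx0, trmx0, mxtrace0, det0_2,
  mul0r, mulr0, subr0, sub0r, addr0, add0r, oppr0).

(** * Block coordinates *)

Section Blocks.
Variable R : realType.
Local Notation C := R[i].
Implicit Types X Y : jordan C.

Definition kmat X n := kblock (xo X n).1.
Definition lmat X n := kblock (xo X n).2.

(* Write S = k_J(M), a skew matrix of size 6, and k(a) for the 2 x 6 matrix of
   the row vector a.  With 1-based indices, [bs] = S_12, [br] = S_36,
   [bt] = S_45, [be], [bf] are the vectors S_1x, S_2x for x in {3, 6}, [bg],
   [bh] the vectors S_1y, S_2y for y in {4, 5}, [bW] = (S_xy), [b1], [b2] are
   the first two columns of k(a), and [bP], [bQ] its columns {3, 6}, {4, 5}.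
   The coordinates are locked because unification would otherwise unfold
   them. *)
Fact blk_key : unit. Proof. by []. Qed.
Definition bs := locked_with blk_key (fun X => xi X 0).
Definition br := locked_with blk_key (fun X => kmat X 0 0 0).
Definition bt := locked_with blk_key (fun X => - kmat X 0 1 1).
Definition be := locked_with blk_key
  (fun X => cv2 (- kmat X 2 0 1) (kmat X 1 1 1)).
Definition bf := locked_with blk_key
  (fun X => cv2 (- kmat X 2 1 1) (- kmat X 1 1 0)).
Definition bg := locked_with blk_key
  (fun X => cv2 (kmat X 2 0 0) (kmat X 1 0 1)).
Definition bh := locked_with blk_key
  (fun X => cv2 (kmat X 2 1 0) (- kmat X 1 0 0)).
Definition b1 := locked_with blk_key
  (fun X => cv2 (lmat X 0 0 0) (lmat X 0 1 0)).
Definition b2 := locked_with blk_key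
  (fun X => cv2 (lmat X 0 0 1) (lmat X 0 1 1)).
Definition bW := locked_with blk_key
  (fun X => mx22 (xi X 1) (- kmat X 0 0 1) (- kmat X 0 1 0) (- xi X 2)).
Definition bP := locked_with blk_key
  (fun X => mx22 (lmat X 1 0 0) (lmat X 2 0 1) (lmat X 1 1 0) (lmat X 2 1 1)).
Definition bQ := locked_with blk_key
  (fun X => mx22 (lmat X 1 0 1) (lmat X 2 0 0) (lmat X 1 1 1) (lmat X 2 1 0)).

Lemma bsE X : bs X = xi X 0.
Proof. by rewrite /bs locked_withE. Qed.
Lemma brE X : br X = kmat X 0 0 0.
Proof. by rewrite /br locked_withE. Qed.
Lemma btE X : bt X = - kmat X 0 1 1.
Proof. by rewrite /bt locked_withE. Qed.
Lemma beE X : be X = cv2 (- kmat X 2 0 1) (kmat X 1 1 1).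
Proof. by rewrite /be locked_withE. Qed.
Lemma bfE X : bf X = cv2 (- kmat X 2 1 1) (- kmat X 1 1 0).
Proof. by rewrite /bf locked_withE. Qed.
Lemma bgE X : bg X = cv2 (kmat X 2 0 0) (kmat X 1 0 1).
Proof. by rewrite /bg locked_withE. Qed.
Lemma bhE X : bh X = cv2 (kmat X 2 1 0) (- kmat X 1 0 0).
Proof. by rewrite /bh locked_withE. Qed.
Lemma b1E X : b1 X = cv2 (lmat X 0 0 0) (lmat X 0 1 0).
Proof. by rewrite /b1 locked_withE. Qed.
Lemma b2E X : b2 X = cv2 (lmat X 0 0 1) (lmat X 0 1 1).
Proof. by rewrite /b2 locked_withE. Qed.
Lemma bWE X : bW X = mx22 (xi X 1) (- kmat X 0 0 1) (- kmat X 0 1 0) (- xi X 2).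
Proof. by rewrite /bW locked_withE. Qed.
Lemma bPE X : bP X = mx22 (lmat X 1 0 0) (lmat X 2 0 1) (lmat X 1 1 0)
  (lmat X 2 1 1).
Proof. by rewrite /bP locked_withE. Qed.
Lemma bQE X : bQ X = mx22 (lmat X 1 0 1) (lmat X 2 0 0) (lmat X 1 1 1)
  (lmat X 2 1 0).
Proof. by rewrite /bQ locked_withE. Qed.

Definition blkE := (bsE, brE, btE, beE, bfE, bgE, bhE, b1E, b2E, bWE, bPE, bQE).

Fact bmk_key : unit. Proof. by []. Qed.
(** The inverse of the twelve coordinates. The signs come from J6, which turns a block ((a, b), (c,
    d)) of k(M) into ((-b, a), (-d, c)), from the conjugation of x_2 in the upper triangle, and from
    the skew symmetry of S. *)
Definition bmk_def (s r t : C) (e f g h n1 n2 : 'cV[C]_2) (W P Q : 'M[C]_2) :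
    jordan C :=
  mkj s (W 0 0) (- W 1 1)
    (kblock_inv (mx22 r (- W 0 1) (- W 1 0) (- t)),
     kblock_inv (mx22 (n1 0 0) (n2 0 0) (n1 1 0) (n2 1 0)))
    (kblock_inv (mx22 (- h 1 0) (g 1 0) (- f 1 0) (e 1 0)),
     kblock_inv (mx22 (P 0 0) (Q 0 0) (P 1 0) (Q 1 0)))
    (kblock_inv (mx22 (g 0 0) (- e 0 0) (h 0 0) (- f 0 0)),
     kblock_inv (mx22 (Q 0 1) (P 0 1) (Q 1 1) (P 1 1))).

Definition bmk := locked_with bmk_key bmk_def.

Lemma bmkE s r t e f g h n1 n2 W P Q
    (X := bmk s r t e f g h n1 n2 W P Q) :
  (bs X = s) * (br X = r) * (bt X = t) * (be X = e) * (bf X = f) * (bg X = g)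
  * (bh X = h) * (b1 X = n1) * (b2 X = n2) * (bW X = W) * (bP X = P)
  * (bQ X = Q).
Proof.
rewrite /X !blkE /kmat /lmat /bmk locked_withE /bmk_def.
rewrite !mkjE /= !kblock_invK !mx22E !opprK.
by do ![split]; (apply: mx2P || apply: cv2P); rewrite ?mx22E ?cv2E.
Qed.

Lemma bmkK X : bmk (bs X) (br X) (bt X) (be X) (bf X) (bg X) (bh X) (b1 X)
  (b2 X) (bW X) (bP X) (bQ X) = X.
Proof.
have mxK (A : 'M[C]_2) : mx22 (A 0 0) (A 0 1) (A 1 0) (A 1 1) = A.
  by apply: mx2P; rewrite mx22E.
rewrite /bmk locked_withE /bmk_def !blkE !mx22E !cv2E ?opprK !mxK !kblockK;
  apply: jordanP; rewrite !mkjE ?opprK //.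
- by case: (xo X 0).
- by case: (xo X 1).
- by case: (xo X 2).
Qed.

Lemma blkP X Y : bs X = bs Y -> br X = br Y -> bt X = bt Y -> be X = be Y ->
  bf X = bf Y -> bg X = bg Y -> bh X = bh Y -> b1 X = b1 Y -> b2 X = b2 Y ->
  bW X = bW Y -> bP X = bP Y -> bQ X = bQ Y -> X = Y.
Proof.
by move=> *; rewrite -[X]bmkK -[Y]bmkK; congr bmk.
Qed.

Lemma kmatP a X Y n s t :
  kmat (a *: X + Y) n s t = a * kmat X n s t + kmat Y n s t.
Proof. by rewrite /kmat xoD xoZ kblockP. Qed.
Lemma lmatP a X Y n s t :
  lmat (a *: X + Y) n s t = a * lmat X n s t + lmat Y n s t.
Proof. by rewrite /lmat xoD xoZ kblockP. Qed.

Lemma blkL a X Y (Z := a *: X + Y) :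
  (bs Z = a * bs X + bs Y) * (br Z = a * br X + br Y)
  * (bt Z = a * bt X + bt Y) * (be Z = a *: be X + be Y)
  * (bf Z = a *: bf X + bf Y) * (bg Z = a *: bg X + bg Y)
  * (bh Z = a *: bh X + bh Y) * (b1 Z = a *: b1 X + b1 Y)
  * (b2 Z = a *: b2 X + b2 Y) * (bW Z = a *: bW X + bW Y)
  * (bP Z = a *: bP X + bP Y) * (bQ Z = a *: bQ X + bQ Y).
Proof.
rewrite /Z !blkE.
by do ![split]; rewrite ?xiD ?xiZ ?kmatP ?lmatP ?mx22L ?cv2L ?mulrN ?opprD.
Qed.

(* The Pfaffian of S minus u S v^T, where u and v are the rows of k(a). *)
Definition cubicf (s r t : C) (e f g h n1 n2 : 'cV[C]_2)
  (W P Q : 'M[C]_2) : C :=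
  s * (r * t - \det W) - t * wdg e f - r * wdg g h - wdg e (W *m (Jmx _ *m h))
  + wdg f (W *m (Jmx _ *m g)) - s * wdg n1 n2
  - wdg n1 (P *m e) - wdg n2 (P *m f) - wdg n1 (Q *m g) - wdg n2 (Q *m h)
  - r * \det P - t * \det Q - \tr (P^T *m Jmx _ *m Q *m W^T).

Definition cubic X : C := cubicf (bs X) (br X) (bt X) (be X) (bf X) (bg X)
  (bh X) (b1 X) (b2 X) (bW X) (bP X) (bQ X).

Lemma kblockE (q : quat C) :
  (kblock q 0 0 = qco q 0 + 'i * qco q 1) *
    (kblock q 0 1 = qco q 2 + 'i * qco q 3)
  * (kblock q 1 0 = - (qco q 2 - 'i * qco q 3))
  * (kblock q 1 1 = qco q 0 - 'i * qco q 1).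
Proof. by rewrite !mxE. Qed.

(** Both sides are polynomials in the 27 coordinates of X, so expansion modulo i^2 = -1 decides the
    identity. *)
Lemma jdet_cubic X : jdet X = cubic X.
Proof.
have ii : 'i * 'i = -1 :> C by rewrite -expr2 sqr_i.
rewrite jdetE ?pnatr_eq0 // /cubic /cubicf tr_mxJ !wdg_mxJ !wdg_mx !det2 /wdg.
rewrite !blkE.
rewrite !cv2E.
rewrite !mx22E.
rewrite /kmat /lmat.
rewrite !kblockE /odot /ore /omul /=.
rewrite !(qcoD, qcoN, qcoM, qco_conj).
move: (xo X 0) (xo X 1) (xo X 2) (xi X 0) (xi X 1) (xi X 2) => [x1 y1] [x2 y2]
  [x3 y3] a b c /=.
by ring: ii.
Qed.
End Blocks.

(** * The Hermitian form in block coordinates *)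

Section Hermitian.
Variable R : realType.
Local Notation C := R[i].
Implicit Types X Y : jordan C.

Definition hp m n (A B : 'M[C]_(m, n)) : C := \tr (cconj A^T *m B).

Lemma cconjE m n (A : 'M[C]_(m, n)) i j : cconj A i j = conjc (A i j).
Proof. by rewrite mxE. Qed.

(** Passing to k doubles the Hermitian norm of a quaternion, since |x + iy|^2 + |x - iy|^2 = 2
    (|x|^2 + |y|^2). This absorbs the factor 2 of the off-diagonal terms in [jinnerE], so the block
    entries are orthonormal coordinates. *)
Lemma jherm_blk X Y : jherm X Y =
  conjc (bs X) * bs Y + conjc (br X) * br Y + conjc (bt X) * bt Y
  + hp (be X) (be Y) + hp (bf X) (bf Y) + hp (bg X) (bg Y) + hp (bh X) (bh Y)
  + hp (b1 X) (b1 Y) + hp (b2 X) (b2 Y)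
  + hp (bW X) (bW Y) + hp (bP X) (bP Y) + hp (bQ X) (bQ Y).
Proof.
have ii : 'i * 'i = -1 :> C by rewrite -expr2 sqr_i.
have hp2 (x y : 'cV[C]_2) :
    hp x y = conjc (x 0 0) * y 0 0 + conjc (x 1 0) * y 1 0.
  by rewrite /hp /mxtrace big_ord1 mulmx2E !cconjE [x^T _ _]mxE [x^T 0 1]mxE.
have hp4 (A B : 'M[C]_2) :
    hp A B = conjc (A 0 0) * B 0 0 + conjc (A 0 1) * B 0 1
    + conjc (A 1 0) * B 1 0 + conjc (A 1 1) * B 1 1.
  rewrite /hp mxtrace2 !mulmx2E !cconjE ![A^T _ _]mxE; ring.
have xiT n : xi (tauj X) n = conjc (xi X n) by rewrite /xi /tauj /= cconjE.
have xoT n : xo (tauj X) n = (cconj (xo X n).1, cconj (xo X n).2).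
  by rewrite /xo /tauj /= ffunE.
have qT (q : quat C) n : qco (cconj q) n = conjc (qco q n).
  by rewrite /qco cconjE.
rewrite /jherm jinnerE ?pnatr_eq0 // !xiT !xoT /odot /= !qT !hp2 !hp4.
rewrite !blkE !mx22E !cv2E /kmat /lmat.
have cN (z : C) : conjc (- z) = - conjc z by exact: rmorphN.
have kc (q : quat C) :
    (conjc (kblock q 0 0) = conjc (qco q 0) - 'i * conjc (qco q 1) )
  * (conjc (kblock q 0 1) = conjc (qco q 2) - 'i * conjc (qco q 3) )
  * (conjc (kblock q 1 0) = - (conjc (qco q 2) + 'i * conjc (qco q 3) ))
  * (conjc (kblock q 1 1) = conjc (qco q 0) + 'i * conjc (qco q 1) ).
  have cD (z w : C) : conjc (z + 'i * w) = conjc z - 'i * conjc w.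
    by case: z w => [? ?] [? ?]; apply/eqP; rewrite eq_complex /=; apply/andP;
      split; apply/eqP; ring.
  have cB (z w : C) : conjc (z - 'i * w) = conjc z + 'i * conjc w.
    by case: z w => [? ?] [? ?]; apply/eqP; rewrite eq_complex /=; apply/andP;
      split; apply/eqP; ring.
  by rewrite !kblockE cN !cD !cB.
rewrite !cN !kc !kblockE.
move: (xo X 0) (xo X 1) (xo X 2) (xi X 0) (xi X 1) (xi X 2) => [x1 y1] [x2 y2]
  [x3 y3] a b c /=.
move: (xo Y 0) (xo Y 1) (xo Y 2) (xi Y 0) (xi Y 1) (xi Y 2) => [x'1 y'1]
  [x'2 y'2] [x'3 y'3] a' b' c' /=.
by ring: ii.
Qed.

End Hermitian.

(** * The actions of sigma3 and nu3 *)

Section Actions.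
Variable R : realType.
Local Notation C := R[i].
Implicit Types X Y : jordan C.

Definition wc : C := (- 2^-1) +i* (Num.sqrt 3 / 2).
Definition wc' : C := (- 2^-1) +i* (- (Num.sqrt 3 / 2)).

Lemma wc_sum : wc + wc' = -1.
Proof.
by apply/eqP; rewrite eq_complex /=; apply/andP; split; apply/eqP; field.
Qed.

Lemma wc_mul : wc * wc' = 1.
Proof.
have s3 : Num.sqrt 3 ^+ 2 = 3 :> R by rewrite sqr_sqrtr ?ler0n.
apply/eqP; rewrite eq_complex /=; apply/andP; split; apply/eqP; last by ring.
by field: s3.
Qed.

Lemma wc_sqr : wc * wc = wc'.
Proof.
have e : wc' = -1 - wc by rewrite -wc_sum; ring.
have -> : wc * wc = - (wc * wc') - wc by rewrite e; ring.
by rewrite wc_mul e.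
Qed.
Lemma wc'_sqr : wc' * wc' = wc.
Proof. by rewrite -{1}wc_sqr -mulrA wc_mul mulr1. Qed.

Lemma kblock_omega : kblock (qC (omega R)) = mx22 wc 0 0 wc'.
Proof.
have qE (q : quat R) n : qco (qC q) n = (qco q n)%:C by rewrite /qco mxE.
apply: mx2P; rewrite ?mx22E !kblockE !qE !mkqE.
all: apply/eqP; rewrite eq_complex /=; apply/andP; split; apply/eqP; ring.
Qed.

Lemma kblock_conj (q : quat C) :
  kblock (qconj q) = mx22 (kblock q 1 1) (- kblock q 0 1) (- kblock q 1 0)
    (kblock q 0 0).
Proof. apply: mx2P; rewrite ?mx22E !kblockE !qco_conj; ring. Qed.

Lemma omul_quatl (q : quat C) (x : cayley C) :
  omul (q, 0) x = (q * x.1, x.2 * q).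
Proof. by rewrite /omul /= mulr0 mul0r subr0 add0r. Qed.

Lemma qconj0 : qconj (0 : quat C) = 0.
Proof. by apply: quatP; rewrite !qco_conj !qco0 ?oppr0. Qed.

Lemma omul_quatr (q : quat C) (x : cayley C) :
  omul x (q, 0) = (x.1 * q, x.2 * qconj q).
Proof. by rewrite /omul /= qconj0 !mul0r subr0 addr0. Qed.

Lemma kmat_sigma3 X (Y := sigma3 R X) :
  (kmat Y 0 = mx22 (wc * kmat X 0 0 0) (kmat X 0 0 1) (kmat X 0 1 0)
    (wc' * kmat X 0 1 1))
  * (kmat Y 1 = mx22 (wc * kmat X 1 0 0) (wc * kmat X 1 0 1)
    (wc' * kmat X 1 1 0) (wc' * kmat X 1 1 1))
  * (kmat Y 2 = mx22 (wc * kmat X 2 0 0) (wc' * kmat X 2 0 1)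
    (wc * kmat X 2 1 0) (wc' * kmat X 2 1 1)).
Proof.
have -> : Y = jtwist (omegaO R) X by rewrite /Y /sigma3 lfunE.
have oc : oconj (omegaO R) = (qconj (qC (omega R)), 0).
  by rewrite /oconj /= oppr0.
rewrite /kmat /jtwist !mkjE oc omul_quatl !omul_quatr omul_quatl /=.
rewrite !kblockM kblock_conj kblock_omega !mx22E.
by do ![split]; apply: mx2P; rewrite mx22E !mulmx2E !mx22E;
  ring: wc_mul wc_sqr wc'_sqr.
Qed.

Lemma lmat_sigma3 X (Y := sigma3 R X) :
  (lmat Y 0 = lmat X 0)
  * (lmat Y 1 = mx22 (wc * lmat X 1 0 0) (wc' * lmat X 1 0 1)
    (wc * lmat X 1 1 0) (wc' * lmat X 1 1 1))
  * (lmat Y 2 = mx22 (wc' * lmat X 2 0 0) (wc * lmat X 2 0 1)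
    (wc' * lmat X 2 1 0) (wc * lmat X 2 1 1)).
Proof.
have -> : Y = jtwist (omegaO R) X by rewrite /Y /sigma3 lfunE.
have oc : oconj (omegaO R) = (qconj (qC (omega R)), 0).
  by rewrite /oconj /= oppr0.
rewrite /lmat /jtwist !mkjE oc omul_quatl !omul_quatr omul_quatl /= qconjK.
rewrite !kblockM kblock_conj kblock_omega !mx22E.
by do ![split]; apply: mx2P; rewrite ?mx22E !mulmx2E ?mulmx2E !mx22E;
  ring: wc_mul wc_sqr wc'_sqr.
Qed.

Lemma sigma3_blk X (Y := sigma3 R X) :
  (bs Y = bs X) * (br Y = wc * br X) * (bt Y = wc' * bt X)
  * (be Y = wc' *: be X) * (bf Y = wc' *: bf X) * (bg Y = wc *: bg X)
  * (bh Y = wc *: bh X) * (b1 Y = b1 X) * (b2 Y = b2 X)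
  * (bW Y = bW X) * (bP Y = wc *: bP X) * (bQ Y = wc' *: bQ X).
Proof.
rewrite !blkE.
rewrite /Y !kmat_sigma3 !lmat_sigma3 !mx22E !cv2Z !mx22Z !mulrN.
by rewrite /sigma3 !lfunE /= /sigma3_fun /jtwist !mkjE.
Qed.

(** [dnu] is the diagonal of [nu_mx]; [dnu'] is that diagonal after being moved across J6, which
    exchanges the two indices of each pair and hence matters only for the first pair. *)
Definition dnu (j : nat) : C := if j == 0%N then nu R ^+ 5 else (nu R)^-1.
Definition dnu' (j : nat) : C := if j == 1%N then nu R ^+ 5 else (nu R)^-1.

Lemma kJinv_nu (M : 'M[quat C]_3) i j :
  (nu_mx R *m kJ M *m (nu_mx R)^T *m invmx (J6 R)) i j =
  dnu i * dnu' j * kmx M i j.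
Proof.
have nuE : nu_mx R = diag_mx (\row_(j < 6) dnu j).
  rewrite /nu_mx; congr diag_mx; apply/rowP => k; rewrite !mxE.
have J6D : J6 R *m diag_mx (\row_(j < 6) dnu j) = diag_mx
  (\row_(j < 6) dnu' j) *m J6 R.
  apply/matrixP => k l; rewrite mul_mx_diag mul_diag_mx !mxE.
  by case: k l => [[|[|[|[|[|[|]]]]]] // ?] [[|[|[|[|[|[|]]]]]] // ?];
    rewrite /dnu /dnu' /=; ring.
rewrite nuE tr_diag_mx /kJ -!mulmxA (mulmxA (J6 R)) J6D -(mulmxA _ (J6 R)).
rewrite mulmxV ?J6_unit // mulmx1 mul_mx_diag mul_diag_mx !mxE; ring.
Qed.

Lemma kinv_block (N : 'M[C]_6) (i j : 'I_3) (s t : 'I_2) :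
  kblock (kinv N i j) s t = N (inord (2 * i + s)) (inord (2 * j + t)).
Proof. by rewrite [kinv N i j]mxE kblock_invK mxE. Qed.

Lemma kmx_block (M : 'M[quat C]_3) (i j : 'I_3) (s t : 'I_2) :
  kmx M (inord (2 * i + s)) (inord (2 * j + t)) = kblock (M i j) s t.
Proof. by rewrite -kinv_block kmxK. Qed.

Lemma kJinv_nu_block (M : 'M[quat C]_3) (i j : 'I_3) (s t : 'I_2) :
  kblock (kJinv (nu_mx R *m kJ M *m (nu_mx R)^T) i j) s t =
  dnu (2 * i + s)%N * dnu' (2 * j + t)%N * kblock (M i j) s t.
Proof.
have lt6 (u : 'I_3) (v : 'I_2) : (2 * u + v < 6)%N.
  by case: u v => [[|[|[|]]] // ?] [[|[|]] // ?].
by rewrite /kJinv kinv_block kJinv_nu kmx_block !inordK.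
Qed.

Lemma nuX n :
  nu R ^+ n = cos (n%:R * (2 * pi / 9)) +i* sin (n%:R * (2 * pi / 9)).
Proof.
elim: n => [|n IHn]; first by rewrite mul0r cos0 sin0.
rewrite exprS IHn -[n.+1%:R]natr1 [(n%:R + 1) * _]mulrDl mul1r cosD sinD.
by apply/eqP; rewrite eq_complex /=; apply/andP; split; apply/eqP; rewrite /=;
  ring.
Qed.

Lemma nu9 : nu R ^+ 9 = 1.
Proof.
rewrite nuX (_ : 9%:R * _ = pi *+ 2); last by rewrite -mulr_natl; field.
by rewrite cos2pi sin2pi.
Qed.

(** The eigenvalues nu, nu^4 and nu^7 of nu3 differ by powers of nu^3, so this inequality separates
    all of them. *)
Lemma nu3_neq1 : nu R ^+ 3 != 1.
Proof.
rewrite nuX (_ : 3%:R * _ = pi * (2 / 3)); last by field.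
apply/eqP => -[_ /eqP]; apply/negP; rewrite gt_eqF // sin_gt0_pi //.
rewrite gtr_pMr ?pi_gt0 // ltr_pdivrMr ?ltr0n // mul1r ltr_nat andbT.
by apply: mulr_gt0; [exact: pi_gt0 | rewrite divr_gt0 ?ltr0n].
Qed.

Lemma nuV : (nu R)^-1 = nu R ^+ 8.
Proof.
have n0 : nu R != 0.
  by apply/eqP => h; have := nu9; rewrite h expr0n /= => /eqP;
    rewrite eq_sym oner_eq0.
by apply: (mulfI n0); rewrite mulfV // -exprS nu9.
Qed.

Lemma kmat_nu3 X (Y := nu3 R X) :
  (kmat Y 0 = nu R ^+ 7 *: kmat X 0)
  * (kmat Y 1 = mx22 (nu R ^+ 7 * kmat X 1 0 0) (nu R ^+ 4 * kmat X 1 0 1)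
                     (nu R ^+ 7 * kmat X 1 1 0) (nu R ^+ 4 * kmat X 1 1 1))
  * (kmat Y 2 = mx22 (nu R ^+ 4 * kmat X 2 0 0) (nu R ^+ 4 * kmat X 2 0 1)
                     (nu R ^+ 7 * kmat X 2 1 0) (nu R ^+ 7 * kmat X 2 1 1)).
Proof.
have ne := nu9.
have jE : (jM X 1 (inord 2) = (xo X 0).1) * (jM X (inord 2) 0 = (xo X 1).1)
    * (jM X 0 1 = (xo X 2).1).
  by rewrite !mxE !inordK.
rewrite /Y /nu3 /phi lfunE /= /phi_fun /jglue /kmat !mkjE /=.
by do ![split]; apply: mx2P;
  rewrite ?mx22E ?[RHS]mxE ?kJinv_nu_block ?jE /dnu /dnu' ?inordK //=
  nuV; ring: ne.
Qed.

Lemma xi_nu3 X (Y := nu3 R X) : (xi Y 0 = nu R ^+ 4 * xi X 0)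
  * (xi Y 1 = nu R ^+ 7 * xi X 1) * (xi Y 2 = nu R ^+ 7 * xi X 2).
Proof.
have ne := nu9.
have q0 (q : quat C) : qco q 0 = (kblock q 0 0 + kblock q 1 1) / 2.
  by rewrite !kblockE; field.
have jE : (jM X 0 0 = qscal (xi X 0)) * (jM X 1 1 = qscal (xi X 1))
    * (jM X (inord 2) (inord 2) = qscal (xi X 2)).
  by rewrite !mxE !inordK.
have ks (z : C) : (kblock (qscal z) 0 0 = z) * (kblock (qscal z) 1 1 = z).
  by rewrite !kblockE /qscal !mkqE mulr0 addr0 subr0.
rewrite /Y /nu3 /phi lfunE /= /phi_fun /jglue !mkjE !q0 !kJinv_nu_block !jE !ks.
by rewrite /dnu /dnu' !inordK //= nuV; do ![split]; field: ne.
Qed.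

Lemma conj_dnu j : conjc (dnu j) = (dnu j)^-1.
Proof.
have cn : conjc (nu R) = (nu R)^-1.
  have n0 : nu R != 0.
    by apply/eqP => h; have := nu_conj R; rewrite h mulr0 => /eqP;
      rewrite eq_sym oner_eq0.
  by apply: (mulIf n0); rewrite nu_conj mulVf.
have cX : conjc (nu R ^+ 5) = conjc (nu R) ^+ 5 by exact: rmorphXn.
by rewrite /dnu; case: ifP => _; rewrite ?cX -?cn ?conjcK cn ?exprVn ?invrK.
Qed.

Lemma kblock0 : kblock (0 : quat C) = 0.
Proof.
by apply: mx2P; rewrite !kblockE !qco0 !mxE ?mulr0 ?addr0 ?subr0 ?oppr0.
Qed.

Lemma qC1 : qC (1 : quat R) = 1.
Proof.
have qE (q : quat R) n : qco (qC q) n = (qco q n)%:C by rewrite /qco mxE.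
by apply: quatP; rewrite qE !qoneE !mkqE.
Qed.

Lemma lmat_nu3 X (Y := nu3 R X) :
  (lmat Y 0 = mx22 (nu R ^+ 4 * lmat X 0 0 0) (nu R * lmat X 0 0 1)
                   (nu R ^+ 4 * lmat X 0 1 0) (nu R * lmat X 0 1 1))
  * (lmat Y 1 = nu R *: lmat X 1) * (lmat Y 2 = nu R *: lmat X 2).
Proof.
have ne := nu9.
have lt6 (u : 'I_3) (v : 'I_2) : (2 * u + v < 6)%N.
  by case: u v => [[|[|[|]]] // ?] [[|[|]] // ?].
pose D := cconj (nu_mx R)^T.
have DE : D = diag_mx (\row_(j < 6) (dnu j)^-1).
  apply/matrixP => i j; rewrite !mxE.
  by case: (eqVneq i j) => [->|ij];
    rewrite ?mulr1n ?mulr0n -?conj_dnu // rmorph0.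
have DB (k j : 'I_3) s t : kblock (kinv D k j) s t =
    if (k == j) && (s == t) then (dnu (2 * k + s)%N)^-1 else 0.
  rewrite kinv_block DE !mxE !inordK // -val_eqE /= !inordK //.
  rewrite (_ : _ == _ = ((k == j) && (s == t))); first by case: ifP.
  by case: k j s t => [[|[|[|]]] // ?] [[|[|[|]]] // ?] [[|[|]] // ?]
    [[|[|]] // ?].
(* [kinv D] is diagonal over the quaternions, so the row product collapses to one factor per
   entry. *)
have Y2 (j : 'I_3) : (qC (1 : quat R) *: ja X *m kinv D) 0 j = (xo X j).2 *
  kinv D j j.
  rewrite qC1 scale1r mxE (bigD1 j) //= big1 ?addr0 ?mxE // => k kj.
  have -> : kinv D k j = 0; last by rewrite mulr0.
  apply: (can_inj (@kblockK R)); apply/matrixP => s t.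
  by rewrite DB kblock0 (negbTE kj) mxE.
have n5V : (nu R ^+ 5)^-1 = nu R ^+ 4.
  by rewrite -exprVn nuV; ring: ne.
rewrite /Y /nu3 /phi lfunE /= /phi_fun /jglue /lmat !mkjE /= !Y2 !kblockM
  !inordK //.
by do ![split]; apply: mx2P;
  rewrite ?mx22E ?[RHS]mxE mulmx2E !DB ?eqxx /= ?inordK // /dnu /=
  ?invrK ?n5V; ring: ne.
Qed.

(** The entries S_1x get nu^5 nu^-1 = nu^4, the other entries of S get nu^-2 = nu^7, the first
    column of k(a) gets nu^-5 = nu^4 and the other columns get nu. That nu^4 arises twice, as nu^9 =
    1, is why s and n1 are not separated. *)
Lemma nu3_blk X (n := nu R) (Y := nu3 R X) :
  (bs Y = n ^+ 4 * bs X) * (br Y = n ^+ 7 * br X) * (bt Y = n ^+ 7 * bt X)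
  * (be Y = n ^+ 4 *: be X) * (bf Y = n ^+ 7 *: bf X) * (bg Y = n ^+ 4 *: bg X)
  * (bh Y = n ^+ 7 *: bh X) * (b1 Y = n ^+ 4 *: b1 X) * (b2 Y = n *: b2 X)
  * (bW Y = n ^+ 7 *: bW X) * (bP Y = n *: bP X) * (bQ Y = n *: bQ X).
Proof.
rewrite !blkE.
have zE (a : C) (A : 'M[C]_2) i j : (a *: A) i j = a * A i j by rewrite mxE.
rewrite /Y !kmat_nu3 !lmat_nu3 !xi_nu3 !zE !mx22E !cv2Z !mx22Z !mulrN.
by [].
Qed.

End Actions.

(** * The subgroup Phi *)

Section Phi.
Variable R : realType.
Local Notation C := R[i].
Implicit Types (X Y : jordan C) (p U V : 'M[C]_2) (a b : C).

Lemma hpMl m n (A : 'M[C]_m) (x y : 'M[C]_(m, n)) :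
  cconj A^T *m A = 1%:M -> hp (A *m x) (A *m y) = hp x y.
Proof.
move=> uA; rewrite /hp trmx_mul cconjM -mulmxA (mulmxA (cconj A^T)) uA.
by rewrite mul1mx.
Qed.

Lemma hpMr m n (A : 'M[C]_n) (x y : 'M[C]_(m, n)) :
  A *m cconj A^T = 1%:M -> hp (x *m A) (y *m A) = hp x y.
Proof.
move=> uA; rewrite /hp trmx_mul cconjM -mulmxA mxtrace_mulC -!mulmxA uA.
by rewrite mulmx1 mxtrace_mulC.
Qed.

Lemma hpZ m n a b (x y : 'M[C]_(m, n)) :
  hp (a *: x) (b *: y) = conjc a * b * hp x y.
Proof.
rewrite /hp (_ : cconj (a *: x)^T = conjc a *: cconj x^T).
  by rewrite -scalemxAl -scalemxAr scalerA mxtraceZ.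
by apply/matrixP => i j; rewrite !mxE rmorphM.
Qed.

Lemma cconjK m n (A : 'M[C]_(m, n)) : cconj (cconj A) = A.
Proof. by apply/matrixP => i j; rewrite !mxE conjcK. Qed.

Lemma cconjT m n (A : 'M[C]_(m, n)) : cconj A^T = (cconj A)^T.
Proof. by apply/matrixP => i j; rewrite !mxE. Qed.

Lemma bmk_lin c X Y :
  c *: X + Y = bmk (c * bs X + bs Y) (c * br X + br Y) (c * bt X + bt Y)
    (c *: be X + be Y) (c *: bf X + bf Y) (c *: bg X + bg Y) (c *: bh X + bh Y)
    (c *: b1 X + b1 Y) (c *: b2 X + b2 Y) (c *: bW X + bW Y) (c *: bP X + bP Y)
    (c *: bQ X + bQ Y).
Proof. by rewrite -[LHS]bmkK !blkL. Qed.

Lemma bmkL c (s r t s' r' t' : C) (e f g h n1 n2 e' f' g' h' n1' n2' : 'cV[C]_2)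
    (W P Q W' P' Q' : 'M[C]_2) :
  c *: bmk s r t e f g h n1 n2 W P Q + bmk s' r' t' e' f' g' h' n1' n2' W' P' Q'
  = bmk (c * s + s') (c * r + r') (c * t + t') (c *: e + e') (c *: f + f')
    (c *: g + g') (c *: h + h') (c *: n1 + n1') (c *: n2 + n2') (c *: W + W')
    (c *: P + P') (c *: Q + Q').
Proof. by rewrite bmk_lin !bmkE. Qed.

(* The action of phi(p, A) for A = diag(a, b, U, V), where a, b act on the
   coordinates 1, 2, U on {3, 6} and V on {4, 5}. *)
Definition Phi_fun p a b U V X : jordan C :=
  bmk (a * b * bs X) (\det U * br X) (\det V * bt X)
    (a *: (U *m be X)) (b *: (U *m bf X)) (a *: (V *m bg X)) (b *: (V *m bh X))
    (a^-1 *: (p *m b1 X)) (b^-1 *: (p *m b2 X))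
    (U *m bW X *m V^T) (p *m bP X *m cconj U^T) (p *m bQ X *m cconj V^T).

Fact Phi_fun_linear p a b U V : linear (Phi_fun p a b U V).
Proof.
move=> c X Y; rewrite /Phi_fun bmkL.
have := blkL c X Y; rewrite /=; move: (c *: X + Y) => Z e; rewrite !e.
congr bmk; rewrite ?mulmxDr ?mulmxDl ?scalerDr -?scalemxAr -?scalemxAl
  ?scalerA 1?[c * _]mulrC //; ring.
Qed.
HB.instance Definition _ p a b U V :=
  GRing.isLinear.Build C (jordan C) (jordan C) _ (Phi_fun p a b U V)
    (Phi_fun_linear p a b U V).

Definition Phi p a b U V : 'End(jordan C) := linfun (Phi_fun p a b U V).

Lemma Phi_blk p a b U V X (Y := Phi p a b U V X) :
  (bs Y = a * b * bs X) * (br Y = \det U * br X) * (bt Y = \det V * bt X)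
  * (be Y = a *: (U *m be X)) * (bf Y = b *: (U *m bf X))
  * (bg Y = a *: (V *m bg X)) * (bh Y = b *: (V *m bh X))
  * (b1 Y = a^-1 *: (p *m b1 X)) * (b2 Y = b^-1 *: (p *m b2 X))
  * (bW Y = U *m bW X *m V^T) * (bP Y = p *m bP X *m cconj U^T)
  * (bQ Y = p *m bQ X *m cconj V^T).
Proof. by rewrite /Y /Phi lfunE /= /Phi_fun !bmkE. Qed.

Lemma PhiM p a b U V p' a' b' U' V' :
  Phi (p *m p') (a * a') (b * b') (U *m U') (V *m V') =
  (Phi p a b U V \o Phi p' a' b' U' V')%VF.
Proof.
apply/lfunP => X; rewrite comp_lfunE; apply: blkP; rewrite !Phi_blk.
all: rewrite ?det_mulmx ?trmx_mul ?cconjM ?invfM -?scalemxAr -?scalemxAl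
  ?scalerA ?mulmxA //.
- by rewrite !mulrA [a * a' * b]mulrAC.
- by rewrite !mulrA.
- by rewrite !mulrA.
Qed.

Lemma Phi1 : Phi 1%:M 1 1 1%:M 1%:M = \1%VF.
Proof.
apply/lfunP => X; rewrite id_lfunE; apply: blkP; rewrite !Phi_blk.
all: rewrite ?det1 ?trmx1 ?invr1 ?mulr1 ?mul1r ?scale1r ?mul1mx //.
all: rewrite /cconj ?map_mx1 ?mulmx1 //.
Qed.

(** Each term is an SL(2)-type invariant, multiplied by a b det U det V, by |det U|^2, by |det V|^2
    or by a power of det p, each of which is 1. *)
Lemma cubicfM p a b U V s r t e f g h n1 n2 W P Q :
  \det p = 1 -> a != 0 -> b != 0 ->
  cconj U^T *m U = 1%:M -> cconj V^T *m V = 1%:M ->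
  a * b * \det U * \det V = 1 ->
  cubicf (a * b * s) (\det U * r) (\det V * t)
    (a *: (U *m e)) (b *: (U *m f)) (a *: (V *m g)) (b *: (V *m h))
    (a^-1 *: (p *m n1)) (b^-1 *: (p *m n2))
    (U *m W *m V^T) (p *m P *m cconj U^T) (p *m Q *m cconj V^T) =
  cubicf s r t e f g h n1 n2 W P Q.
Proof.
move=> dp a0 b0 uU uV d1.
have dUs : \det U * \det (cconj U^T) = 1 by rewrite mulrC -det_mulmx uU det1.
have dVs : \det V * \det (cconj V^T) = 1 by rewrite mulrC -det_mulmx uV det1.
have t1 x y : wdg (a *: (U *m x)) (U *m W *m V^T *m
  (Jmx C *m (b *: (V *m y)))) =
    wdg x (W *m (Jmx C *m y)).
  (* W carries V^T on its right, not the inverse of V; moving it past J produces det V, the factor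
     missing from a b det U. *)
  have JV z : V^T *m (Jmx C *m (V *m z)) = \det V *: (Jmx C *m z).
    by rewrite !mulmxA Jmx_mul -scalemxAl.
  rewrite -!scalemxAr -!mulmxA JV -!scalemxAr !wdgZl !wdgZr wdgM.
  by rewrite -[RHS]mul1r -d1; ring.
have t1' x y : wdg (b *: (U *m x)) (U *m W *m V^T *m
  (Jmx C *m (a *: (V *m y)))) =
    wdg x (W *m (Jmx C *m y)).
  by rewrite -t1 -!scalemxAr !wdgZl !wdgZr; ring.
have t2 c (A M : 'M[C]_2) x y : c != 0 -> cconj A^T *m A = 1%:M ->
    wdg (c^-1 *: (p *m x)) (p *m M *m cconj A^T *m (c *: (A *m y))) = wdg x
      (M *m y).
  move=> c0 uA; rewrite -!scalemxAr -!mulmxA (mulmxA (cconj A^T)) uA mul1mx.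
  by rewrite wdgZl wdgZr wdgM dp mul1r mulrA mulVf ?mul1r.
have t3 : \tr ((p *m P *m cconj U^T)^T *m Jmx C *m (p *m Q *m cconj V^T)
    *m (U *m W *m V^T)^T) = \tr (P^T *m Jmx C *m Q *m W^T).
  have Jp (Z : 'M[C]_2) : p^T *m (Jmx C *m (p *m Z)) = Jmx C *m Z.
    by rewrite !mulmxA Jmx_mul dp scale1r.
  have UU : U^T *m (cconj U^T)^T = 1%:M by rewrite -trmx_mul uU trmx1.
  rewrite !trmx_mul trmxK -!mulmxA (mulmxA (cconj V^T)) uV mul1mx.
  by rewrite mxtrace_mulC -!mulmxA UU mulmx1 Jp.
rewrite /cubicf t1 t1' !t2 // t3 !det_mulmx det_tr dp !(wdgZl, wdgZr) !wdgM dp.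
have -> : a * b * s * (\det U * r * (\det V * t) - \det U * \det W * \det V) =
    a * b * \det U * \det V * (s * (r * t - \det W)) by ring.
have -> : \det V * t * (a * (b * (\det U * wdg e f))) =
    a * b * \det U * \det V * (t * wdg e f) by ring.
have -> : \det U * r * (a * (b * (\det V * wdg g h))) =
    a * b * \det U * \det V * (r * wdg g h) by ring.
have -> : \det U * r * (1 * \det P * \det (cconj U^T)) =
    \det U * \det (cconj U^T) * (r * \det P) by ring.
have -> : \det V * t * (1 * \det Q * \det (cconj V^T)) =
    \det V * \det (cconj V^T) * (t * \det Q) by ring.
have -> : a * b * s * (a^-1 * (b^-1 * (1 * wdg n1 n2))) = s * wdg n1 n2.
  by field; rewrite a0 b0.
by rewrite d1 dUs dVs !mul1r.
Qed.

Lemma cubicM p a b U V X : \det p = 1 -> a != 0 -> b != 0 ->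
  cconj U^T *m U = 1%:M -> cconj V^T *m V = 1%:M ->
  a * b * \det U * \det V = 1 ->
  cubic (Phi p a b U V X) = cubic X.
Proof. by move=> *; rewrite /cubic !Phi_blk cubicfM. Qed.

Definition unimod a := conjc a * a = 1.

Lemma unimod_neq0 a : unimod a -> a != 0.
Proof.
by move=> ua; apply/eqP => a0; move/eqP: ua; rewrite a0 mulr0 eq_sym oner_eq0.
Qed.

Lemma unimodV a : unimod a -> unimod a^-1.
Proof. by rewrite /unimod fmorphV /= -invfM mulrC => ->; rewrite invr1. Qed.

Lemma unimodM a b : unimod a -> unimod b -> unimod (a * b).
Proof. by rewrite /unimod => ha hb; rewrite rmorphM mulrACA ha hb mulr1. Qed.

Lemma unimod_det n (A : 'M[C]_n) : cconj A^T *m A = 1%:M -> unimod (\det A).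
Proof.
move=> uA; have := congr1 determinant uA.
by rewrite det_mulmx det1 /cconj (det_map_mx (@conjc R)) det_tr.
Qed.

Definition unitary n (A : 'M[C]_n) := cconj A^T *m A = 1%:M.

Lemma unitaryZ z U : unimod z -> unitary U -> unitary (z *: U).
Proof.
move=> uz uU; rewrite /unitary.
have -> : cconj (z *: U)^T = conjc z *: cconj U^T.
  by apply/matrixP => i j; rewrite !mxE rmorphM.
by rewrite -scalemxAl -scalemxAr scalerA uz uU scale1r.
Qed.

Lemma jhermM p a b U V X Y : unitary p -> unitary U -> unitary V ->
  unimod a -> unimod b ->
  jherm (Phi p a b U V X) (Phi p a b U V Y) = jherm X Y.
Proof.
move=> up uU uV ua ub.
have uT (A : 'M[C]_2) : unitary A -> A^T *m cconj A^T^T = 1%:M.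
  by move=> uA; rewrite cconjT -trmx_mul uA trmx1.
have uS (A : 'M[C]_2) : unitary A -> cconj A^T *m cconj (cconj A^T)^T = 1%:M.
  by move=> uA; rewrite !cconjT trmxK cconjK -cconjT.
have us c x y : unimod c -> conjc (c * x) * (c * y) = conjc x * y.
  by rewrite /unimod => uc; rewrite rmorphM mulrACA uc mul1r.
have := unimodM ua ub; have := unimod_det uU; have := unimod_det uV =>
  uv uu uab.
rewrite !jherm_blk !Phi_blk (us _ _ _ uab) (us _ _ _ uu) (us _ _ _ uv) !hpZ.
by rewrite !(hpMr _ _ (uT _ _)) // !(hpMr _ _
  (uS _ _)) // !hpMl // ua ub !(unimodV ua) !(unimodV ub) !mul1r.
Qed.

End Phi.

(** * Elements commuting with sigma3 and nu3 *)

Section Centralizer.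
Variable R : realType.
Local Notation C := R[i].
Local Notation J := (jordan C).
Implicit Types (X Y : J) (alpha beta : 'End(jordan C)).

Lemma blk0 : (bs (0 : J) = 0) * (br (0 : J) = 0) * (bt (0 : J) = 0)
  * (be (0 : J) = 0) * (bf (0 : J) = 0) * (bg (0 : J) = 0) * (bh (0 : J) = 0)
  * (b1 (0 : J) = 0) * (b2 (0 : J) = 0) * (bW (0 : J) = 0) * (bP (0 : J) = 0)
  * (bQ (0 : J) = 0).
Proof.
have e := blkL (-1) (0 : J) 0; rewrite /= scaler0 addr0 in e.
by do ![split]; rewrite e ?scaleN1r ?mulN1r addNr.
Qed.

Lemma bmk0 : bmk 0 0 0 0 0 0 0 0 0 0 0 0 = 0 :> J.
Proof. by rewrite -[RHS]bmkK !blk0. Qed.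

Lemma bmkZ c (s r t : C) (e f g h n1 n2 : 'cV[C]_2) (W P Q : 'M[C]_2) :
  c *: bmk s r t e f g h n1 n2 W P Q = bmk (c * s) (c * r) (c * t)
    (c *: e) (c *: f) (c *: g) (c *: h) (c *: n1) (c *: n2)
    (c *: W) (c *: P) (c *: Q).
Proof. by rewrite -[LHS]addr0 -[X in _ + X]bmk0 bmkL !addr0. Qed.

Lemma wc_neq0 : wc R != 0.
Proof.
by apply/eqP => h; have := wc_mul R; rewrite h mul0r => /eqP;
  rewrite eq_sym oner_eq0.
Qed.
Lemma wc'_neq0 : wc' R != 0.
Proof.
by apply/eqP => h; have := wc_mul R; rewrite h mulr0 => /eqP;
  rewrite eq_sym oner_eq0.
Qed.
Lemma nu_neq0 : nu R != 0.
Proof.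
by apply/eqP => h; have := nu9 R; rewrite h expr0n /= => /eqP;
  rewrite eq_sym oner_eq0.
Qed.

Lemma wc_neq1 : wc R != 1.
Proof.
apply/eqP => h; have := wc_mul R; rewrite h mul1r => h'.
have := wc_sum R; rewrite h h' => /eqP; rewrite -subr_eq0 opprK.
by rewrite (_ : 1 + 1 + 1 = 3%:R :> C); [rewrite pnatr_eq0 | ring].
Qed.
Lemma wc'_neq1 : wc' R != 1.
Proof.
apply: contra wc_neq1 => /eqP h; have := wc_mul R; rewrite h mulr1 => -> //.
Qed.
Lemma wc_neq : wc R != wc' R.
Proof.
apply: contra wc_neq1 => /eqP h; apply/eqP/(mulfI wc_neq0).
by rewrite wc_sqr mulr1.
Qed.
Lemma nu41 : nu R ^+ 4 != nu R.
Proof.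
apply: contra (nu3_neq1 R) => /eqP h; apply/eqP/(mulfI nu_neq0).
by rewrite mulr1 -exprS.
Qed.
Lemma nu74 : nu R ^+ 7 != nu R ^+ 4.
Proof.
apply: contra (nu3_neq1 R) => /eqP h; apply/eqP/(mulfI (expf_neq0 4 nu_neq0)).
by rewrite mulr1 -exprD.
Qed.
Lemma nu71 : nu R ^+ 7 != nu R.
Proof.
apply: contra (nu3_neq1 R) => /eqP h; apply/eqP.
by rewrite -(nu9 R) (exprD _ 7 2) h -exprS.
Qed.

Lemma lker_inj alpha : lker alpha = 0%VS <-> injective alpha.
Proof. by split=> [/eqP/lker0P | /lker0P/eqP]. Qed.

Lemma sigma3_inj : injective (sigma3 R).
Proof.
move=> X Y h; apply: blkP.
- by have := congr1 (@bs R) h; rewrite !sigma3_blk.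
- by have := congr1 (@br R) h; rewrite !sigma3_blk => /(mulfI wc_neq0).
- by have := congr1 (@bt R) h; rewrite !sigma3_blk => /(mulfI wc'_neq0).
- by have := congr1 (@be R) h; rewrite !sigma3_blk => /(scalerI wc'_neq0).
- by have := congr1 (@bf R) h; rewrite !sigma3_blk => /(scalerI wc'_neq0).
- by have := congr1 (@bg R) h; rewrite !sigma3_blk => /(scalerI wc_neq0).
- by have := congr1 (@bh R) h; rewrite !sigma3_blk => /(scalerI wc_neq0).
- by have := congr1 (@b1 R) h; rewrite !sigma3_blk.
- by have := congr1 (@b2 R) h; rewrite !sigma3_blk.
- by have := congr1 (@bW R) h; rewrite !sigma3_blk.
- by have := congr1 (@bP R) h; rewrite !sigma3_blk => /(scalerI wc_neq0).
- by have := congr1 (@bQ R) h; rewrite !sigma3_blk => /(scalerI wc'_neq0).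
Qed.

Lemma nu3_inj : injective (nu3 R).
Proof.
have n4 := expf_neq0 4 nu_neq0; have n7 := expf_neq0 7 nu_neq0.
move=> X Y h; apply: blkP.
- by have := congr1 (@bs R) h; rewrite !nu3_blk => /(mulfI n4).
- by have := congr1 (@br R) h; rewrite !nu3_blk => /(mulfI n7).
- by have := congr1 (@bt R) h; rewrite !nu3_blk => /(mulfI n7).
- by have := congr1 (@be R) h; rewrite !nu3_blk => /(scalerI n4).
- by have := congr1 (@bf R) h; rewrite !nu3_blk => /(scalerI n7).
- by have := congr1 (@bg R) h; rewrite !nu3_blk => /(scalerI n4).
- by have := congr1 (@bh R) h; rewrite !nu3_blk => /(scalerI n7).
- by have := congr1 (@b1 R) h; rewrite !nu3_blk => /(scalerI n4).
- by have := congr1 (@b2 R) h; rewrite !nu3_blk => /(scalerI nu_neq0).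
- by have := congr1 (@bW R) h; rewrite !nu3_blk => /(scalerI n7).
- by have := congr1 (@bP R) h; rewrite !nu3_blk => /(scalerI nu_neq0).
- by have := congr1 (@bQ R) h; rewrite !nu3_blk => /(scalerI nu_neq0).
Qed.

Definition cent alpha : Prop :=
  (E6fix (sigma3 R) `&` E6fix (nu3 R))%classic alpha.

(** Injectivity makes [g^-1] a true inverse, which turns the conjugation equation into a
    commutation, the form to which eigenspace arguments apply. *)
Lemma E6fixP (g : 'End(J)) alpha : injective g ->
  E6fix g alpha <-> E6 alpha /\ forall X, alpha (g X) = g (alpha X).
Proof.
move=> /lker0P g0; split=> [[Ea h] | [Ea h]]; split=> //.
  by move=> X; rewrite -{2}h !comp_lfunE lker0_lfunVK.
by apply/lfunP => X; rewrite !comp_lfunE h lker0_lfunK.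
Qed.

Lemma centP alpha : cent alpha <-> [/\ injective alpha,
  forall X, cubic (alpha X) = cubic X,
  forall X Y, jherm (alpha X) (alpha Y) = jherm X Y,
  forall X, alpha (sigma3 R X) = sigma3 R (alpha X) &
  forall X, alpha (nu3 R X) = nu3 R (alpha X)].
Proof.
split.
  case=>
    /(E6fixP _ sigma3_inj)[[/lker_inj ia da ha] sa] /(E6fixP _ nu3_inj)[_ na].
  by split; [exact: ia | move=> X; rewrite -!jdet_cubic; exact: da | exact: ha |
    exact: sa | exact: na].
case=> ia da ha sa na.
have Ea : E6 alpha.
  by split=> [|X|//]; [exact/lker_inj | rewrite !jdet_cubic].
by split; [apply/(E6fixP _ sigma3_inj) | apply/(E6fixP _ nu3_inj)].
Qed.

Lemma cent_comp alpha beta : cent alpha -> cent beta -> cent (alpha \o beta)%VF.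
Proof.
case/centP=> ia da ha sa na /centP[ib db hb sb nb]; apply/centP.
by split=> [X Y|X|X Y|X|X]; rewrite !comp_lfunE ?da ?ha ?sb ?nb // => /ia/ib.
Qed.

Lemma cent_inv alpha beta : cent alpha -> cancel alpha beta ->
  cancel beta alpha -> cent beta.
Proof.
case/centP=> ia da ha sa na ab ba; apply/centP; split=> [|X|X Y|X|X].
- exact: can_inj ba.
- by rewrite -[in RHS](ba X) da.
- by rewrite -[in RHS](ba X) -[in RHS](ba Y) ha.
- by apply: ia; rewrite ba sa ba.
- by apply: ia; rewrite ba na ba.
Qed.

Lemma cent_has_inv alpha : cent alpha ->
  exists beta, [/\ cent beta, cancel alpha beta & cancel beta alpha].
Proof.
move=> ca; have [/lker0P ia _ _ _ _] := (centP alpha).1 ca.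
exists alpha^-1%VF.
have ab : cancel alpha alpha^-1%VF by apply: lker0_lfunK.
have ba : cancel alpha^-1%VF alpha by apply: lker0_lfunVK.
by split; [exact: cent_inv ca ab ba | exact: ab | exact: ba].
Qed.

Lemma Phi_cent (p U V : 'M[C]_2) (a b : C) : unitary p -> \det p = 1 ->
  unitary U -> unitary V -> unimod a -> unimod b ->
  a * b * \det U * \det V = 1 -> cent (Phi p a b U V).
Proof.
move=> up dp uU uV ua ub d1; have a0 := unimod_neq0 ua.
have b0 := unimod_neq0 ub.
apply/centP; split=> [|X|X Y|X|X].
- apply: (can_inj (g := Phi (cconj p^T) a^-1 b^-1 (cconj U^T) (cconj V^T))) =>
  X.
  by rewrite -comp_lfunE -PhiM up uU uV !mulVf // Phi1 id_lfunE.
- exact: cubicM.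
- exact: jhermM.
- apply: blkP; rewrite !(Phi_blk, sigma3_blk) -?scalemxAr -?scalemxAl ?scalerA
    1?[_ * a]mulrC 1?[_ * b]mulrC //; ring.
- apply: blkP; rewrite !(Phi_blk, nu3_blk) -?scalemxAr -?scalemxAl ?scalerA //;
    by [ring | congr (_ *: _); ring].
Qed.

Definition eig_shift (g : 'End(J)) c X := - c *: X + g X.

Lemma eig_shift_sigma3 c X : eig_shift (sigma3 R) c X =
  bmk ((1 - c) * bs X) ((wc R - c) * br X) ((wc' R - c) * bt X)
    ((wc' R - c) *: be X) ((wc' R - c) *: bf X) ((wc R - c) *: bg X)
    ((wc R - c) *: bh X) ((1 - c) *: b1 X) ((1 - c) *: b2 X)
    ((1 - c) *: bW X) ((wc R - c) *: bP X) ((wc' R - c) *: bQ X).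
Proof.
by rewrite /eig_shift bmk_lin !sigma3_blk; congr bmk;
  rewrite ?[RHS]mulrBl ?[RHS]scalerBl
  ?scale1r ?mul1r ?mulNr ?scaleNr addrC.
Qed.

Lemma eig_shift_nu3 (n := nu R) c X : eig_shift (nu3 R) c X =
  bmk ((n ^+ 4 - c) * bs X) ((n ^+ 7 - c) * br X) ((n ^+ 7 - c) * bt X)
    ((n ^+ 4 - c) *: be X) ((n ^+ 7 - c) *: bf X) ((n ^+ 4 - c) *: bg X)
    ((n ^+ 7 - c) *: bh X) ((n ^+ 4 - c) *: b1 X) ((n - c) *: b2 X)
    ((n ^+ 7 - c) *: bW X) ((n - c) *: bP X) ((n - c) *: bQ X).
Proof.
by rewrite /eig_shift bmk_lin !nu3_blk; congr bmk;
  rewrite ?[RHS]mulrBl ?[RHS]scalerBl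
  ?mulNr ?scaleNr addrC.
Qed.

(** Each of sigma3 and nu3 has three eigenvalues, and all nine pairs occur. Killing two eigenvalues
    of each leaves a nonzero multiple of the projection onto one joint eigenspace; as a polynomial
    in sigma3 and nu3 it commutes with the centralizer. *)
Lemma eig_shift4E s1 s2 v1 v2 (n := nu R) X (s' := fun w => (w - s1) * (w - s2))
    (v' := fun w => (w - v1) * (w - v2)) :
  eig_shift (sigma3 R) s1 (eig_shift (sigma3 R) s2
    (eig_shift (nu3 R) v1 (eig_shift (nu3 R) v2 X))) =
  bmk (s' 1 * v' (n ^+ 4) * bs X) (s' (wc R) * v' (n ^+ 7) * br X)
    (s' (wc' R) * v' (n ^+ 7) * bt X) ((s' (wc' R) * v' (n ^+ 4)) *: be X)
    ((s' (wc' R) * v' (n ^+ 7)) *: bf X) ((s' (wc R) * v' (n ^+ 4)) *: bg X)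
    ((s' (wc R) * v' (n ^+ 7)) *: bh X) ((s' 1 * v' (n ^+ 4)) *: b1 X)
    ((s' 1 * v' n) *: b2 X) ((s' 1 * v' (n ^+ 7)) *: bW X)
    ((s' (wc R) * v' n) *: bP X) ((s' (wc' R) * v' n) *: bQ X).
Proof.
rewrite (eig_shift_nu3 v2) (eig_shift_nu3 v1) !bmkE (eig_shift_sigma3 s2) !bmkE
  (eig_shift_sigma3 s1) !bmkE.
by congr bmk; rewrite !(mulrA, scalerA).
Qed.

Lemma eig_shift_comm alpha (g : 'End(J)) c X :
  (forall Y, alpha (g Y) = g (alpha Y)) ->
  alpha (eig_shift g c X) = eig_shift g c (alpha X).
Proof. by move=> ag; rewrite /eig_shift linearP /= ag. Qed.

Lemma comp_comm alpha (c : J -> J) s1 s2 v1 v2 k : cent alpha -> k != 0 ->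
  (forall X, eig_shift (sigma3 R) s1 (eig_shift (sigma3 R) s2
    (eig_shift (nu3 R) v1 (eig_shift (nu3 R) v2 X)))
     = k *: c X) ->
  forall X, alpha (c X) = c (alpha X).
Proof.
move=> /centP[_ _ _ sa na] k0 h X; apply: (scalerI k0).
have -> : k *: alpha (c X) = alpha (k *: c X) by rewrite linearZ.
rewrite -!h.
by rewrite (eig_shift_comm _ _ sa) (eig_shift_comm _ _ sa)
  (eig_shift_comm _ _ na) (eig_shift_comm _ _ na).
Qed.

Definition mks c : J := bmk c 0 0 0 0 0 0 0 0 0 0 0.
Definition mkr c : J := bmk 0 c 0 0 0 0 0 0 0 0 0 0.
Definition mkt c : J := bmk 0 0 c 0 0 0 0 0 0 0 0 0.
Definition mke x : J := bmk 0 0 0 x 0 0 0 0 0 0 0 0.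
Definition mkf x : J := bmk 0 0 0 0 x 0 0 0 0 0 0 0.
Definition mkg x : J := bmk 0 0 0 0 0 x 0 0 0 0 0 0.
Definition mkh x : J := bmk 0 0 0 0 0 0 x 0 0 0 0 0.
Definition mk1 x : J := bmk 0 0 0 0 0 0 0 x 0 0 0 0.
Definition mk2 x : J := bmk 0 0 0 0 0 0 0 0 x 0 0 0.
Definition mkW A : J := bmk 0 0 0 0 0 0 0 0 0 A 0 0.
Definition mkP A : J := bmk 0 0 0 0 0 0 0 0 0 0 A 0.
Definition mkQ A : J := bmk 0 0 0 0 0 0 0 0 0 0 0 A.

(* The joint eigenspaces of sigma3 and nu3 are spanned by (s, n1), (r, h),
   (t, f) and by each of the six remaining blocks. *)
Definition cS1 X : J := bmk (bs X) 0 0 0 0 0 0 (b1 X) 0 0 0 0.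
Definition cRH X : J := bmk 0 (br X) 0 0 0 0 (bh X) 0 0 0 0 0.
Definition cTF X : J := bmk 0 0 (bt X) 0 (bf X) 0 0 0 0 0 0 0.

Ltac comp_tac := rewrite eig_shift4E bmkZ; congr bmk;
  rewrite ?subrr ?(mul0r, mulr0) ?scale0r ?scaler0 ?mulr0 //.

Lemma comps alpha X : cent alpha ->
  (alpha (cS1 X) = cS1 (alpha X)) * (alpha (cRH X) = cRH (alpha X))
  * (alpha (cTF X) = cTF (alpha X)) * (alpha (mke (be X)) = mke (be (alpha X)))
  * (alpha (mkg (bg X)) = mkg (bg (alpha X)))
  * (alpha (mk2 (b2 X)) = mk2 (b2 (alpha X)))
  * (alpha (mkW (bW X)) = mkW (bW (alpha X)))
  * (alpha (mkP (bP X)) = mkP (bP (alpha X)))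
  * (alpha (mkQ (bQ X)) = mkQ (bQ (alpha X))).
Proof.
move=> ca; set n := nu R.
have sk (w s1 s2 v v1 v2 : C) : w != s1 -> w != s2 -> v != v1 -> v != v2 ->
    (w - s1) * (w - s2) * ((v - v1) * (v - v2)) != 0.
  by rewrite -!(subr_eq0 w) -!(subr_eq0 v) => *; rewrite !mulf_neq0.
have w1 := wc_neq1; have w1' := wc'_neq1; have ww := wc_neq.
have w1s := w1; rewrite eq_sym in w1s; have w1's := w1'; rewrite eq_sym in w1's.
have wws := ww; rewrite eq_sym in wws.
have n74 := nu74; have n71 := nu71; have n41 := nu41.
have n47 := n74; rewrite eq_sym in n47; have n17 := n71; rewrite eq_sym in n17.
have n14 := n41; rewrite eq_sym in n14.
do ![split].
(* In each case [s1], [s2] and [v1], [v2] are the eigenvalues to be killed, and the explicit values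
   given to [sk] are the pair that is kept. *)
- apply: (comp_comm (c := cS1) (s1 := wc R) (s2 := wc' R) (v1 := n ^+ 7)
  (v2 := n) ca).
    exact: (sk 1 _ _ (n ^+ 4) _ _ w1s w1's n47 n41).
  by move=> Y; comp_tac.
- apply: (comp_comm (c := cRH) (s1 := 1) (s2 := wc' R) (v1 := n ^+ 4)
  (v2 := n) ca).
    exact: (sk (wc R) _ _ (n ^+ 7) _ _ w1 ww n74 n71).
  by move=> Y; comp_tac.
- apply: (comp_comm (c := cTF) (s1 := 1) (s2 := wc R) (v1 := n ^+ 4)
  (v2 := n) ca).
    exact: (sk (wc' R) _ _ (n ^+ 7) _ _ w1' wws n74 n71).
  by move=> Y; comp_tac.
- apply: (comp_comm (c := fun Y => mke (be Y)) (s1 := 1) (s2 := wc R)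
  (v1 := n ^+ 7) (v2 := n) ca).
    exact: (sk (wc' R) _ _ (n ^+ 4) _ _ w1' wws n47 n41).
  by move=> Y; comp_tac.
- apply: (comp_comm (c := fun Y => mkg (bg Y)) (s1 := 1) (s2 := wc' R)
  (v1 := n ^+ 7) (v2 := n) ca).
    exact: (sk (wc R) _ _ (n ^+ 4) _ _ w1 ww n47 n41).
  by move=> Y; comp_tac.
- apply: (comp_comm (c := fun Y => mk2 (b2 Y)) (s1 := wc R) (s2 := wc' R)
  (v1 := n ^+ 7) (v2 := n ^+ 4) ca).
    exact: (sk 1 _ _ n _ _ w1s w1's n17 n14).
  by move=> Y; comp_tac.
- apply: (comp_comm (c := fun Y => mkW (bW Y)) (s1 := wc R) (s2 := wc' R)
  (v1 := n ^+ 4) (v2 := n) ca).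
    exact: (sk 1 _ _ (n ^+ 7) _ _ w1s w1's n74 n71).
  by move=> Y; comp_tac.
- apply: (comp_comm (c := fun Y => mkP (bP Y)) (s1 := 1) (s2 := wc' R)
  (v1 := n ^+ 7) (v2 := n ^+ 4) ca).
    exact: (sk (wc R) _ _ n _ _ w1 ww n17 n14).
  by move=> Y; comp_tac.
- apply: (comp_comm (c := fun Y => mkQ (bQ Y)) (s1 := 1) (s2 := wc R)
  (v1 := n ^+ 7) (v2 := n ^+ 4) ca).
    exact: (sk (wc' R) _ _ n _ _ w1' wws n17 n14).
  by move=> Y; comp_tac.
Qed.

End Centralizer.

(** * Blockwise action of the centralizer *)

Section BlockForm.
Variable R : realType.
Local Notation C := R[i].
Local Notation J := (jordan C).
Implicit Types (X Y : J) (alpha beta : 'End(jordan C)).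

Lemma bmkD (s r t s' r' t' : C) (e f g h n1 n2 e' f' g' h' n1' n2' : 'cV[C]_2)
    (W P Q W' P' Q' : 'M[C]_2) :
  bmk s r t e f g h n1 n2 W P Q + bmk s' r' t' e' f' g' h' n1' n2' W' P' Q'
  = bmk (s + s') (r + r') (t + t') (e + e') (f + f')
    (g + g') (h + h') (n1 + n1') (n2 + n2') (W + W') (P + P') (Q + Q').
Proof. by rewrite -[X in X + _ = _]scale1r bmkL !scale1r !mul1r. Qed.

Lemma bmk_sum (s r t : C) (e f g h n1 n2 : 'cV[C]_2) (W P Q : 'M[C]_2) :
  bmk s r t e f g h n1 n2 W P Q = mks s + mkr r + mkt t + mke e + mkf f + mkg g
    + mkh h + mk1 n1 + mk2 n2 + mkW W + mkP P + mkQ Q.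
Proof. by do 11![rewrite bmkD !(addr0, add0r)]. Qed.

Lemma hp0l m n (A : 'M[C]_(m, n)) : hp 0 A = 0.
Proof. by rewrite /hp trmx0 /cconj map_mx0 mul0mx mxtrace0. Qed.
Lemma hp0r m n (A : 'M[C]_(m, n)) : hp A 0 = 0.
Proof. by rewrite /hp mulmx0 mxtrace0. Qed.

Lemma hp_delta (i : 'I_2) (x : 'cV[C]_2) : hp (delta_mx i 0) x = x i 0.
Proof.
have dE k : cconj (delta_mx i 0 : 'cV[C]_2)^T 0 k = (k == i)%:R.
  by rewrite cconjE !mxE eqxx andbT; exact: rmorph_nat.
rewrite /hp /mxtrace big_ord1 mxE (bigD1 i) //= dE eqxx mul1r big1 ?addr0 // =>
  k ki.
by rewrite dE (negbTE ki) mul0r.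
Qed.

Lemma hp_eq0 (x : 'cV[C]_2) : (forall v, hp v x = 0) -> x = 0.
Proof.
by move=> h; apply/matrixP => i j; rewrite (ord1 j) -hp_delta h mxE.
Qed.

(* In the cubic form, [mkW A] pairs with (s, n1) only through [s * \det A], so
   the line spanned by s is singled out inside its eigenspace. *)
Lemma bs_mk1 alpha v : cent alpha -> bs (alpha (mk1 v)) = 0.
Proof.
move=> ca; have [beta [cb ab ba]] := cent_has_inv ca.
have [_ da _ _ _] := (centP alpha).1 ca.
(* The W block is a full joint eigenspace, so the preimage of [mkW 1%:M] is some [mkW A]. The cubic
   form vanishes at [mk1 v + mkW A], while at the image it equals minus the s-coordinate. *)
pose A := bW (beta (mkW 1%:M)).
have hA : alpha (mkW A) = mkW 1%:M.
  by have := comps (mkW 1%:M) cb; rewrite !bmkE -/A => e;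
    rewrite -[RHS]ba -/A e.
have hv : alpha (mk1 v) = cS1 (alpha (mk1 v)).
  by have := comps (mk1 v) ca; rewrite /cS1 !bmkE => e; rewrite -e.
have := da (mk1 v + mkW A); rewrite (linearD alpha) /= hA hv /cS1 !bmkD.
rewrite /cubic !bmkE /cubicf !(add0r, addr0) det1.
by simp0; rewrite mulrN mulr1 => /eqP; rewrite oppr_eq0 => /eqP.
Qed.

(** Here the separating term is [r * \det P], the only one in which r, h and P can meet; for t and f
    it will be [t * \det Q]. *)
Lemma br_mkh alpha v : cent alpha -> br (alpha (mkh v)) = 0.
Proof.
move=> ca; have [beta [cb ab ba]] := cent_has_inv ca.
have [_ da _ _ _] := (centP alpha).1 ca.
pose A := bP (beta (mkP 1%:M)).
have hA : alpha (mkP A) = mkP 1%:M.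
  by have := comps (mkP 1%:M) cb; rewrite !bmkE -/A => e;
    rewrite -[RHS]ba -/A e.
have hv : alpha (mkh v) = cRH (alpha (mkh v)).
  by have := comps (mkh v) ca; rewrite /cRH !bmkE => e; rewrite -e.
have := da (mkh v + mkP A); rewrite (linearD alpha) /= hA hv /cRH !bmkD.
rewrite /cubic !bmkE /cubicf !(add0r, addr0) det1.
by simp0; rewrite mulr1 => /eqP; rewrite oppr_eq0 => /eqP.
Qed.

Lemma bt_mkf alpha v : cent alpha -> bt (alpha (mkf v)) = 0.
Proof.
move=> ca; have [beta [cb ab ba]] := cent_has_inv ca.
have [_ da _ _ _] := (centP alpha).1 ca.
pose A := bQ (beta (mkQ 1%:M)).
have hA : alpha (mkQ A) = mkQ 1%:M.
  by have := comps (mkQ 1%:M) cb; rewrite !bmkE -/A => e;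
    rewrite -[RHS]ba -/A e.
have hv : alpha (mkf v) = cTF (alpha (mkf v)).
  by have := comps (mkf v) ca; rewrite /cTF !bmkE => e; rewrite -e.
have := da (mkf v + mkQ A); rewrite (linearD alpha) /= hA hv /cTF !bmkD.
rewrite /cubic !bmkE /cubicf !(add0r, addr0) det1.
by simp0; rewrite mulr1 => /eqP; rewrite oppr_eq0 => /eqP.
Qed.

Lemma jherm_mkv v X :
  (jherm (mk1 v) X = hp v (b1 X)) * (jherm (mkh v) X = hp v (bh X))
  * (jherm (mkf v) X = hp v (bf X)).
Proof. by rewrite !jherm_blk !bmkE !hp0l conjc0 !mul0r !(addr0, add0r). Qed.

Lemma jherm_mkc c X :
  (jherm X (mks c) = conjc (bs X) * c) * (jherm X (mkr c) = conjc (br X) * c)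
  * (jherm X (mkt c) = conjc (bt X) * c).
Proof. by rewrite !jherm_blk !bmkE !hp0r !mulr0 !(addr0, add0r). Qed.

(* The other half of the splitting follows from [bs_mk1] for the inverse of
   alpha, which is its adjoint. *)
Lemma b1_mks alpha c : cent alpha -> b1 (alpha (mks c)) = 0.
Proof.
move=> ca; have [beta [cb ab ba]] := cent_has_inv ca.
have [_ _ ha _ _] := (centP alpha).1 ca.
apply: hp_eq0 => v; rewrite -jherm_mkv -(ba (mk1 v)) ha jherm_mkc bs_mk1 //.
by rewrite conjc0 mul0r.
Qed.

Lemma bh_mkr alpha c : cent alpha -> bh (alpha (mkr c)) = 0.
Proof.
move=> ca; have [beta [cb ab ba]] := cent_has_inv ca.
have [_ _ ha _ _] := (centP alpha).1 ca.
apply: hp_eq0 => v; rewrite -jherm_mkv -(ba (mkh v)) ha jherm_mkc br_mkh //.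
by rewrite conjc0 mul0r.
Qed.

Lemma bf_mkt alpha c : cent alpha -> bf (alpha (mkt c)) = 0.
Proof.
move=> ca; have [beta [cb ab ba]] := cent_has_inv ca.
have [_ _ ha _ _] := (centP alpha).1 ca.
apply: hp_eq0 => v; rewrite -jherm_mkv -(ba (mkf v)) ha jherm_mkc bt_mkf //.
by rewrite conjc0 mul0r.
Qed.

Lemma cent_mk alpha (ca : cent alpha) :
  ((forall c, alpha (mks c) = mks (bs (alpha (mks c))))
  * (forall c, alpha (mkr c) = mkr (br (alpha (mkr c))))
  * (forall c, alpha (mkt c) = mkt (bt (alpha (mkt c)))))
  * ((forall x, alpha (mke x) = mke (be (alpha (mke x))))
  * (forall x, alpha (mkf x) = mkf (bf (alpha (mkf x))))
  * (forall x, alpha (mkg x) = mkg (bg (alpha (mkg x))))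
  * (forall x, alpha (mkh x) = mkh (bh (alpha (mkh x))))
  * (forall x, alpha (mk1 x) = mk1 (b1 (alpha (mk1 x))))
  * (forall x, alpha (mk2 x) = mk2 (b2 (alpha (mk2 x)))))
  * ((forall A, alpha (mkW A) = mkW (bW (alpha (mkW A))))
  * (forall A, alpha (mkP A) = mkP (bP (alpha (mkP A))))
  * (forall A, alpha (mkQ A) = mkQ (bQ (alpha (mkQ A))))).
Proof.
do ![split]=> x.
- by have [[[[[[[[e _] _] _] _] _] _] _] _] := comps (mks x) ca; move: e;
  rewrite /cS1 !bmkE (b1_mks x ca).
- by have [[[[[[[[_ e] _] _] _] _] _] _] _] := comps (mkr x) ca; move: e;
  rewrite /cRH !bmkE (bh_mkr x ca).
- by have [[[[[[[[_ _] e] _] _] _] _] _] _] := comps (mkt x) ca; move: e;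
  rewrite /cTF !bmkE (bf_mkt x ca).
- by have [[[[[[[[_ _] _] e] _] _] _] _] _] := comps (mke x) ca; move: e;
  rewrite !bmkE.
- by have [[[[[[[[_ _] e] _] _] _] _] _] _] := comps (mkf x) ca; move: e;
  rewrite /cTF !bmkE (bt_mkf x ca).
- by have [[[[[[[[_ _] _] _] e] _] _] _] _] := comps (mkg x) ca; move: e;
  rewrite !bmkE.
- by have [[[[[[[[_ e] _] _] _] _] _] _] _] := comps (mkh x) ca; move: e;
  rewrite /cRH !bmkE (br_mkh x ca).
- by have [[[[[[[[e _] _] _] _] _] _] _] _] := comps (mk1 x) ca; move: e;
  rewrite /cS1 !bmkE (bs_mk1 x ca).
- by have [[[[[[[[_ _] _] _] _] e] _] _] _] := comps (mk2 x) ca; move: e;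
  rewrite !bmkE.
- by have [[[[[[[[_ _] _] _] _] _] e] _] _] := comps (mkW x) ca; move: e;
  rewrite !bmkE.
- by have [[[[[[[[_ _] _] _] _] _] _] e] _] := comps (mkP x) ca; move: e;
  rewrite !bmkE.
- by have [[[[[[[[_ _] _] _] _] _] _] _] e] := comps (mkQ x) ca; move: e;
  rewrite !bmkE.
Qed.

Lemma lin_cv2 (f : 'cV[C]_2 -> 'cV[C]_2) :
  (forall a x y, f (a *: x + y) = a *: f x + f y) -> exists M, forall x, f x
    = M *m x.
Proof.
move=> fL; exists (\matrix_(i, j) f (delta_mx j 0) i 0) => x.
have f0 : f 0 = 0.
  have := fL (-1) 0 0; rewrite scaler0 addr0 scaleN1r addNr => ->; by [].
have {1}-> : x = x 0 0 *: delta_mx 0 0 + (x 1 0 *: delta_mx 1 0 + 0).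
  by apply: cv2P; rewrite !mxE /=; ring.
rewrite !fL f0 addr0; apply/matrixP => i j; rewrite (ord1 j) mulmx2E !mxE.
by rewrite [x 0 0 * _]mulrC [x 1 0 * _]mulrC.
Qed.

Lemma lin_mk alpha (mk : 'cV[C]_2 -> J) (pr : J -> 'cV[C]_2) :
  (forall a x y, mk (a *: x + y) = a *: mk x + mk y) ->
  (forall a X Y, pr (a *: X + Y) = a *: pr X + pr Y) ->
  exists M, forall x, pr (alpha (mk x)) = M *m x.
Proof. by move=> hm hp; apply: lin_cv2 => a x y; rewrite hm linearP hp. Qed.

Lemma lin_mkc alpha (mk : C -> J) (pr : J -> C) :
  (forall a x, mk (a * x) = a *: mk x) ->
  (forall a X, pr (a *: X) = a * pr X) ->
  exists k, forall x, pr (alpha (mk x)) = k * x.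
Proof.
move=> hm hp; exists (pr (alpha (mk 1))) => x.
by rewrite -{1}[x]mulr1 hm linearZ hp mulrC.
Qed.

(** The maps on the matrix blocks W, P, Q are kept as functions, to be read off pointwise from the
    cubic form; the maps on the scalars and vectors are given by matrices, which are what gets
    normalized. *)
Definition block_form alpha (l r t : C) (E F G H N1 N2 : 'M[C]_2)
    (tW tP tQ : 'M[C]_2 -> 'M[C]_2) : Prop :=
  forall (s' r' t' : C) (e f g h n1 n2 : 'cV[C]_2) (W P Q : 'M[C]_2),
  alpha (bmk s' r' t' e f g h n1 n2 W P Q) = bmk (l * s') (r * r') (t * t')
    (E *m e) (F *m f) (G *m g) (H *m h) (N1 *m n1) (N2 *m n2) (tW W) (tP P)
      (tQ Q).

Lemma cent_block_form alpha : cent alpha ->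
  exists l r t E F G H N1 N2 tW tP tQ,
    block_form alpha l r t E F G H N1 N2 tW tP tQ /\
    [/\ tW 0 = 0, tP 0 = 0 & tQ 0 = 0].
Proof.
move=> ca; have h := cent_mk ca.
have [l hl] : exists k, forall x, bs (alpha (mks x)) = k * x.
  apply: lin_mkc => [a x | a X]; first by rewrite bmkZ !mulr0 !scaler0.
  by rewrite -[a *: X]addr0 blkL blk0 addr0.
have [r hr] : exists k, forall x, br (alpha (mkr x)) = k * x.
  apply: lin_mkc => [a x | a X]; first by rewrite bmkZ !mulr0 !scaler0.
  by rewrite -[a *: X]addr0 blkL blk0 addr0.
have [t ht] : exists k, forall x, bt (alpha (mkt x)) = k * x.
  apply: lin_mkc => [a x | a X]; first by rewrite bmkZ !mulr0 !scaler0.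
  by rewrite -[a *: X]addr0 blkL blk0 addr0.
have [E hE] : exists M, forall x, be (alpha (mke x)) = M *m x.
  by apply: lin_mk => *; rewrite ?bmkL ?blkL // !mulr0 !scaler0 !addr0.
have [F hF] : exists M, forall x, bf (alpha (mkf x)) = M *m x.
  by apply: lin_mk => *; rewrite ?bmkL ?blkL // !mulr0 !scaler0 !addr0.
have [G hG] : exists M, forall x, bg (alpha (mkg x)) = M *m x.
  by apply: lin_mk => *; rewrite ?bmkL ?blkL // !mulr0 !scaler0 !addr0.
have [H hH] : exists M, forall x, bh (alpha (mkh x)) = M *m x.
  by apply: lin_mk => *; rewrite ?bmkL ?blkL // !mulr0 !scaler0 !addr0.
have [N1 h1] : exists M, forall x, b1 (alpha (mk1 x)) = M *m x.
  by apply: lin_mk => *; rewrite ?bmkL ?blkL // !mulr0 !scaler0 !addr0.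
have [N2 h2] : exists M, forall x, b2 (alpha (mk2 x)) = M *m x.
  by apply: lin_mk => *; rewrite ?bmkL ?blkL // !mulr0 !scaler0 !addr0.
exists l, r, t, E, F, G, H, N1, N2, (fun A => bW (alpha (mkW A))),
  (fun A => bP (alpha (mkP A))), (fun A => bQ (alpha (mkQ A))).
split; last by split; rewrite /mkW /mkP /mkQ bmk0 linear0 blk0.
move=> *; rewrite -hl -hr -ht -hE -hF -hG -hH -h1 -h2 [in LHS]bmk_sum
  [in RHS]bmk_sum.
rewrite !(linearD alpha) /=.
by do ?[congr (_ + _)]; rewrite -h.
Qed.

End BlockForm.

(** * Rigidity *)

Section Rigidity.
Variable R : realType.
Local Notation C := R[i].
Local Notation J := (jordan C).
Implicit Types (X Y : J) (alpha beta : 'End(jordan C)) (A B M : 'M[C]_2)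
  (x y : 'cV[C]_2).

Lemma cubicf_srt s r t : cubicf s r t 0 0 0 0 0 0 0 0 0 = s * (r * t) :> C.
Proof. by rewrite /cubicf; simp0. Qed.
Lemma cubicf_s12 s x y : cubicf s 0 0 0 0 0 0 x y 0 0 0 = - (s * wdg x y) :> C.
Proof. by rewrite /cubicf; simp0. Qed.
Lemma cubicf_tef t x y : cubicf 0 0 t x y 0 0 0 0 0 0 0 = - (t * wdg x y) :> C.
Proof. by rewrite /cubicf; simp0. Qed.
Lemma cubicf_rgh r x y : cubicf 0 r 0 0 0 x y 0 0 0 0 0 = - (r * wdg x y) :> C.
Proof. by rewrite /cubicf; simp0. Qed.
Lemma cubicf_e1P x y A : cubicf 0 0 0 x 0 0 0 y 0 0 A 0 = - wdg y (A *m x).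
Proof. by rewrite /cubicf; simp0. Qed.
Lemma cubicf_f2P x y A : cubicf 0 0 0 0 x 0 0 0 y 0 A 0 = - wdg y (A *m x).
Proof. by rewrite /cubicf; simp0. Qed.
Lemma cubicf_g1Q x y A : cubicf 0 0 0 0 0 x 0 y 0 0 0 A = - wdg y (A *m x).
Proof. by rewrite /cubicf; simp0. Qed.
Lemma cubicf_h2Q x y A : cubicf 0 0 0 0 0 0 x 0 y 0 0 A = - wdg y (A *m x).
Proof. by rewrite /cubicf; simp0. Qed.
Lemma cubicf_ehW x y A :
  cubicf 0 0 0 x 0 0 y 0 0 A 0 0 = - wdg x (A *m (Jmx C *m y)).
Proof. by rewrite /cubicf; simp0. Qed.

Lemma wdg_inj A B : (forall x y, wdg x (A *m y) = wdg x (B *m y)) -> A = B.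
Proof.
move=> h; apply: mx2P.
- have := h (cv2 0 1) (cv2 1 0); rewrite !wdg_mx !cv2E.
  by rewrite !(mul0r, mul1r, mulr0, mulr1, addr0, add0r, sub0r) => /oppr_inj.
- have := h (cv2 0 1) (cv2 0 1); rewrite !wdg_mx !cv2E.
  by rewrite !(mul0r, mul1r, mulr0, mulr1, addr0, add0r, sub0r) => /oppr_inj.
- have := h (cv2 1 0) (cv2 1 0); rewrite !wdg_mx !cv2E.
  by rewrite !(mul0r, mul1r, mulr0, mulr1, addr0, add0r, subr0).
- have := h (cv2 1 0) (cv2 0 1); rewrite !wdg_mx !cv2E.
  by rewrite !(mul0r, mul1r, mulr0, mulr1, addr0, add0r, subr0).
Qed.

(** The adjugate, which is also the adjoint with respect to [wdg]. *)
Definition madj A := mx22 (A 1 1) (- A 0 1) (- A 1 0) (A 0 0).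

Lemma wdg_adj A x y : wdg (A *m x) y = wdg x (madj A *m y).
Proof. by rewrite /wdg !mulmx2E !mx22E; ring. Qed.

Lemma wdgC x y : wdg x y = - wdg y x.
Proof. by rewrite /wdg; ring. Qed.

Lemma comm_scalar A : (forall B, B *m A = A *m B) -> A = (A 0 0)%:M.
Proof.
move=> h; have e := h (mx22 0 1 0 0); have e' := h (mx22 0 0 1 0).
have a01 : A 0 1 = 0.
  have := congr1 (fun M : 'M[C]_2 => M 1 1) e'; rewrite !mulmx2E !mx22E.
  by rewrite !(mul0r, mul1r, mulr0, mulr1, addr0, add0r).
have a10 : A 1 0 = 0.
  have := congr1 (fun M : 'M[C]_2 => M 0 0) e; rewrite !mulmx2E !mx22E.
  by rewrite !(mul0r, mul1r, mulr0, mulr1, addr0, add0r).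
have a11 : A 1 1 = A 0 0.
  have := congr1 (fun M : 'M[C]_2 => M 0 1) e; rewrite !mulmx2E !mx22E.
  by rewrite !(mul0r, mul1r, mulr0, mulr1, addr0, add0r).
by apply: mx2P; rewrite [RHS]mxE ?a01 ?a10 ?a11.
Qed.

(* The trilinear terms (e, n1, P), (g, n1, Q), (f, n2, P), (h, n2, Q),
   (s, n1, n2), (t, e, f), (r, g, h), (s, r, t) and (e, h, W) of the cubic
   form determine, in this order, the remaining components. *)
Lemma rigidity alpha l r t F H N2 tW tP tQ :
  (forall X, cubic (alpha X) = cubic X) ->
  block_form alpha l r t 1%:M F 1%:M H 1%:M N2 tW tP tQ ->
  tW 0 = 0 -> tP 0 = 0 -> tQ 0 = 0 -> alpha = \1%VF.
Proof.
rewrite /block_form => da b tW0 tP0 tQ0.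
have dc s r' t' e f g h n1 n2 W P Q :
    cubicf (l * s) (r * r') (t * t') e (F *m f) g (H *m h) n1 (N2 *m n2) (tW W)
      (tP P) (tQ Q)
    = cubicf s r' t' e f g h n1 n2 W P Q.
  by have := da (bmk s r' t' e f g h n1 n2 W P Q);
    rewrite b /cubic !bmkE !mul1mx.
(* With e and n1 fixed, the nondegenerate term [wdg n1 (P *m e)] determines P; likewise g and n1
   determine Q. *)
have hP A : tP A = A.
  apply: wdg_inj => x y; have := dc 0 0 0 y 0 0 0 x 0 0 A 0.
  by rewrite !mulr0 !mulmx0 tW0 tQ0 !cubicf_e1P => /oppr_inj.
have hQ A : tQ A = A.
  apply: wdg_inj => x y; have := dc 0 0 0 0 0 y 0 x 0 0 0 A.
  by rewrite !mulr0 !mulmx0 tW0 tP0 !cubicf_g1Q => /oppr_inj.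
have f2P A : madj N2 *m A *m F = A.
  apply: wdg_inj => x y; have := dc 0 0 0 0 y 0 0 0 x 0 A 0.
  by rewrite !mulr0 !mulmx0 tW0 tQ0 !cubicf_f2P hP wdg_adj !mulmxA => /oppr_inj.
have h2Q A : madj N2 *m A *m H = A.
  apply: wdg_inj => x y; have := dc 0 0 0 0 0 0 y 0 x 0 0 A.
  by rewrite !mulr0 !mulmx0 tW0 tP0 !cubicf_h2Q hQ wdg_adj !mulmxA => /oppr_inj.
have NF : madj N2 *m F = 1%:M by have := f2P 1%:M; rewrite mulmx1.
have FN := mulmx1C NF.
have HF : H = F.
  by rewrite -[LHS]mul1mx -FN -mulmxA -[madj N2]mulmx1 h2Q mulmx1.
(* [madj N2] and F are mutually inverse, so [f2P] says that F commutes with every matrix. *)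
have [c Fc] : exists c, F = c%:M.
  exists (F 0 0); apply: comm_scalar => A.
  by rewrite -[RHS]/(F *m A) -{2}(f2P A) !mulmxA FN mul1mx.
have w1 : wdg (cv2 1 0) (cv2 0 1) = 1 :> C.
  by rewrite /wdg !cv2E mulr1 mulr0 subr0.
have cw x y : c * wdg (N2 *m x) y = wdg x y.
  rewrite wdg_adj -wdgZr; congr wdg.
  by rewrite -[c *: _]mul_scalar_mx -Fc mulmxA FN mul1mx.
have lw x y : l * wdg x (N2 *m y) = wdg x y.
  have := dc 1 0 0 0 0 0 0 x y 0 0 0.
  by rewrite !mulr0 !mulmx0 tW0 tP0 tQ0 !cubicf_s12 mulr1 mul1r => /oppr_inj.
have tc : t * c = 1.
  have := dc 0 0 1 (cv2 1 0) (cv2 0 1) 0 0 0 0 0 0 0.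
  rewrite !mulr0 !mulmx0 tW0 tP0 tQ0 !cubicf_tef Fc mul_scalar_mx wdgZr w1.
  by rewrite !mulr1 => /oppr_inj.
have rc : r * c = 1.
  have := dc 0 1 0 0 0 (cv2 1 0) (cv2 0 1) 0 0 0 0 0.
  rewrite !mulr0 !mulmx0 tW0 tP0 tQ0 !cubicf_rgh HF Fc mul_scalar_mx wdgZr w1.
  by rewrite !mulr1 => /oppr_inj.
have lrt : l * (r * t) = 1.
  have := dc 1 1 1 0 0 0 0 0 0 0 0 0.
  by rewrite !mulmx0 tW0 tP0 tQ0 !cubicf_srt !mulr1.
have lc : l = c.
  have := lw (cv2 0 1) (cv2 1 0); rewrite wdgC [RHS]wdgC w1 mulrN =>
    /oppr_inj lw1.
  have := cw (cv2 1 0) (cv2 0 1); rewrite w1 => cw1.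
  by rewrite -[LHS]mulr1 -cw1 mulrCA lw1 mulr1.
(* Now l = c and r = t = c^-1, so the relation l r t = 1 reads c^-1 = 1. *)
have c1 : c = 1.
  have c0 : c != 0 by apply/eqP => c0; move/eqP: tc;
    rewrite c0 mulr0 eq_sym oner_eq0.
  apply: (mulfI c0);
    rewrite mulr1 -{3}lc -[RHS]mulr1 -[in RHS]tc -[in RHS](mul1r
    (t * c)) -{1}rc.
  by rewrite -[LHS]mul1r -lrt; ring.
have N21 : N2 = 1%:M.
  by apply: wdg_inj => x y; rewrite mul1mx -(lw x y) lc c1 mul1r.
(* The (e, h, W) term contains W J, so equality is tested after multiplication by J and J is then
   cancelled. *)
have hW A : tW A = A.
  have JJ : Jmx C *m - Jmx C = 1%:M.
    have nE M i j : (- M) i j = - M i j by rewrite mxE.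
    by apply: mx2P; rewrite !mulmx2E !nE !mx22E [RHS]mxE /=; ring.
  rewrite -[LHS]mulmx1 -[RHS]mulmx1 -JJ !mulmxA; congr (_ *m _).
  apply: wdg_inj => x y; have := dc 0 0 0 x 0 0 y 0 0 A 0 0.
  by rewrite !mulr0 !mulmx0 tP0 tQ0 !cubicf_ehW HF Fc c1 !mul1mx !mulmxA =>
    /oppr_inj.
have t1 : t = 1 by rewrite -tc c1 mulr1.
have r1 : r = 1 by rewrite -rc c1 mulr1.
apply/lfunP => X; rewrite id_lfunE -[X]bmkK b.
by rewrite hW hP hQ HF Fc lc c1 t1 r1 N21 !mul1r !mul1mx.
Qed.

Lemma unitaryP A : (forall x y, hp (A *m x) (A *m y) = hp x y) -> unitary A.
Proof.
move=> h; apply/matrixP => i j.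
have E (M : 'M[C]_2) : hp (delta_mx i 0 : 'cV[C]_2) (M *m delta_mx j 0) = M i j.
  by rewrite hp_delta -colE mxE.
rewrite -[LHS]E -[RHS]E mul1mx -[RHS]h /hp.
by rewrite trmx_mul cconjM !mulmxA.
Qed.

Lemma block_unitary alpha l r t E F G H N1 N2 tW tP tQ :
  (forall X Y, jherm (alpha X) (alpha Y) = jherm X Y) ->
  block_form alpha l r t E F G H N1 N2 tW tP tQ ->
  tW 0 = 0 -> tP 0 = 0 -> tQ 0 = 0 ->
  [/\ unitary E, unitary G & unitary N1].
Proof.
rewrite /block_form => ha b tW0 tP0 tQ0; split; apply: unitaryP => x y.
- have := ha (mke x) (mke y); rewrite !b !jherm_blk !bmkE.
  by rewrite !mulr0 !mulmx0 tW0 tP0 tQ0 !hp0l !(addr0, add0r).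
- have := ha (mkg x) (mkg y); rewrite !b !jherm_blk !bmkE.
  by rewrite !mulr0 !mulmx0 tW0 tP0 tQ0 !hp0l !(addr0, add0r).
- have := ha (mk1 x) (mk1 y); rewrite !b !jherm_blk !bmkE.
  by rewrite !mulr0 !mulmx0 tW0 tP0 tQ0 !hp0l !(addr0, add0r).
Qed.

End Rigidity.

(** * The covering homomorphism *)

Section Cover.
Variable R : realType.
Local Notation C := R[i].

Lemma unimodP (z : C) : unimod z <-> `|z| == 1.
Proof.
rewrite /unimod mulrC -sqr_normc -(expr1n _ 2%N); split=> [/eqP|/eqP->].
  by rewrite eqrXn2 ?ler01 // expr1n.
by rewrite !expr1n.
Qed.

Lemma U1_unimod (z : U1 R) : unimod (U1val z).
Proof. exact/unimodP/U1P. Qed.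

Lemma SU_unitary n (A : SU R n) : unitary (SUval A) /\ \det (SUval A) = 1.
Proof. by case/andP: (SUP A) => /eqP ? /eqP. Qed.

Definition spmx (p : Sp1 R) : 'M[C]_2 := kblock (qC (Sp1val p)).

Lemma qco_qC (q : quat R) n : qco (qC q) n = (qco q n)%:C.
Proof. by rewrite /qco mxE. Qed.

Lemma qCM (p q : quat R) : qC (p * q) = qC p * qC q.
Proof.
by apply: quatP; rewrite qco_qC !qcoM !qco_qC; apply/eqP;
  rewrite eq_complex /=; apply/andP; split; apply/eqP; ring.
Qed.

Lemma qC_conj (q : quat R) : qC (qconj q) = qconj (qC q).
Proof. by apply: quatP; rewrite qco_qC !qco_conj qco_qC ?rmorphN. Qed.

Lemma qC_inj : injective (@qC R).
Proof.
move=> p q h; have e n : qco p n = qco q n.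
  by apply: complexI; rewrite -!qco_qC h.
exact: quatP.
Qed.

Lemma kblock_adj (q : quat R) : kblock (qC (qconj q)) = cconj (kblock (qC q))^T.
Proof.
have tE (M : 'M[C]_2) i j : M^T i j = M j i by rewrite mxE.
rewrite qC_conj kblock_conj; apply: mx2P;
  rewrite mx22E cconjE tE !kblockE !qco_qC;
  by apply/eqP; rewrite eq_complex /=; apply/andP; split; apply/eqP; ring.
Qed.

Lemma kblock_one : kblock (1 : quat C) = 1%:M.
Proof.
by apply: mx2P; rewrite kblockE qoneE !mkqE
  [RHS]mxE /= ?mulr0 ?addr0 ?subr0 ?oppr0.
Qed.

Lemma spmxM p q : spmx (p * q)%g = spmx p *m spmx q.
Proof. by rewrite /spmx -kblockM -qCM. Qed.

Lemma spmx1 : spmx 1%g = 1%:M.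
Proof. by rewrite /spmx -kblock_one -(qC1 R). Qed.

Lemma spmx_unitary p : unitary (spmx p) /\ \det (spmx p) = 1.
Proof.
have u : unitary (spmx p).
  by rewrite /unitary /spmx -kblock_adj -kblockM -qCM
    (eqP (Sp1P p)) qC1 kblock_one.
split=> //; have := u;
  rewrite /unitary /spmx -kblock_adj qC_conj kblock_conj det2.
move/(congr1 (fun M : 'M[C]_2 => M 0 0)); rewrite mulmx2E !mx22E
  [1%:M _ _]mxE eqxx => h.
by rewrite -[RHS]h; ring.
Qed.

Lemma spmx_inj : injective spmx.
Proof. by move=> p q /(can_inj (@kblockK R))/qC_inj/val_inj. Qed.

(** The conjugate transpose of a unitary matrix of determinant 1 is its inverse, hence its adjugate;
    comparing entries yields the shape of the block of a real quaternion. *)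
Lemma spmx_surj (A : 'M[C]_2) : unitary A -> \det A = 1 -> exists p, spmx p = A.
Proof.
move=> uA dA.
have adjA : cconj A^T = madj A.
  have AA : A *m madj A = 1%:M.
    by apply: mx2P; rewrite mulmx2E !mx22E [RHS]mxE /= -?dA ?det2; ring.
  by rewrite -[LHS]mulmx1 -AA mulmxA uA mul1mx.
have a11 : A 1 1 = conjc (A 0 0).
  have := congr1 (fun M : 'M[C]_2 => M 0 0) adjA.
  by rewrite cconjE [A^T _ _]mxE mx22E.
have a10 : A 1 0 = - conjc (A 0 1).
  have := congr1 (fun M : 'M[C]_2 => M 1 0) adjA.
  by rewrite cconjE [A^T _ _]mxE mx22E => ->; rewrite opprK.
pose q : quat R := mkq (complex.Re (A 0 0)) (complex.Im (A 0 0))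
  (complex.Re (A 0 1))
    (complex.Im (A 0 1)).
have kq : kblock (qC q) = A.
  apply: mx2P; rewrite kblockE !qco_qC !mkqE ?a11 ?a10; case: (A 0 0) (A 0 1) =>
    [? ?] [? ?];
  by apply/eqP; rewrite eq_complex /=; apply/andP; split; apply/eqP; ring.
suff qq : qconj q * q == 1 by exists (MkSp1 qq).
apply/eqP/qC_inj/(can_inj (@kblockK R)).
by rewrite qCM kblockM kblock_adj kq uA qC1 kblock_one.
Qed.

(* The exponents are chosen so that a b det U det V = 1 holds identically and
   so that the fibre over the identity is the given group of order 16. *)
Definition covering (g : G6 R) : 'End(jordan C) :=
  let: (p, t1, t2, t3, B1, B2) := g in
  Phi (spmx p) (U1val t1 ^+ 2) (U1val t1 ^+ 4 * U1val t2 ^+ 2 *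
    U1val t3 ^+ 4)^-1
    (U1val t3 *: SUval B1) (U1val t1 * U1val t2 * U1val t3 *: SUval B2).

Lemma coveringM g h : covering (g * h)%g = (covering g \o covering h)%VF.
Proof.
case: g h => [[[[[p t1] t2] t3] B1] B2] [[[[[p' t1'] t2'] t3'] B1'] B2'].
rewrite /covering -PhiM /= -spmxM -!scalemxAl -!scalemxAr !scalerA.
congr Phi.
- exact: exprMn.
- by rewrite -invfM; congr (_^-1); ring.
- congr (_ *: _); ring.
Qed.

Lemma covering1 : covering 1%g = \1%VF.
Proof.
by rewrite -[RHS]Phi1 /covering /= spmx1 !expr1n !mulr1 invr1 !scale1r.
Qed.

Lemma covering_cent g : cent (covering g).
Proof.
case: g => [[[[[p t1] t2] t3] B1] B2].
have [up dp] := spmx_unitary p.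
have [uB1 dB1] := SU_unitary B1; have [uB2 dB2] := SU_unitary B2.
have u1 := U1_unimod t1; have u2 := U1_unimod t2; have u3 := U1_unimod t3.
have z1 := unimod_neq0 u1; have z2 := unimod_neq0 u2; have z3 := unimod_neq0 u3.
have uX (z : C) n : unimod z -> unimod (z ^+ n).
  by move=> uz; elim: n => [|n IH]; rewrite ?exprS;
    [rewrite /unimod mulr1 rmorph1 | exact: unimodM].
apply: Phi_cent => //.
- exact: unitaryZ.
- by apply: unitaryZ => //; do 2?[apply: unimodM].
- exact: uX.
- by apply: unimodV; apply: unimodM; [apply: unimodM|]; apply: uX.
- by rewrite !detZ dB1 dB2 !mulr1; field; rewrite z1 z2 z3.
Qed.

End Cover.

(** * Surjectivity onto the centralizer *)

Section Surjectivity.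
Variable R : realType.
Local Notation C := R[i].

Lemma mx_ext (A B : 'M[C]_2) : (forall x : 'cV[C]_2, A *m x = B *m x) -> A = B.
Proof.
move=> h; apply/matrixP => i j; have := congr1 (fun v : 'cV[C]_2 => v i 0)
  (h (delta_mx j 0)).
by rewrite -!colE !mxE.
Qed.

Lemma sqrtC_unimod (z : C) : unimod z -> unimod (sqrtC z).
Proof.
move=> /unimodP/eqP uz; apply/unimodP/eqP.
by apply: (pexpIrn (n := 2)); rewrite ?nnegrE // -normrX sqrtCK uz expr1n.
Qed.

(** Matching a U = E, a V = G and p / a = N1 requires det(a N1) = 1, after which U and V are forced.
    The quotient of alpha by the element so built acts trivially on e, g and n1, and rigidity
    concludes. *)
Lemma covering_surj (alpha : 'End(jordan C)) : cent alpha -> exists g,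
  covering g = alpha.
Proof.
move=> ca; have [_ _ ha _ _] := (centP alpha).1 ca.
have [l [r [t [E [F [G [H [N1 [N2 [tW [tP [tQ [b [w0 p0 q0]]]]]]]]]]]]]] :=
  cent_block_form ca; rewrite /block_form in b.
have [uE uG uN] := block_unitary ha b w0 p0 q0.
pose d := \det N1; have ud : unimod d by exact: unimod_det.
(* A fourth root is taken because a = c^2 must itself be the square of the first U(1) coordinate,
   while a^2 det N1 = 1. *)
pose c := (sqrtC (sqrtC d))^-1.
have uc : unimod c by do 2![apply: unimodV || apply: sqrtC_unimod];
  apply: sqrtC_unimod.
have c0 := unimod_neq0 uc.
have cd : c ^+ 4 * d = 1.
  by rewrite /c exprVn (exprM _ 2 2) !sqrtCK mulVf // unimod_neq0.
have uc2 : unimod (c ^+ 2) by rewrite expr2; exact: unimodM.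
have [p ep] : exists p, spmx p = c ^+ 2 *: N1.
  by apply: spmx_surj; [exact: unitaryZ | rewrite detZ -exprM].
have uU : unitary (c ^- 2 *: E) by apply: unitaryZ => //; exact: unimodV.
have uV : unitary (c ^- 2 *: G) by apply: unitaryZ => //; exact: unimodV.
(* U(2) is covered by U(1) x SU(2): divide by a square root of the determinant. *)
have sqr (A : 'M[C]_2) : unitary A -> exists z (B : SU R 2),
  unimod z /\ z *: SUval B = A.
  move=> uA; pose z := sqrtC (\det A).
  have uz : unimod z by apply: sqrtC_unimod; exact: unimod_det.
  have z0 := unimod_neq0 uz.
  have sB : is_SU (z^-1 *: A).
    apply/andP; split; first by apply/eqP/unitaryZ => //; exact: unimodV.
    by rewrite detZ exprVn sqrtCK mulVf // unimod_neq0 //; exact: unimod_det.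
  by exists z, (MkSU sB); split => //=; rewrite scalerA mulfV ?scale1r.
have [z [B1 [uz zB1]]] := sqr _ uU; have [v [B2 [uv vB2]]] := sqr _ uV.
have z0 := unimod_neq0 uz.
(* The second U(1) coordinate solves t1 t2 t3 = v with t1 = c and t3 = z. *)
have u2 : unimod (v / (c * z)) by apply: unimodM => //; apply: unimodV;
  exact: unimodM.
pose g : G6 R := (p, MkU1 ((unimodP _).1 uc), MkU1 ((unimodP _).1 u2),
  MkU1 ((unimodP _).1 uz), B1, B2).
exists g; have [beta [cb gK Kg]] := cent_has_inv (covering_cent g).
have cba := cent_comp cb ca; have [_ dba _ _ _] := (centP _).1 cba.
have aE X : alpha X = covering g
  ((beta \o alpha)%VF X) by rewrite comp_lfunE Kg.
have [l' [r' [t' [E' [F' [G' [H' [N1' [N2'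
  [tW' [tP' [tQ' [b' [w0' p0' q0']]]]]]]]]]]]]] :=
  cent_block_form cba; rewrite /block_form in b'.
have cz : c * (v / (c * z)) * z = v by field; rewrite c0 z0.
have cg : covering g = Phi (spmx p) (c ^+ 2)
    (c ^+ 4 * (v / (c * z)) ^+ 2 * z ^+ 4)^-1 (z *: SUval B1)
    (c * (v / (c * z)) * z *: SUval B2) by [].
rewrite ep zB1 cz vB2 in cg.
have gE X : (be (covering g X) = c ^+ 2 *: (c ^- 2 *: E *m be X))
    * (bg (covering g X) = c ^+ 2 *: (c ^- 2 *: G *m bg X))
    * (b1 (covering g X) = c ^- 2 *: (c ^+ 2 *: N1 *m b1 X)).
  by rewrite cg !Phi_blk.
have bE x : (be (alpha (mke x)) = E *m x) * (bg (alpha (mkg x)) = G *m x)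
    * (b1 (alpha (mk1 x)) = N1 *m x) by rewrite /mke /mkg /mk1 !b !bmkE.
have bE' x : (be ((beta \o alpha)%VF (mke x)) = E' *m x)
    * (bg ((beta \o alpha)%VF (mkg x)) = G' *m x)
    * (b1 ((beta \o alpha)%VF (mk1 x)) = N1' *m x).
  by rewrite /mke /mkg /mk1 !b' !bmkE.
have inj A (x y : 'cV[C]_2) : unitary A -> A *m x = A *m y -> x = y.
  by move=> uA h; rewrite -[x]mul1mx -[y]mul1mx -uA -!mulmxA h.
(* On the e block both alpha and [covering g] act by E, so their quotient E' is the identity; g and
   n1 are treated alike. *)
have E1 : E' = 1%:M.
  apply: mx_ext => x; rewrite mul1mx; apply: (inj _ _ _ uE).
  rewrite -(bE x) aE gE bE' -scalemxAl scalerA mulfV ?expf_neq0 //.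
  by rewrite scale1r.
have G1 : G' = 1%:M.
  apply: mx_ext => x; rewrite mul1mx; apply: (inj _ _ _ uG).
  rewrite -(bE x) aE gE bE' -scalemxAl scalerA mulfV ?expf_neq0 //.
  by rewrite scale1r.
have N11 : N1' = 1%:M.
  apply: mx_ext => x; rewrite mul1mx; apply: (inj _ _ _ uN).
  rewrite -(bE x) aE gE bE' -scalemxAl scalerA mulVf ?expf_neq0 //.
  by rewrite scale1r.
rewrite E1 G1 N11 in b'; have := rigidity dba b' w0' p0' q0' => e.
by apply/lfunP => X; rewrite aE e id_lfunE.
Qed.

End Surjectivity.

(** * The kernel of the covering *)

Section Kernel.
Variable R : realType.
Local Notation C := R[i].
Local Notation N := (nprod (nprod (Z2a R) (Z2b R)) (Z4 R)).

(** This is (-1, -E) in Sp(1) x SU(6); its signs cancel because it enters every block an even number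
    of times. The two elements of order 4 in Z_4 are sent to it. *)
Lemma PhiN1 : Phi (- 1%:M : 'M[C]_2) (-1) (-1) (- 1%:M) (- 1%:M) = \1%VF.
Proof.
have d1 : \det (- 1%:M : 'M[C]_2) = 1.
  by rewrite -scaleN1r detZ det1 mulr1 sqrrN expr1n.
have cN : cconj (- 1%:M : 'M[C]_2)^T = - 1%:M.
  by apply/matrixP => i j; rewrite !mxE rmorphN rmorph_nat eq_sym.
apply/lfunP => X; rewrite id_lfunE; apply: blkP;
  rewrite !Phi_blk ?cN ?d1 ?invrN1
  ?mulrNN ?mulNmx ?mul1mx ?scaleN1r ?opprK ?mulr1 ?mul1r //.
- by rewrite raddfN /= trmx1 mulmxN mulmx1 opprK.
- by rewrite mulmxN mulmx1 opprK.
- by rewrite mulmxN mulmx1 opprK.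
Qed.

Lemma spmxN1 : spmx (Sp1_opp 1%g : Sp1 R) = - 1%:M.
Proof.
have kN (q : quat R) : kblock (qC (- q)) = - kblock (qC q).
  have nE (M : 'M[C]_2) i j : (- M) i j = - M i j by rewrite mxE.
  by apply: mx2P; rewrite nE !kblockE !qco_qC !qcoN; apply/eqP;
    rewrite eq_complex /=; apply/andP; split; apply/eqP; ring.
by rewrite -spmx1; exact: kN.
Qed.

Lemma covering_N g : nsg_set N g -> covering g = \1%VF.
Proof.
have ii : 'i * 'i = -1 :> C by rewrite -expr2 sqr_i.
have ii4 : 'i ^+ 4 = 1 :> C by rewrite (exprM _ 2 2) sqr_i sqrrN expr1n.
case=> y [u Au [v Bv ->]] [w Dw ->]; rewrite !coveringM.
have -> : covering u = \1%VF.
  case: Au => ->; first exact: covering1.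
  rewrite -Phi1 /covering /= spmx1; congr Phi; rewrite ?scale1r //.
  + by rewrite expr1n.
  + by rewrite !expr1n sqrrN expr1n !mulr1 invr1.
  + by rewrite mulr1 mul1r scaleN1r opprK.
have -> : covering v = \1%VF.
  case: Bv => ->; first exact: covering1.
  rewrite -Phi1 /covering /= spmx1; congr Phi; rewrite ?scale1r //.
  + by rewrite expr1n.
  + by rewrite (exprM (-1) 2 2) sqrrN !expr1n !mulr1 invr1.
  + by rewrite scaleN1r opprK.
  + by rewrite mul1r mulrNN mulr1 scale1r.
have -> : covering w = \1%VF.
  case: Dw => [[[->|->]|->]|->]; first exact: covering1.
  - rewrite -Phi1 /covering /= spmx1; congr Phi; rewrite ?scale1r //.
    + by rewrite sqrrN expr1n.
    + by rewrite (exprM (-1) 2 2) sqrrN !expr1n !mulr1 invr1.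
    + by rewrite mulr1 mulrNN mulr1 scale1r.
  - rewrite -PhiN1 /covering /= spmxN1; congr Phi; rewrite ?scale1r //.
    + by rewrite ii4 sqr_i expr1n mul1r mulr1 invrN1.
    + by rewrite mulr1 ii scaleN1r.
  - rewrite -PhiN1 /covering /= spmxN1; congr Phi; rewrite ?scale1r //.
    + by rewrite sqrrN sqr_i.
    + by rewrite
      (exprM
      (- 'i) 2 2) sqrrN -(exprM _ 2 2) ii4 sqr_i expr1n mul1r mulr1 invrN1.
    + by rewrite mulr1 mulrNN ii scaleN1r.
by apply/lfunP => X; rewrite !comp_lfunE !id_lfunE.
Qed.

Definition sgU (b : bool) : U1 R := if b then U1_opp 1%g else 1%g.
Definition sgSU (b : bool) : SU R 2 := if b then SU2_opp 1%g else 1%g.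

Lemma sgUE b : U1val (sgU b) = (-1) ^+ b.
Proof. by case: b; rewrite ?expr0 ?expr1. Qed.

Lemma G6_eq (x y : G6 R) :
  x.1.1.1.1.1 = y.1.1.1.1.1 -> x.1.1.1.1.2 = y.1.1.1.1.2 ->
  x.1.1.1.2 = y.1.1.1.2 -> x.1.1.2 = y.1.1.2 -> x.1.2 = y.1.2 -> x.2 = y.2 ->
  x = y.
Proof.
case: x y => [[[[[? ?] ?] ?] ?] ?] [[[[[? ?] ?] ?] ?] ?] /=.
by do 6![move=> ->].
Qed.

(** The sign d comes from the first Z_2 and b from the second; both affect the second U(1)
    coordinate, hence the exclusive or. *)
Lemma N_mem (b d : bool) (w : G6 R) : Z4_set w ->
  nsg_set N (((1, 1, sgU (b (+) d), sgU b, sgSU b, sgSU d) : G6 R) * w)%g.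
Proof.
move=> Dw.
exists ((1, 1, sgU (b (+) d), sgU b, sgSU b, sgSU d) : G6 R)%g;
  last by exists w.
exists ((1, 1, sgU d, 1, 1, sgSU d) : G6 R)%g.
  by case: d; [right | left].
exists ((1, 1, sgU b, sgU b, sgSU b, 1) : G6 R)%g.
  by case: b; [right | left].
apply: G6_eq; apply: val_inj => /=.
- by rewrite mulr1.
- by rewrite mulr1.
- by rewrite !sgUE -signr_addb addbC.
- by rewrite mul1r.
- by rewrite mul1mx.
- by rewrite mulmx1.
Qed.

Lemma sqr_sign (z : C) : z ^+ 2 = 1 -> exists b : bool, z = (-1) ^+ b.
Proof.
move/eqP; rewrite sqrf_eq1 => /orP[/eqP->|/eqP->]; first by exists false.
by exists true; rewrite expr1.
Qed.

Lemma scalar_col (k : C) (A : 'M[C]_2) :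
  (forall x : 'cV[C]_2, k *: (A *m x) = x) -> k *: A = 1%:M.
Proof. by move=> h; apply: mx_ext => x; rewrite -scalemxAl h mul1mx. Qed.

(** The blocks n1 and n2 make p equal to both scalars a and c, and s gives a c = 1, so a is a sign.
    Determinants on e and g then make t3 and t1 t2 t3 signs, and t1 is a square root of a: four
    independent signs k, b, d, m for the sixteen elements. *)
Lemma covering_ker g : covering g = \1%VF -> nsg_set N g.
Proof.
case: g => [[[[[p t1] t2] t3] B1] B2].
set a := U1val t1 ^+ 2; set c := (U1val t1 ^+ 4 * U1val t2 ^+ 2 *
  U1val t3 ^+ 4)^-1.
rewrite /covering -/a -/c => e.
have ii : 'i%C * 'i%C = -1 :> C by rewrite -expr2 sqr_i.
have z1 : U1val t1 != 0 := U1_neq0 t1; have z3 : U1val t3 != 0 := U1_neq0 t3.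
have a0 : a != 0 by rewrite expf_neq0.
have e1 : a^-1 *: spmx p = 1%:M.
  by apply: scalar_col => x; have := congr1
    (fun f : 'End(_) => b1 (f (mk1 x))) e;
    rewrite /= Phi_blk id_lfunE /mk1 !bmkE.
have e2 : c^-1 *: spmx p = 1%:M.
  by apply: scalar_col => x; have := congr1
    (fun f : 'End(_) => b2 (f (mk2 x))) e;
    rewrite /= Phi_blk id_lfunE /mk2 !bmkE.
have e3 : a *: (U1val t3 *: SUval B1) = 1%:M.
  by apply: scalar_col => x; have := congr1
    (fun f : 'End(_) => be (f (mke x))) e;
    rewrite /= Phi_blk id_lfunE /mke !bmkE.
have e4 : a *: (U1val t1 * U1val t2 * U1val t3 *: SUval B2) = 1%:M.
  by apply: scalar_col => x; have := congr1
    (fun f : 'End(_) => bg (f (mkg x))) e;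
    rewrite /= Phi_blk id_lfunE /mkg !bmkE.
have ac : a * c = 1.
  by have := congr1 (fun f : 'End(_) => bs (f (mks 1))) e;
    rewrite /= Phi_blk id_lfunE /mks !bmkE mulr1.
have pa : spmx p = a%:M.
  by rewrite -scalemx1 -e1 scalerA mulfV ?scale1r.
have ca : c = a.
  have h : c^-1 * a = 1.
    have := congr1 (fun M : 'M[C]_2 => M 0 0) e2; rewrite pa.
    by rewrite [LHS]mxE [a%:M _ _]mxE [1%:M _ _]mxE eqxx !mulr1n.
  have c0 : c != 0 by apply/eqP => c0; move/eqP: ac;
    rewrite c0 mulr0 eq_sym oner_eq0.
  by rewrite -[LHS]mulr1 -h mulrA mulfV ?mul1r.
have aa : a ^+ 2 = 1 by rewrite expr2 -{2}ca.
have [k ak] := sqr_sign aa.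
have [_ dB1] := SU_unitary B1; have [_ dB2] := SU_unitary B2.
have [b tb] : exists b : bool, U1val t3 = (-1) ^+ b.
  apply: sqr_sign; have := congr1 determinant e3.
  by rewrite !detZ det1 dB1 aa mul1r mulr1.
have [d td] : exists d : bool, U1val t1 * U1val t2 * U1val t3 = (-1) ^+ d.
  apply: sqr_sign; have := congr1 determinant e4.
  by rewrite !detZ det1 dB2 aa mul1r mulr1.
have sg2 (m : bool) : (-1) ^+ m * (-1) ^+ m
  = 1 :> C by rewrite -signr_addb addbb.
have B1E : SUval B1 = (-1) ^+ (k (+) b) *: 1%:M.
  by rewrite -e3 ak tb !scalerA signr_addb mulrACA !sg2 mulr1 scale1r.
have B2E : SUval B2 = (-1) ^+ (k (+) d) *: 1%:M.
  by rewrite -e4 ak td !scalerA signr_addb mulrACA !sg2 mulr1 scale1r.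
have t2E : U1val t2 = (-1) ^+ (b (+) d) * (U1val t1)^-1.
  rewrite addbC signr_addb -td -tb; have := sg2 b; rewrite -tb => h.
  by rewrite -(mulrA _ (U1val t3) (U1val t3)) h mulr1 mulrAC mulfV ?mul1r.
have pE : p = (if k then Sp1_opp 1 else 1)%g.
  apply: spmx_inj; rewrite pa ak; case: (k);
    rewrite ?expr1 ?expr0 ?spmxN1 ?spmx1 //.
  by rewrite raddfN.
(* As t1^2 = a = (-1)^k, t1 is i or 1 up to a sign m. *)
have [m t1E] : exists m : bool, U1val t1 = (-1) ^+ m * (if k then 'i%C else 1).
  have [|m hm] := @sqr_sign (U1val t1 / (if k then 'i%C else 1)).
    rewrite expr_div_n -/a ak; case: (k);
      rewrite ?sqr_i ?expr1 ?expr0 ?expr1n ?divr1 //.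
    by rewrite divff // oppr_eq0 oner_eq0.
  exists m; rewrite -hm divfK //; case: (k); rewrite ?oner_neq0 //;
    exact: ci_neq0.
(* The element of Z_4 with the same p and t1. Its SU(2) entries absorb (-1)^k from B1 but nothing
   from B2, so the signs left over are b and k + d. *)
pose w : G6 R := if k then (if m then (Sp1_opp 1, U1_opp (U1_i R), U1_opp
  (U1_i R), 1, SU2_opp 1, 1)
   else (Sp1_opp 1, U1_i R, U1_i R, 1, SU2_opp 1, 1))%g
  else (if m then (1, U1_opp 1, U1_opp 1, 1, 1, 1) else (1, 1, 1, 1, 1, 1))%g.
have Dw : Z4_set w.
  rewrite /w; case: (k); case: (m); [right | left; right | left; left; right |
    left; left; left]; by [].
have := @N_mem b (k (+) d) w Dw.
suff -> : ((1, 1, sgU (b (+) (k (+) d)), sgU b, sgSU b, sgSU (k (+) d)) * w)%g =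
  (p, t1, t2, t3, B1, B2) :> G6 R by [].
have iV : 'i%C^-1 = - 'i%C :> C.
  by apply: (mulfI (ci_neq0 R)); rewrite mulfV ?ci_neq0 // mulrN ii opprK.
apply: G6_eq; [| apply: val_inj ..]; rewrite /w.
- by rewrite pE; case: (k); case: (m); exact: mul1g.
- rewrite /= t1E; case: (k); case: (m); rewrite /= ?expr1 ?expr0; ring.
- rewrite /= t2E t1E sgUE; case: (k); case: (m); case: (b); case: (d);
    rewrite /= ?expr1 ?expr0 ?mulr1 ?mul1r ?invfM ?invrN1 ?invr1 ?iV; ring.
- by rewrite /= tb -sgUE; case: (k); case: (m); rewrite /= mulr1.
- rewrite /= B1E; case: (k); case: (m); case: (b);
    by rewrite /= ?expr1 ?expr0 ?mulNmx ?mul1mx ?mulmx1 ?scale1r ?scaleN1r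
      ?opprK.
- rewrite /= B2E; case: (k); case: (m); case: (d);
    by rewrite /= ?expr1 ?expr0 ?mulNmx ?mul1mx ?mulmx1 ?scale1r ?scaleN1r
      ?opprK.
Qed.

End Kernel.

(** The intersection carries no bundled group structure, so the isomorphism is expressed by an
    injective map that turns products into compositions and has the intersection as its range. *)
Theorem theorem4p9p3 (R : realType) :
  exists f : quotg (nprod (nprod (Z2a R) (Z2b R)) (Z4 R)) ->
             'End(jordan R[i]),
    [/\ forall x y, f (x * y)%g = (f x \o f y)%VF,
        injective f &
        range f = (E6fix (sigma3 R) `&` E6fix (nu3 R))%classic].
Proof.
set N := nprod _ _.
(* The fibres of [covering] are the cosets; inverses of its values are supplied by
   [covering g^-1]. *)
have eN (g h : G6 R) : nsg_set N (g^-1 * h)%g <-> covering g = covering h.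
  have gV : (covering g \o covering g^-1%g)%VF = \1%VF.
    by rewrite -coveringM mulgV covering1.
  have gV' : (covering g^-1%g \o covering g)%VF = \1%VF.
    by rewrite -coveringM mulVg covering1.
  split=> [/covering_N | e].
    rewrite coveringM => e; rewrite -[LHS]comp_lfun1r -e comp_lfunA gV.
    by rewrite comp_lfun1l.
  by apply: covering_ker; rewrite coveringM -e gV'.
have rE (g : G6 R) : covering (repr (\pi_(quotg N) g)%qT) = covering g.
  by apply/eN/quotg_eqP; rewrite reprK.
(* The value at a coset is taken at its chosen representative, and [rE] gives the independence of
   that choice. *)
exists (fun x => covering (repr x)); split.
- by move=> x y; rewrite -coveringM -[RHS]rE.
- by move=> x y /eN/quotg_eqP; rewrite !reprK.
- apply/seteqP; split=> [_ [x _ <-] | alpha ca]; first exact: covering_cent.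
  have [g <-] := covering_surj ca.
  by exists (\pi_(quotg N) g)%qT; rewrite ?rE.
Qed.
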